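(* Let $\mathcal C$ be a stable convex weakly compact set of (possibly non dominated) probability measures on $\Omega$, and let $\rho(f)=\sup_{Q\in\mathcal C}E_Q(-f)$ for $f\in\mathcal C_b(\Omega)$. Let $P\in K_+$ be a probability measure belonging to the canonical $c_\rho$-class and $\mathcal S=\{Q\in\mathcal C: Q\ll P\}$, where $P$ is chosen such that $\rho(X)=\sup_{Q\in\mathcal S}E_Q(-X)$ for all $X\in\mathcal C_b(\Omega)$. Assume that, for every $s\ge0$, for all $X$ in a subset of $\mathcal C_b(\Omega)$ which is dense for the $c_\rho$-norm, there is an element $\rho_s(X)$ of $L^1_s(c_\rho)$ such that $$\rho_s(X)=\operatorname{ess\,sup}_{\{Q\in\mathcal S,\ Q\sim P\}}E_Q(-X\mid\mathcal B_s)\quad P\text{ a.s.}$$ Then for all $s$, $\rho_s$ extends to $L^1(c_\rho)$ with values in $L^1_s(c_\rho)$, and the sublinear risk measure $\rho$ on $\mathcal C_b(\Omega)$ factorizes through time on $L^1(c_\rho)$ (by means of $(\rho_s)$). In particular, for all $r\le s$ and all $X\in L^1(c_\rho)$, $$\rho_r(X)=\rho_r(-\rho_s(X))\quad\text{in }L^1(c_\rho).$$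
   Context: Path space: $\Omega$ is either $\mathcal C_0([0,\infty),\mathbb R^d)$ (continuous functions with $f(0)=0$, topology of uniform convergence on compact sets) or $D([0,\infty),\mathbb R^d)$ (càdlàg functions, Skorokhod $J_1$ topology). For $0<t<\infty$, $\Omega_t$ is $\mathcal C_0([0,t],\mathbb R^d)$ with the uniform topology in the first case; in the second case $\Omega_t=D([0,t),\mathbb R^d)$ with the topology transported from $D([0,\infty),\mathbb R^d)$ by $x\mapsto x\circ\alpha_t^{-1}$, where $\alpha_t(u)=u/(t-u)$. $\Omega_\infty=\Omega$, $\Omega_0$ is a one-point space. The restriction map $\Pi_t:\Omega\to\Omega_t$ is continuous and $\mathcal C_b(\Omega_t)$ is identified with a subspace of $\mathcal C_b(\Omega)$ via $f\mapsto f\circ\Pi_t$. $(\mathcal B_t)$ is the right-continuous (not completed) filtration generated by the open sets of the $\Omega_t$, i.e. $\mathcal B_t=\bigcap_{u>t}\Pi_u^{-1}(\mathcal B(\Omega_u))$. As a standing assumption, $\mathcal B_0$ is trivial for $P$ (every $A\in\mathcal B_0$ has $P(A)\in\{0,1\}$). $c_\rho(f)=\rho(-|f|)$; $L^1(c_\rho)$ is the Banach space obtained by separation and completion of $\mathcal C_b(\Omega)$ for $c_\rho$, $L^1_t(c_\rho)$ the closure of $\mathcal C_b(\Omega_t)$ in it. Order: $X\le Y$ in $L^1(c_\rho)$ means that $Y-X$ is a $c_\rho$-limit of nonnegative functions of $\mathcal C_b(\Omega)$. $K_+$ is the nonnegative part of the unit ball of the dual of $L^1(c_\rho)$ (elements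 represented by finite Borel measures; each $X\in L^1(c_\rho)$ determines a class in $L^1(\mu)$, $\mu\in K_+$). The canonical $c_\rho$-class is the set of $\mu\in K_+$ such that for all $X,Y\in L^1(c_\rho)$: $X=Y$ $\mu$ a.s. if and only if $X=Y$ in $L^1(c_\rho)$. For $Q\ll P$, $(\frac{dQ}{dP})_t=E_P(\frac{dQ}{dP}\mid\mathcal B_t)$. A convex weakly closed set $\mathcal C$ of probability measures on $(\Omega,\mathcal B(\Omega))$ is stable if for all $P,Q\in\mathcal C$ with $Q\ll P$ and every stopping time $\tau$ there is $R\in\mathcal C$, $R\ll P$, such that $(\frac{dR}{dP})_t=(\frac{dQ}{dP})_t$ for $t\le\tau$ and $(\frac{dR}{dP})_t=(\frac{dQ}{dP})_\tau$ for $t\ge\tau$. For such weakly compact $\mathcal C$, measures $P$ as in the claim exist. $\rho$ factorizes through time on $L^1(c_\rho)$ if there is a family $\rho_s:L^1(c_\rho)\to L^1_s(c_\rho)$, $s\ge0$, each monotone ($X\le Y\Rightarrow\rho_s(X)\ge\rho_s(Y)$), translation invariant ($\rho_s(X+Y)=\rho_s(X)-Y$ for $Y\in L^1_s(c_\rho)$) and sublinear (subadditive and positively homogeneous), time consistent ($\rho_r(X)=\rho_r(-\rho_s(X))$ for $r\le s$), with $\rho_s(fX)\le f\rho_s(X)$ for all $f\in\mathcal C_b(\Omega_s)$, $f\ge0$, and $X\in L^1(c_\rho)$, and with $\rho_0(X)=\rho(X)$ for all $X\in\mathcal C_b(\Omega)$. *)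

(* Defs.v *)
From HB Require Import structures.
From mathcomp Require Import all_boot all_order all_algebra.
From mathcomp Require Import all_classical all_reals all_analysis.

Set Implicit Arguments.
Unset Strict Implicit.
Unset Printing Implicit Defensive.

Import Order.TTheory GRing.Theory Num.Theory.
Import numFieldNormedType.Exports.

Local Open Scope classical_set_scope.
Local Open Scope ring_scope.

(* A function on a time interval I is represented by a total function R -> V
   that vanishes outside I, so that Leibniz equality of paths is equality of
   functions on I. *)

Section paths.
Context {R : realType} (d : nat).
Local Notation V := 'rV[R]_d.

Definition supported_on (I : set R) (f : R -> V) := forall s, ~ I s -> f s = 0.

Definition C0paths (I : set R) : set (R -> V) :=
  [set f : R -> V | [/\ {within I, continuous f}, f 0 = 0 & supported_on I f]].

(* Meant for the intervals [0, +oo[ and [0, t[, for which the one-sided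
   neighborhoods of a point of I are eventually contained in I. *)
Definition cadlag (W : topologicalType) (I : set R) (f : R -> W) :=
  (forall s, I s -> f x @[x --> s^'+] --> f s) /\
  (forall s, I s -> 0 < s -> exists l : W, f x @[x --> s^'-] --> l).

Definition Dpaths (I : set R) : set (R -> V) :=
  [set f : R -> V | cadlag I f /\ supported_on I f].

(* Compact convergence on R coincides here with compact convergence on
   [0, +oo[, because the paths vanish on the negative half-line. *)
Definition C0_space : Type :=
  set_type (C0paths `[0, +oo[ : set {family compact, R -> V}).
Definition C0_space_upto (t : R) : Type :=
  set_type (C0paths `[0, t] : set {uniform` `[0, t] -> V}).

HB.instance Definition _ := Topological.on C0_space.
HB.instance Definition _ (t : R) := Topological.on (C0_space_upto t).

Definition D_space : Type := set_type (Dpaths `[0, +oo[).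
Definition D_space_upto (t : R) : Type := set_type (Dpaths `[0, t[).

Lemma supported_restrict (f : R -> V) (I : set R) : supported_on I (patch (fun=> 0) I f).
Proof. by move=> s nIs; rewrite /patch memNset. Qed.

Lemma C0paths0 (I : set R) : C0paths I (fun=> 0).
Proof. by split=> //; apply: continuous_subspaceT => x; exact: cst_continuous. Qed.

Lemma Dpaths0 (I : set R) : Dpaths I (fun=> 0).
Proof.
by split=> //; split=> [s _|s _ _]; [|exists 0]; exact: cvg_cst.
Qed.

Lemma C0paths_restrict (f : R -> V) (t : R) :
  C0paths `[0, +oo[ f -> C0paths `[0, t] (patch (fun=> 0) `[0, t] f).
Proof.
move=> [fc f0 _]; split; last exact: supported_restrict.
  have fct : {within `[0, t], continuous f}.
    apply: continuous_subspaceW fc => x /=.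
    by rewrite !in_itv/= andbT => /andP[].
  apply: (@subspace_eq_continuous _ _ _ f) fct => x xI.
  by rewrite /from_subspace /patch xI.
by rewrite /patch; case: ifP.
Qed.

Lemma Dpaths_restrict (f : R -> V) (t : R) :
  Dpaths `[0, +oo[ f -> Dpaths `[0, t[ (patch (fun=> 0) `[0, t[ f).
Proof.
move=> [[fr fl] _]; split; last exact: supported_restrict.
split=> [s|s] /=; rewrite in_itv/= => /andP[s0 st].
  rewrite /patch mem_set/= ?in_itv/= ?s0//.
  have fs : f x @[x --> s^'+] --> f s by apply: fr; rewrite /= in_itv/= s0.
  apply: cvg_trans fs; apply: near_eq_cvg; near=> x.
  rewrite /patch mem_set//= in_itv/=; apply/andP; split.
    by apply: (le_trans s0); near: x; exact: nbhs_right_ge.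
  by near: x; exact: nbhs_right_lt.
move=> s_gt0.
have [|l fs] := fl s _ s_gt0; first by rewrite /= in_itv/= s0.
exists l; apply: cvg_trans fs.
apply: near_eq_cvg; near=> x.
rewrite /patch mem_set//= in_itv/=; apply/andP; split.
  by near: x; apply: nbhs_left_ge.
by apply: le_lt_trans st; near: x; exact: nbhs_left_le.
Unshelve. all: by end_near. Qed.

Definition C0_restr (t : R) (f : C0_space) : C0_space_upto t :=
  exist (fun g => g \in C0paths `[0, t]) _
    (mem_set (C0paths_restrict t (set_mem (valP f)))).

Definition D_restr (t : R) (f : D_space) : D_space_upto t :=
  exist (fun g => g \in Dpaths `[0, t[) _
    (mem_set (Dpaths_restrict t (set_mem (valP f)))).

HB.instance Definition _ := isPointed.Build C0_space
  (exist (fun g => g \in C0paths `[0, +oo[) _ (mem_set (C0paths0 `[0, +oo[))).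

(* A strictly increasing bijection of [0, +oo[ is a homeomorphism. *)
Definition time_change (lam : R -> R) :=
  set_bij `[0, +oo[ `[0, +oo[ lam /\
  {in `[0, +oo[ &, {homo lam : s u / s < u}}.

(* These sets, for N and e > 0, form a neighborhood base of x: x_n tends to x
   for J1 iff there are time changes lam_n with lam_n -> id uniformly on
   [0, +oo[ and x_n \o lam_n -> x uniformly on each [0, N]. *)
Definition J1_ball (x : D_space) (N e : R) : set D_space :=
  [set y | exists2 lam, time_change lam &
    (forall s, 0 <= s -> `|lam s - s| < e) /\
    (forall s, 0 <= s <= N -> `|val y (lam s) - val x s| < e)].

Definition J1_open : set (set D_space) :=
  [set O | forall x, O x -> exists N e, 0 < e /\ J1_ball x N e `<=` O].

Lemma sub_J1_ball (x : D_space) (M N e e' : R) :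
  N <= M -> e' <= e -> J1_ball x M e' `<=` J1_ball x N e.
Proof.
move=> NM ee' y [lam lamP [lam1 lam2]]; exists lam => //; split=> s s0.
  exact: lt_le_trans (lam1 _ s0) ee'.
apply: lt_le_trans (lam2 s _) ee'.
by case/andP: s0 => -> /le_trans ->.
Qed.

Lemma J1_openT : J1_open setT.
Proof. by move=> x _; exists 0, 1; split. Qed.

Lemma J1_openI : setI_closed J1_open.
Proof.
move=> A B oA oB x [/oA[N [e [e0 sA]]] /oB[M [e' [e'0 sB]]]].
exists (Num.max N M), (Num.min e e'); split; first by rewrite lt_min e0.
move=> y xy; split; [apply: sA|apply: sB]; apply: sub_J1_ball xy.
- by rewrite le_max lexx.
- by rewrite ge_min lexx.
- by rewrite le_max lexx orbT.
- by rewrite ge_min lexx orbT.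
Qed.

Lemma J1_open_bigU (I : Type) (f : I -> set D_space) :
  (forall i, J1_open (f i)) -> J1_open (\bigcup_i f i).
Proof.
move=> of_ x [i _ /of_[N [e [e0 sf]]]].
by exists N, e; split=> // y /sf fy; exists i.
Qed.

HB.instance Definition _ := Choice.on D_space.
HB.instance Definition _ := isPointed.Build D_space
  (exist (fun g => g \in Dpaths `[0, +oo[) _ (mem_set (Dpaths0 `[0, +oo[))).
HB.instance Definition _ :=
  isOpenTopological.Build D_space J1_openT J1_openI J1_open_bigU.

(* x |-> x \o alpha_t^-1 on [0, +oo[, where alpha_t u = u / (t - u), i.e.
   alpha_t^-1 v = t v / (1 + v). *)
Definition stretch_fun (t : R) (x : R -> V) : R -> V :=
  patch (fun=> 0) `[0, +oo[ (fun v => x (t * v / (1 + v))).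

Lemma Dpaths_stretch (t : R) (x : R -> V) :
  Dpaths `[0, t[ x -> Dpaths `[0, +oo[ (stretch_fun t x).
Proof.
move=> [[xr xl] x0]; split; last exact: supported_restrict.
have [t0|t0] := leP t 0.
  have x_eq0 s : x s = 0.
    apply: x0; rewrite /= in_itv/= => /andP[s0 st].
    by have := le_lt_trans s0 st; rewrite ltNge t0.
  have -> : stretch_fun t x = fun=> 0.
    by apply/funext => v; rewrite /stretch_fun /patch x_eq0; case: ifP.
  by have [] := Dpaths0 `[0, +oo[.
pose a v := t * v / (1 + v).
have a_cont v : 0 <= v -> {for v, continuous a}.
  move=> v0; apply: cvgM; first by apply: cvgMr; exact: cvg_id.
  apply: cvgV; first by rewrite gt_eqF// ltr_wpDr.
  by apply: cvgD; [exact: cvg_cst|exact: cvg_id].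
have a_homo u v : 0 <= u -> u < v -> a u < a v.
  move=> u0 uv; have v0 : 0 <= v by rewrite (le_trans u0)// ltW.
  rewrite /a ltr_pdivrMr ?ltr_wpDr// mulrAC ltr_pdivlMr ?ltr_wpDr//.
  by rewrite !mulrDr !mulr1 -!mulrA (mulrC u v) ltrD2r ltr_pM2l.
have a_range v : 0 <= v -> 0 <= a v < t.
  move=> v0; rewrite /a divr_ge0 ?mulr_ge0 ?addr_ge0 ?(ltW t0)//=.
  rewrite ltr_pdivrMr ?ltr_wpDr// mulrDr mulr1 ltrDr//.
split=> [v|v] /=; rewrite in_itv/= andbT => v0.
  have av : x y @[y --> (a v)^'+] --> x (a v).
    by apply: xr; rewrite /= in_itv/= a_range.
  have aR : a y @[y --> v^'+] --> (a v)^'+.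
    move=> A; rewrite /at_right !nbhs_simpl /within/= => Aa.
    have := a_cont v v0 _ Aa; rewrite nbhs_simpl/=.
    apply: filterS => y Ay vy; apply: Ay; exact: a_homo.
  rewrite /stretch_fun /patch mem_set/= ?in_itv/= ?v0//.
  have xa : x (a y) @[y --> v^'+] --> x (a v).
    exact: (cvg_comp _ _ aR av).
  apply: cvg_trans xa; apply: near_eq_cvg; near=> y.
  rewrite /patch mem_set//= in_itv/= andbT.
  by apply: (le_trans v0); near: y; exact: nbhs_right_ge.
move=> v_gt0.
have [l av] : exists l : V, x y @[y --> (a v)^'-] --> l.
  apply: xl; first by rewrite /= in_itv/= a_range.
  by rewrite /a divr_gt0 ?mulr_gt0// ltr_wpDr.
have aL : a y @[y --> v^'-] --> (a v)^'-.
  move=> A; rewrite /at_left !nbhs_simpl /within/= => Aa.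
  have := a_cont v v0 _ Aa; rewrite nbhs_simpl/=.
  have : \forall y \near v, 0 <= y 
    by apply: filterS (lt_nbhsr v_gt0) => y /ltW.
  apply: filterS2 => y y0 Ay yv; apply: Ay; exact: a_homo.
exists l.
have xa : x (a y) @[y --> v^'-] --> l by exact: (cvg_comp _ _ aL av).
apply: cvg_trans xa; apply: near_eq_cvg; near=> y.
rewrite /stretch_fun /patch mem_set//= in_itv/= andbT.
by near: y; apply: nbhs_left_ge.
Unshelve. all: by end_near. Qed.

Definition stretch (t : R) (x : D_space_upto t) : D_space :=
  exist (fun g => g \in Dpaths `[0, +oo[) _
    (mem_set (Dpaths_stretch (set_mem (valP x)))).

HB.instance Definition _ (t : R) := Choice.on (D_space_upto t).
HB.instance Definition _ (t : R) :=
  Topological.copy (D_space_upto t) (initial_topology (@stretch t)).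

End paths.

(* path_upto and restr are only meaningful for nonnegative times. *)
Record path_space (R : realType) := PathSpace {
  path :> ptopologicalType;
  path_upto : R -> topologicalType;
  restr : forall t : R, path -> path_upto t
}.
Arguments restr {R} p t _.

Definition continuous_paths (R : realType) (d : nat) : path_space R :=
  @PathSpace R (@C0_space R d) (@C0_space_upto R d) (@C0_restr R d).

Definition cadlag_paths (R : realType) (d : nat) : path_space R :=
  @PathSpace R (@D_space R d) (@D_space_upto R d) (@D_restr R d).

Definition Cb (R : realType) (T : topologicalType) : set (T -> R) :=
  [set f : T -> R | continuous f /\ bounded_fun f].
Arguments Cb : clear implicits.

Definition Borel (T : ptopologicalType) := g_sigma_algebraType (@open T).

Section filtration.
Context {R : realType} (Om : path_space R).

Definition Cb_upto (t : R) : set (Om -> R) :=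
  [set f \o restr Om t | f in Cb R (path_upto Om t)].

Definition Borel_upto (t : R) : set (set Om) :=
  [set restr Om t @^-1` A | A in <<s @open (path_upto Om t) >>].

Definition filtration (t : R) : set (set Om) :=
  [set A | forall u, t < u -> Borel_upto u A].

Definition stopping_time (tau : Om -> \bar R) :=
  (forall w, (0%:E <= tau w)%E) /\
  (forall t, 0 <= t -> filtration t [set w | (tau w <= t%:E)%E]).

End filtration.
Arguments Cb_upto {R} Om t _.
Arguments filtration {R} Om t _.
Arguments stopping_time {R} Om tau.

Section conditional.
Context d (T : measurableType d) {R : realType}.
Implicit Types (P : probability T R) (G : set (set T)).

(* Y is a version of E_P(X | G), for a P-integrable X and a sub-sigma-algebra G
   of the measurable sets of T. *)
Definition is_cond_exp P G (X : T -> \bar R) (Y : T -> R) :=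
  [/\ forall B : set R, measurable B -> G (Y @^-1` B),
      P.-integrable setT (EFin \o Y) &
      forall A, G A -> (\int[P]_(w in A) (Y w)%:E = \int[P]_(w in A) X w)%E].

(* Y is a version of the P-essential supremum of the functions in F. *)
Definition is_ess_sup P (F : set (T -> R)) (Y : T -> R) :=
  [/\ measurable_fun setT Y,
      forall Z, F Z -> {ae P, forall w, Z w <= Y w} &
      forall Y', measurable_fun setT Y' ->
        (forall Z, F Z -> {ae P, forall w, Z w <= Y' w}) ->
        {ae P, forall w, Y w <= Y' w}].

End conditional.

Section stability.
Context {R : realType} (Om : path_space R).
Local Notation prob := (probability (Borel Om) R).

(* Topology of convergence of Q |-> E_Q(f) for every bounded continuous f. *)
Definition weak_prob :=
  initial_topology (fun Q : prob =>
    (fun f : set_type (Cb R Om) => \int[Q]_w (val f w)) :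
      {ptws set_type (Cb R Om) -> R}).

(* Quantifying over all R' makes C insensitive to the values that measures,
   as functions on all subsets of Om, take on non-Borel sets. *)
Definition convex_probs (C : set prob) :=
  forall P Q : prob, C P -> C Q -> forall a : R, 0 <= a <= 1 ->
  forall R' : prob,
    (forall A, measurable A -> R' A = (a%:E * P A + (1 - a)%:E * Q A)%E) ->
  C R'.

Definition density_cond_exp (P Q : prob) (t : R) (Y : Om -> R) :=
  is_cond_exp P (filtration Om t)
    (Radon_Nikodym (charge_of_finite_measure Q) P) Y.

(* A P-a.s. cadlag version of the martingale ((dQ/dP)_t)_t. It exists because
   the filtration is right-continuous, and it is unique up to
   indistinguishability, so that its value at a random time makes sense. *)
Definition density_process (P Q : prob) (Z : R -> Om -> R) :=
  (forall t, 0 <= t -> density_cond_exp P Q t (Z t)) /\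
  {ae P, forall w, cadlag `[0, +oo[ (Z ^~ w)}.

Definition stable (C : set prob) :=
  [/\ convex_probs C, closed (C : set weak_prob) &
    forall P Q : prob, C P -> C Q -> Q `<< P ->
    forall tau : Om -> \bar R, stopping_time Om tau ->
    exists2 R' : prob, C R' /\ R' `<< P &
      exists ZQ ZR, [/\ density_process P Q ZQ, density_process P R' ZR &
        {ae P, forall w t, 0 <= t ->
          ((t%:E <= tau w)%E -> ZR t w = ZQ t w) /\
          ((tau w <= t%:E)%E -> ZR t w = ZQ (fine (tau w)) w)}]].

Definition dominated (C : set prob) (P : prob) : set prob :=
  [set Q | C Q /\ Q `<< P].

Definition risk (C : set prob) (f : Om -> R) : R :=
  sup [set \int[Q]_w (- f w) | Q in C].

End stability.

Section L1.
Context {R : realType} (Om : path_space R).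

Definition capacity (rho : (Om -> R) -> R) (f : Om -> R) : R :=
  rho (fun w => - `|f w|).

(* (L, i) is the separated completion of the seminormed space (Cb R Om, c),
   i being the canonical map (its values outside Cb R Om are irrelevant). *)
Definition is_completion (c : (Om -> R) -> R) (L : completeNormedModType R)
    (i : (Om -> R) -> L) :=
  [/\ forall (a : R) f g, Cb R Om f -> Cb R Om g ->
        i (fun w => a * f w + g w) = a *: i f + i g,
      forall f, Cb R Om f -> `|i f| = c f &
      closure (i @` Cb R Om) = setT].

Context (L : completeNormedModType R) (i : (Om -> R) -> L).

Definition L1_upto (t : R) : set L := closure (i @` Cb_upto Om t).

Definition L1_le (X Y : L) :=
  closure (i @` [set f | Cb R Om f /\ forall w, 0 <= f w]) (Y - X).

(* f X: the extension to L, by continuity, of the map g |-> f g on Cb R Om. *)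
Definition L1_mul (f : Om -> R) (X : L) : L :=
  get [set Y | exists2 g : nat -> Om -> R, (forall n, Cb R Om (g n)) &
    i (g n) @[n --> \oo] --> X /\
    i (fun w => f w * g n w) @[n --> \oo] --> Y].

Local Notation fmeas := {finite_measure set (Borel Om) -> \bar R}.

(* mu represents a nonnegative element of the unit ball of the dual of L. *)
Definition Kplus (mu : fmeas) :=
  exists l : {linear L -> R^o},
    [/\ forall X, `|l X| <= `|X|,
        forall X, L1_le 0 X -> 0 <= l X &
        forall f, Cb R Om f -> l (i f) = \int[mu]_w f w].

(* x belongs to the class in L^1(mu) determined by X. *)
Definition L1_class (mu : fmeas) (X : L) (x : Om -> R) :=
  mu.-integrable setT (EFin \o x : Borel Om -> \bar R) /\
  exists2 g : nat -> Om -> R, (forall n, Cb R Om (g n)) &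
    i (g n) @[n --> \oo] --> X /\
    (\int[mu]_w (`|g n w - x w|%:E))%E @[n --> \oo] --> 0%E.

Definition eq_as (mu : fmeas) (X Y : L) :=
  exists x y, [/\ L1_class mu X x, L1_class mu Y y &
    {ae mu, forall w, x w = y w}].

Definition canonical_class (mu : fmeas) :=
  Kplus mu /\ forall X Y, eq_as mu X Y <-> X = Y.

(* rhos s plays the role of rho_s; "in L1_upto s" uses the identification of
   Cb_upto s with its image in L. *)
Record factorizes (rho : (Om -> R) -> R) (rhos : R -> L -> L) : Prop := {
  factor_range : forall s X, 0 <= s -> L1_upto s (rhos s X);
  factor_monotone : forall s X Y, 0 <= s ->
    L1_le X Y -> L1_le (rhos s Y) (rhos s X);
  factor_translation : forall s X Y, 0 <= s ->
    L1_upto s Y -> rhos s (X + Y) = rhos s X - Y;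
  factor_subadditive : forall s X Y, 0 <= s ->
    L1_le (rhos s (X + Y)) (rhos s X + rhos s Y);
  factor_homogeneous : forall s (a : R) X, 0 <= s -> 0 <= a ->
    rhos s (a *: X) = a *: rhos s X;
  factor_consistent : forall r s X, 0 <= r <= s ->
    rhos r X = rhos r (- rhos s X);
  factor_local : forall s f X, 0 <= s -> Cb_upto Om s f ->
    (forall w, 0 <= f w) ->
    L1_le (rhos s (L1_mul f X)) (L1_mul f (rhos s X));
  factor_initial : forall X, Cb R Om X -> rhos 0 (i X) = i (fun=> rho X)
}.

End L1.

(* Main.v *)
(* For X in D s, the hypothesis provides an element Y = rho_s(X) of L^1_s whose
   P-class is an essential supremum of conditional expectations.  Stability lets
   one paste models: given Q1, Q2 equivalent to P and A in B_s, the stopping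
   time equal to s on A and to infinity off A yields a model that coincides with
   Q2 on B_s and off A, and with Q1 conditionally on B_s on A.  Hence Y is
   characterized without conditional expectations by
     E_Q(Y 1_A) = sup { E_Q'(-X 1_A) | Q' = Q on B_s },   A in B_s,
   for the models Q, Q' equivalent to P.  The right-hand side is 1-Lipschitz in
   X for the c_rho-norm, by pasting again, so that rho_s extends to L^1(c_rho)
   by density; monotonicity, sublinearity, translation invariance, locality and
   time consistency all follow by comparing the integrals E_Q(. 1_A).  Pasted
   models are identified on all Borel sets because every open set of the path
   space is a countable union of events observable at finite times. *)

Require Import Defs.
From HB Require Import structures.
From mathcomp Require Import all_boot all_order all_algebra.
From mathcomp Require Import all_classical all_reals all_analysis.
From mathcomp Require Import measurable_realfun lra ring.

Set Implicit Arguments.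
Unset Strict Implicit.
Unset Printing Implicit Defensive.

Import Order.TTheory GRing.Theory Num.Theory.
Import numFieldNormedType.Exports.

Local Open Scope classical_set_scope.
Local Open Scope ring_scope.

(** * Observable events of the path spaces *)

Section observable_events.
Context {R : realType} (Om : path_space R).

(** No countable or directed subfamily realizing the essential supremum is ever extracted. For fixed
    Q, the set function A |-> sup E_Q'(-X 1_A), over the Q' equal to Q on B_s, is additive on B_s by
    pasting and dominated by a multiple of Q, hence has a B_s-measurable density. This density lies
    above every conditional expectation of the family, and minimality of the essential supremum
    gives the nontrivial inequality. Models equivalent to P share their null sets, so almost sure
    statements pass freely between them. They suffice to compute the risk, because mixing a little
    of an equivalent model into a dominated one hardly changes integrals. Elements of L have no
    pointwise values: E_Q(. 1_A) is first extended to L by continuity, then computed from a P-class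
    representative, even when dQ/dP is unbounded. On L^1_s both norm and order are tested by
    B_s-events, namely the sign sets of approximating functions from [Cb_upto]. *)

Definition observable (t : R) : set (set Om) :=
  [set restr Om t @^-1` V | V in @open (path_upto Om t)].

(** All that the rest of the proof uses of the two path topologies. The strict [n%:R < t] in the
    last field matches the right-continuity of the filtration: each [F n] lies in
    [filtration Om n%:R]. *)
Record observation : Prop := {
  observable_open : forall t, 0 <= t -> observable t `<=` open;
  observable_lt : forall s t, 0 <= s -> s < t -> observable s `<=` observable t;
  observable_bigcup : forall O : set Om, open O ->
    exists2 F : nat -> set Om, O = \bigcup_n F n &
      forall n t, n%:R < t -> observable t (F n)
}.

Lemma observable_local (t : R) (A : set Om) :
  (forall x, A x -> exists2 U : set Om, observable t U & U x /\ U `<=` A) ->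
  observable t A.
Proof.
move=> AU; exists (\bigcup_(V in [set V | open V /\ restr Om t @^-1` V `<=` A]) V).
  by apply: bigcup_open => V [].
apply/seteqP; split=> [x [V [_ VA] Vx]|x Ax]; first exact: VA.
have [U [V oV <-] [Vx VA]] := AU _ Ax.
by exists V.
Qed.

(* B x N e stands for the paths e-close to x up to time N.  An event whose
   points have such a neighborhood inside it with N < u is observable at u. *)
Lemma observation_of_balls (B : Om -> R -> R -> set Om) :
  (forall x N e, 0 < e -> B x N e x) ->
  (forall O : set Om,
     open O <-> forall x, O x -> exists N e, 0 < e /\ B x N e `<=` O) ->
  (forall t (V : set (path_upto Om t)) x, 0 <= t -> open V ->
     V (restr Om t x) ->
     exists N e, [/\ N <= t, 0 < e & B x N e `<=` restr Om t @^-1` V]) ->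
  (forall u N e x, 0 < u -> N < u -> 0 < e ->
     exists2 U : set Om, observable u U & U x /\ U `<=` B x N e) ->
  (forall x N N' e, N < N' -> 0 < e -> exists2 e', 0 < e' &
     forall y, B x N' e' y -> B y N' e' `<=` B x N e) ->
  observation.
Proof.
move=> Bx Bopen Brestr Bobs Btrans; split.
- move=> t t0 _ [V oV <-]; apply/Bopen => x Vx.
  by have [N [e [_ e0 BV]]] := Brestr t V x t0 oV Vx; exists N, e.
- move=> s t s0 st _ [V oV <-]; apply: observable_local => x Vx.
  have [N [e [Ns e0 BV]]] := Brestr s V x s0 oV Vx.
  have [U oU [Ux UB]] :=
    Bobs t N e x (le_lt_trans s0 st) (le_lt_trans Ns st) e0.
  by exists U => //; split=> //; exact: subset_trans BV.
move=> O /Bopen BO.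
(* The n-th event collects the points whose membership in [O] is already forced by their path on a
   horizon strictly below n. *)
exists (fun n : nat => [set x | exists N e,
    [/\ N < n%:R, 0 < e & B x N e `<=` O]]).
  apply/seteqP; split=> [x /BO[N [e [e0 xO]]]|x [n _ [N [e [_ e0]]]]]; last first.
    by apply; exact: Bx.
  exists (Num.truncn `|N|).+1 => //; exists N, e; split=> //.
  by rewrite (le_lt_trans (ler_norm _))// truncnS_gt.
move=> n t nt; apply: observable_local => x [N [e [Nn e0 xO]]].
(* The midpoint leaves room on both sides: balls with horizon [N'] around nearby points still lie in
   the ball of horizon [N], and [N' < n] keeps those points in the n-th event. *)
pose N' := (N + n%:R) / 2.
have NN' : N < N' by rewrite /N'; lra.
have N'n : N' < n%:R by rewrite /N'; lra.
have [e' e'0 yB] := Btrans x N N' e NN' e0.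
have t0 : 0 < t by exact: le_lt_trans nt.
have [U oU [Ux UB]] := Bobs t N' e' x t0 (lt_trans N'n nt) e'0.
exists U => //; split=> // y /UB /yB yxB.
by exists N', e'; split=> //; exact: subset_trans xO.
Qed.

End observable_events.

(** * Continuous paths under compact convergence *)

Section continuous_observation.
Context {R : realType} (d : nat).
Local Notation V := 'rV[R]_d.
Local Notation Om := (continuous_paths R d).

(** No lower bound on [s] is imposed, since paths vanish at negative times. *)
Definition C0_ball (x : Om) (N e : R) : set Om :=
  [set y | forall s, s <= N -> `|val x s - val y s| < e].

Let entourage_norm (E : set (V * V)) : entourage E ->
  exists2 e : R, 0 < e & forall a b : V, `|a - b| < e -> E (a, b).
Proof.
rewrite -entourage_ballE => -[e /= e0 eE]; exists e => // a b ab.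
by apply: eE => /=; rewrite -ball_normE.
Qed.

Let norm_entourage (e : R) : 0 < e ->
  entourage [set p : V * V | `|p.1 - p.2| < e].
Proof.
move=> e0; rewrite -entourage_ballE; exists e => //= -[a b] /=.
by rewrite -ball_normE.
Qed.

Let val_neg (x : @C0_space R d) s : s < 0 -> val x s = 0.
Proof.
move=> s0; have [_ _] := set_mem (valP x); apply.
by rewrite /= in_itv/= andbT; apply/negP; rewrite -ltNge.
Qed.

Let val_restr t (x : @C0_space R d) s :
  [set` `[0, t]] s -> val (C0_restr t x) s = val x s.
Proof. by move=> sI; rewrite /= /patch mem_set. Qed.

Let C0_nbhs (x : @C0_space R d) (O : set {family compact, R -> V}) :
  open O -> O (val x) -> exists N e, 0 < e /\ C0_ball x N e `<=` val @^-1` O.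
Proof.
move=> oO Ox.
pose B (p : R * R) :=
  [set g : R -> V | forall s, s <= p.1 -> `|val x s - g s| < p.2].
pose F := filter_from [set p : R * R | 0 < p.2] B.
have FF : Filter F.
  apply: filter_from_filter; first by exists (0, 1) => /=.
  move=> [N e] [M e'] /= e0 e'0; exists (Num.max N M, Num.min e e') => /=.
    by rewrite lt_min e0.
  move=> g gB; split=> s /= sN; have /= := gB s; rewrite le_max sN ?orbT lt_min.
    by move=> /(_ isT) /andP[].
  by move=> /(_ isT) /andP[].
suff : {family compact, F --> (val x : R -> V)}.
  move=> Fx; have /Fx : nbhs (val x : {family compact, R -> V}) O.
    by apply: open_nbhs_nbhs; split.
  by move=> [[N e] /= e0 BO]; exists N, e; split=> // y; exact: BO.
apply/fam_cvgP => K /compact_bounded[M [_ KM]] W /uniform_nbhs[E [entE EW]].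
have [e e0 eE] := entourage_norm entE.
(* A compact set of times is bounded, so closeness up to the horizon [M + 1] is closeness on it. *)
exists (M + 1, e) => //= g gB; apply: EW => /= s Ks; apply: eE; apply: gB => /=.
apply: le_trans (ler_norm s) _; apply: KM => //; exact: ltr_pwDr.
Qed.

Lemma continuous_paths_observation : observation Om.
Proof.
apply: (@observation_of_balls _ _ C0_ball).
- by move=> x N e e0 s _; rewrite subrr normr0.
- move=> O; split=> [[W oW <-] x Wx|OB]; first exact: C0_nbhs.
  rewrite openE => x /OB[N [e [e0 xO]]].
  have : nbhs (val x : {family compact, R -> V})
      [set g | forall s, [set` `[0, N]] s -> `|val x s - g s| < e].
    apply: (@fam_nbhs _ _ _ _ [set p : V * V | `|p.1 - p.2| < e]).
      exact: norm_entourage.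
    exact: segment_compact.
  move=> /(@initial_continuous _ _ (val : @C0_space R d -> {family compact, R -> V})).
  move=> xW; rewrite nbhs_simpl /= in xW.
  apply: (@filterS _ (nbhs x) _ _ _ _ xW) => y xy; apply: xO => s sN.
  have [s0|s0] := ltP s 0; first by rewrite !val_neg// subrr normr0.
  by apply: xy; rewrite /= in_itv/= s0.
- move=> t U x t0 [W oW <-] Wx.
  have /uniform_nbhs[E [entE EW]] : nbhs (val (C0_restr t x)
      : {uniform` `[0, t] -> V}) W by apply: open_nbhs_nbhs; split.
  have [e e0 eE] := entourage_norm entE.
  exists t, e; split=> // y xy; apply: EW => s /= sI; apply: eE.
  suff : `|val (C0_restr t x) s - val (C0_restr t y) s| < e by [].
  rewrite (val_restr x sI) (val_restr y sI). apply: xy.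
  by move: sI; rewrite in_itv/= => /andP[].
move=> u N e x u0 Nu e0.
pose W := [set g : {uniform` `[0, u] -> V} |
  forall s, [set` `[0, u]] s -> `|val (C0_restr u x) s - g s| < e].
have : nbhs (val (C0_restr u x) : {uniform` `[0, u] -> V}) W.
  apply/uniform_nbhs; exists [set p : V * V | `|p.1 - p.2| < e].
  by split => //; exact: norm_entourage.
move=> /(@initial_continuous _ _
  (val : @C0_space_upto R d u -> {uniform` `[0, u] -> V})) xW.
pose A : set (@C0_space_upto R d u) := val @^-1` W.
(* A strict pointwise bound need not define an open set for uniform convergence, because the
   supremum may equal [e]; hence the interior. *)
exists (restr Om u @^-1` A^°).
  by exists A^° => //; exact: open_interior.
split=> // y /= /interior_subset /= yW s sN.
have [s0|s0] := ltP s 0; first by rewrite !val_neg// subrr normr0.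
have sI : [set` `[0, u]] s by rewrite /= in_itv/= s0/= (le_trans sN (ltW Nu)).
by have := yW s sI; rewrite /= /patch mem_set.
move=> x N N' e NN' e0; exists (e / 2); first by rewrite divr_gt0.
move=> y xy z yz s sN.
have sN' : s <= N' by exact: le_trans (ltW NN').
rewrite -(subrKA (val y s)) (le_lt_trans (ler_normD _ _))//.
by rewrite [e]splitr ltrD ?xy ?yz.
Qed.

End continuous_observation.

(** * Time changes, and the reparametrization of [0, t[ by the half-line *)

Section time_changes.
Context {R : realType}.
Implicit Types (lam kap : R -> R) (s t u v w M : R).

Lemma time_changeP lam : time_change lam <->
  [/\ forall s, 0 <= s -> 0 <= lam s,
      forall s u, 0 <= s -> s < u -> lam s < lam u &
      forall w, 0 <= w -> exists2 s, 0 <= s & lam s = w].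
Proof.
split=> [[[lam0 _ lamS] lamH]|[lam0 lamH lamS]].
  split=> [s s0|s u s0 su|w w0].
  - have := lam0 s; rewrite /= !in_itv/= !andbT; exact.
  - apply: lamH => //; rewrite in_itv/= andbT//.
    exact: le_trans (ltW su).
  - have [|s] := lamS w; rewrite /= in_itv/= andbT//.
    by move=> s0 sw; exists s.
split; last by move=> s u; rewrite !in_itv/= !andbT => s0 u0; exact: lamH.
have itvE s : [set` `[0, +oo[%R] s = (0 <= s) :> Prop.
  by rewrite /= in_itv/= andbT.
split=> [s|s u /set_mem + /set_mem|w]; rewrite ?itvE.
- exact: lam0.
- move=> s0 u0 lamE; have [su|us|//] := ltgtP s u.
    by have := lamH s u s0 su; rewrite lamE ltxx.
  by have := lamH u s u0 us; rewrite lamE ltxx.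
- by move=> /lamS[s s0 <-]; exists s; rewrite ?itvE.
Qed.

Lemma time_change_comp lam kap :
  time_change lam -> time_change kap -> time_change (kap \o lam).
Proof.
move=> /time_changeP[l0 lH lS] /time_changeP[k0 kH kS]; apply/time_changeP.
split=> [s s0|s u s0 su|w w0] /=; first exact/k0/l0.
  by apply: kH; [exact: l0|exact: lH].
have [v v0 vw] := kS _ w0; have [s s0 sv] := lS _ v0.
by exists s => //; rewrite sv.
Qed.

(** Conjugating a time change by [alpha] is controlled only on a bounded horizon, whereas a J1 ball
    asks for closeness to the identity on the whole half-line. Past [M] the displacement is frozen
    at [kap M - M], so a bound on [0, M] is a global one. *)
Definition glue kap M : R -> R :=
  fun v => if v <= M then kap v else v + (kap M - M).

Lemma time_change_glue kap M : 0 <= M ->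
  (forall v, 0 <= v <= M -> 0 <= kap v) ->
  (forall v w, 0 <= v -> v < w -> w <= M -> kap v < kap w) ->
  (forall w, 0 <= w <= kap M -> exists2 v, 0 <= v <= M & kap v = w) ->
  time_change (glue kap M).
Proof.
move=> M0 k0 kH kS; have kM0 : 0 <= kap M by rewrite k0// M0 lexx.
apply/time_changeP; rewrite /glue; split=> [s s0|s u s0 su|w w0].
- by case: (leP s M) => sM; [rewrite k0// s0|lra].
- case: (leP u M) => uM; first by rewrite (le_trans (ltW su) uM)//; exact: kH.
  case: (leP s M) => sM; last by lra.
  have : kap s <= kap M.
    move: sM; rewrite le_eqVlt => /predU1P[->//|sM].
    by rewrite ltW// kH.
  lra.
- have [wM|Mw] := leP w (kap M).
    have [|v /andP[v0 vM] vw] := kS w; first by rewrite w0.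
    by exists v => //; rewrite vM.
  exists (w - (kap M - M)); first by lra.
  by case: (leP (w - (kap M - M)) M) => ?; lra.
Qed.

Lemma glue_dist kap M e : 0 <= M ->
  (forall v, 0 <= v <= M -> `|kap v - v| < e) ->
  forall v, 0 <= v -> `|glue kap M v - v| < e.
Proof.
move=> M0 kM v v0; rewrite /glue; case: (leP v M) => vM; first by rewrite kM// v0.
by rewrite addrAC subrr add0r kM// M0 lexx.
Qed.

Definition alpha_inv t v := t * v / (1 + v).
Definition alpha t s := s / (t - s).

Section alpha.
Context (t : R) (t0 : 0 < t).

Lemma alpha_inv_itv v : 0 <= v -> 0 <= alpha_inv t v < t.
Proof.
move=> v0; rewrite /alpha_inv divr_ge0 ?addr_ge0 ?mulr_ge0 ?(ltW t0)//=.
by rewrite ltr_pdivrMr ?ltr_wpDr// mulrDr mulr1 ltrDr.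
Qed.

Lemma alpha_ge0 s : 0 <= s < t -> 0 <= alpha t s.
Proof. by move=> /andP[s0 st]; rewrite divr_ge0// subr_ge0 ltW. Qed.

Lemma alphaK s : 0 <= s < t -> alpha_inv t (alpha t s) = s.
Proof.
move=> /andP[s0 st]; rewrite /alpha_inv /alpha; field.
by apply/andP; split; lra.
Qed.

Lemma alpha_invK v : 0 <= v -> alpha t (alpha_inv t v) = v.
Proof.
move=> v0; rewrite /alpha_inv /alpha; field.
have -> : t * (1 + v) - t * v = t by ring.
by rewrite !gt_eqF// ltr_wpDr.
Qed.

Lemma alpha_inv_homo v w : 0 <= v -> v < w -> alpha_inv t v < alpha_inv t w.
Proof.
move=> v0 vw; rewrite /alpha_inv.
have w0 : 0 <= w by lra.
rewrite ltr_pdivrMr ?ltr_wpDr// mulrAC ltr_pdivlMr ?ltr_wpDr//.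
by rewrite !mulrDr !mulr1 -!mulrA (mulrC v w) ltrD2r ltr_pM2l.
Qed.

Lemma alpha_homo s u : 0 <= s -> s < u -> u < t -> alpha t s < alpha t u.
Proof.
move=> s0 su ut; rewrite /alpha.
have ts : 0 < t - s by lra.
have tu : 0 < t - u by lra.
by rewrite ltr_pdivrMr// mulrAC ltr_pdivlMr//; nra.
Qed.

Lemma alpha_inv_le v w : 0 <= v -> v <= w -> alpha_inv t v <= alpha_inv t w.
Proof.
move=> v0; rewrite le_eqVlt => /predU1P[->//|vw].
by apply: ltW; exact: alpha_inv_homo.
Qed.

Lemma alpha_le s u : 0 <= s -> s <= u -> u < t -> alpha t s <= alpha t u.
Proof.
move=> s0; rewrite le_eqVlt => /predU1P[->//|su ut].
by apply: ltW; exact: alpha_homo.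
Qed.

Lemma alpha_inv_lip v w : 0 <= v -> 0 <= w ->
  `|alpha_inv t v - alpha_inv t w| <= t * `|v - w|.
Proof.
move=> v0 w0.
have -> : alpha_inv t v - alpha_inv t w = t * (v - w) / ((1 + v) * (1 + w)).
  by rewrite /alpha_inv; field; apply/andP; split; lra.
rewrite !normrM (ger0_norm (ltW t0)) normfV ler_pdivrMr; last first.
  by rewrite normr_gt0 mulf_neq0//; lra.
rewrite ler_peMr ?mulr_ge0 ?(ltW t0)// ger0_norm; nra.
Qed.

Lemma alpha_lip c s u : 0 < c -> s <= t - c -> u <= t - c ->
  `|alpha t s - alpha t u| <= t * `|s - u| / c ^+ 2.
Proof.
move=> c0 sc uc.
have -> : alpha t s - alpha t u = t * (s - u) / ((t - s) * (t - u)).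
  by rewrite /alpha; field; apply/andP; split; lra.
rewrite !normrM (ger0_norm (ltW t0)) normfV ler_wpM2l ?mulr_ge0 ?(ltW t0)//.
have h : c ^+ 2 <= (t - s) * (t - u) by rewrite expr2; nra.
rewrite lef_pV2 ?posrE ?normr_gt0 ?exprn_gt0//.
  by rewrite ger0_norm// (le_trans _ h)// exprn_ge0// ltW.
by rewrite gt_eqF// (lt_le_trans _ h)// exprn_gt0.
Qed.

End alpha.
End time_changes.

(** * Càdlàg paths under the J1 topology *)

Section cadlag_observation.
Context {R : realType} (d : nat).
Local Notation V := 'rV[R]_d.
Local Notation D := (@D_space R d).
Local Notation Om := (cadlag_paths R d).
Implicit Types (x y z : D) (t u M N e : R).

Let stretched t x : D := stretch (D_restr t x).

Let stretchedE t x v : 0 < t -> 0 <= v ->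
  val (stretched t x) v = val x (alpha_inv t v).
Proof.
move=> t0 v0; rewrite /= /stretch_fun /patch mem_set/= ?in_itv/= ?v0//.
by rewrite mem_set/= ?in_itv/=; last exact: alpha_inv_itv.
Qed.

(** The time changes compose. The first may push a time below [N] up to [N + e], which is why the
    second ball needs the longer horizon. *)
Lemma J1_ball_trans x y z N e e' : J1_ball x N e y ->
  J1_ball y (N + e) e' z -> J1_ball x N (e + e') z.
Proof.
move=> [lam lamP [lam1 lam2]] [kap kapP [kap1 kap2]].
have /time_changeP[lam0 _ _] := lamP.
exists (kap \o lam); first exact: time_change_comp.
split=> s s0 /=.
  rewrite -(subrKA (lam s)) (le_lt_trans (ler_normD _ _))// addrC.
  by rewrite ltrD ?lam1 ?kap1// lam0.
have /andP[s0' sN] := s0.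
rewrite -(subrKA (val y (lam s))) (le_lt_trans (ler_normD _ _))// addrC.
rewrite ltrD ?lam2 ?kap2// lam0//=.
have := lam1 s s0'; rewrite ltr_norml => /andP[_]; lra.
Qed.

Lemma J1_ball_refl x N e : 0 < e -> J1_ball x N e x.
Proof.
move=> e0; exists id; first by apply/time_changeP; split=> // w w0; exists w.
by split=> s _; rewrite subrr normr0.
Qed.

(** The witness is the union of the balls of strictly smaller radius; [J1_ball_trans] spends half of
    the remaining gap [e - e'] to show it open. *)
Lemma J1_ball_open x N e : 0 < e ->
  exists2 U : set D, open U & U x /\ U `<=` J1_ball x N e.
Proof.
move=> e0; exists [set y | exists2 e', 0 < e' < e & J1_ball x N e' y]; last first.
  split; first by exists (e / 2); [lra|apply: J1_ball_refl; lra].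
  by move=> y [e' /andP[_ e'e]]; apply: sub_J1_ball => //; exact: ltW.
move=> y [e' /andP[e'0 e'e] xy].
exists (N + e'), ((e - e') / 2); split; first by lra.
move=> z yz; exists (e' + (e - e') / 2); first by lra.
exact: J1_ball_trans yz.
Qed.

(** Continuity of the restriction at x: the time change [lam] is conjugated by [alpha t] up to [M]
    and then glued. *)
Let stretched_ball t x M e : 0 < t -> 0 <= M -> 0 < e -> exists2 e', 0 < e' &
  forall y, J1_ball x (alpha_inv t M) e' y ->
    J1_ball (stretched t x) M e (stretched t y).
Proof.
move=> t0 M0 e0; set N := alpha_inv t M.
have /andP[N0 Nt] : 0 <= N < t by exact: alpha_inv_itv.
(* As [N = t - 2 * c], a displacement below [c] keeps all times involved below [t - c]. There
   [alpha t] is Lipschitz with constant [t / c ^+ 2], whence the third term of [e']. *)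
pose c := (t - N) / 2.
have c0 : 0 < c by rewrite /c; lra.
pose e' := Num.min e (Num.min c (e * c ^+ 2 / t)).
have e'0 : 0 < e'.
  by rewrite !lt_min e0 c0 divr_gt0// mulr_gt0// exprn_gt0.
have e'e : e' <= e by rewrite ge_min lexx.
have e'c : e' <= c by rewrite !ge_min lexx orbT.
have e'm : e' <= e * c ^+ 2 / t by rewrite !ge_min lexx !orbT.
exists e' => // y [lam lamP [lam1 lam2]].
have /time_changeP[lam0 lamH lamS] := lamP.
pose kap v := alpha t (lam (alpha_inv t v)).
have aN v : 0 <= v <= M -> 0 <= alpha_inv t v <= N.
  move=> /andP[v0 vM]; have /andP[-> _] := alpha_inv_itv t0 v0.
  exact: alpha_inv_le.
have lamN v : 0 <= v <= M -> 0 <= lam (alpha_inv t v) <= t - c.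
  move=> /aN /andP[a0 aN']; rewrite lam0//=.
  have := lam1 _ a0; rewrite ltr_norml /c => /andP[_].
  by move: e'c; rewrite /c; lra.
have lamt v : 0 <= v <= M -> 0 <= lam (alpha_inv t v) < t.
  by move=> /lamN/andP[-> l]; rewrite (le_lt_trans l)// gtrBl.
have kapK v : 0 <= v <= M -> alpha_inv t (kap v) = lam (alpha_inv t v).
  by move=> vM; rewrite alphaK// lamt.
have kap0 v : 0 <= v <= M -> 0 <= kap v.
  by move=> vM; rewrite alpha_ge0// lamt.
exists (glue kap M).
  apply: time_change_glue => //.
    move=> v w v0 vw wM; have w0 : 0 <= w by exact: le_trans (ltW vw).
    have /andP[a0 _] := alpha_inv_itv t0 v0.
    have /andP[la0 _] : 0 <= lam (alpha_inv t v) < t.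
      by rewrite lamt// v0 (le_trans (ltW vw)).
    apply: alpha_homo => //; first by apply: lamH => //; exact: alpha_inv_homo.
    by have /andP[] : 0 <= lam (alpha_inv t w) < t by rewrite lamt// w0.
  move=> w /andP[w0 wk].
  have /andP[aw0 awt] := alpha_inv_itv t0 w0.
  have [s s0 sE] := lamS _ aw0.
  have MM : 0 <= M <= M by rewrite M0 lexx.
  have sN : s <= N.
    rewrite leNgt; apply/negP => Ns; have := lamH _ _ N0 Ns.
    rewrite sE -(kapK M)//; apply/negP; rewrite -leNgt.
    exact: alpha_inv_le.
  have st : 0 <= s < t by rewrite s0 (le_lt_trans sN).
  exists (alpha t s); last by rewrite /kap alphaK// sE alpha_invK.
  rewrite alpha_ge0//= -(alpha_invK t0 M0).
  exact: alpha_le.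
split.
  apply: glue_dist => // v vM.
  have /andP[v0 vM'] := vM; have /andP[a0 a1] := aN _ vM.
  have /andP[_ lc] := lamN _ vM.
  rewrite -[in X in _ - X](alpha_invK t0 v0).
  apply: (@le_lt_trans _ _ (t * `|lam (alpha_inv t v) - alpha_inv t v| / c ^+ 2)).
    by apply: alpha_lip => //; move: Nt; rewrite /c; lra.
  rewrite ltr_pdivrMr ?exprn_gt0// mulrC -ltr_pdivlMr//.
  by apply: lt_le_trans e'm; exact: lam1.
move=> s sM; have /andP[s0 sM'] := sM; rewrite /glue sM' !stretchedE ?kap0//.
by rewrite kapK//; apply: lt_le_trans e'e; exact/lam2/aN.
Qed.

(** The converse transfer: the stretched path at [u] decides what happens up to [N < u]. Here
    [alpha_inv u] is Lipschitz with constant [u] on the whole half-line, so [e / u] suffices. *)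
Let ball_stretched u x N e : 0 <= N -> N < u -> 0 < e -> exists2 e', 0 < e' &
  forall y, J1_ball (stretched u x) (alpha u N) e' (stretched u y) ->
    J1_ball x N e y.
Proof.
move=> N0 Nu e0; have u0 : 0 < u by exact: le_lt_trans Nu.
set M := alpha u N.
have M0 : 0 <= M by rewrite alpha_ge0// N0.
pose e' := Num.min e (e / u).
have e'0 : 0 < e' by rewrite lt_min e0 divr_gt0.
have e'e : e' <= e by rewrite ge_min lexx.
have e'u : e' <= e / u by rewrite !ge_min lexx orbT.
exists e' => // y [mu muP [mu1 mu2]].
have /time_changeP[mu0 muH muS] := muP.
have sU s : 0 <= s <= N -> 0 <= s < u.
  by move=> /andP[-> /le_lt_trans]; exact.
have aM s : 0 <= s <= N -> 0 <= alpha u s <= M.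
  move=> sN; rewrite alpha_ge0 ?sU//=; have /andP[s0 sN'] := sN.
  exact: alpha_le.
pose kap s := alpha_inv u (mu (alpha u s)).
have muA s : 0 <= s <= N -> 0 <= mu (alpha u s).
  by move=> /aM/andP[a0 _]; exact: mu0.
exists (glue kap N).
  apply: time_change_glue => //.
  - by move=> s sN; have /andP[] := alpha_inv_itv u0 (muA _ sN).
  - move=> s w s0 sw wN; have sN : 0 <= s <= N by rewrite s0 (le_trans (ltW sw)).
    apply: alpha_inv_homo => //; first exact: muA.
    apply: muH; first by have /andP[] := aM _ sN.
    by apply: alpha_homo => //; exact: le_lt_trans Nu.
  - move=> w /andP[w0 wk].
    have NN : 0 <= N <= N by rewrite N0 lexx.
    have wu : 0 <= w < u.
      rewrite w0 (le_lt_trans wk)//.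
      by have /andP[] := alpha_inv_itv u0 (muA _ NN).
    have [v v0 vE] := muS _ (alpha_ge0 wu).
    have vM : v <= M.
      rewrite leNgt; apply/negP => Mv; have := muH _ _ M0 Mv.
      rewrite vE; apply/negP; rewrite -leNgt -(alpha_invK u0 (mu0 _ M0)).
      apply: alpha_le => //.
      by have /andP[] := alpha_inv_itv u0 (muA _ NN).
    exists (alpha_inv u v); last by rewrite /kap alpha_invK// vE alphaK.
    have /andP[-> _] /= := alpha_inv_itv u0 v0.
    have <- : alpha_inv u M = N by rewrite alphaK// sU.
    exact: alpha_inv_le.
split.
  apply: glue_dist => // s sN.
  have /andP[a0 aM'] := aM _ sN.
  rewrite -[in X in _ - X](alphaK (sU _ sN)).
  apply: le_lt_trans (alpha_inv_lip u0 (mu0 _ a0) a0) _.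
  by rewrite mulrC -ltr_pdivlMr//; apply: lt_le_trans e'u; exact: mu1.
move=> s sN; have /andP[s0 sN'] := sN; rewrite /glue sN'.
have /andP[a0 aM'] := aM _ sN.
have := mu2 _ (aM _ sN); rewrite !stretchedE// ?mu0// alphaK ?sU//.
by move=> /lt_le_trans; apply.
Qed.

Lemma cadlag_paths_observation : observation Om.
Proof.
apply: (@observation_of_balls _ Om (fun x => J1_ball (x : D))).
- by move=> x N e; exact: J1_ball_refl.
- by move=> O; split.
- move=> t U x _ oU Ux; have [t0|t0] := leP t 0.
    (* For [t <= 0] the interval [0, t[ is empty, and all restrictions are the same path. *)
    exists t, 1; split=> // y _; suff yx : restr Om t y = restr Om t x.
      by rewrite -yx in Ux.
    apply: val_inj; apply/funext => s /=; rewrite /patch.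
    rewrite memNset//= in_itv/= => /andP[s0 st].
    by have := le_lt_trans s0 (lt_le_trans st t0); rewrite ltxx.
  move: oU Ux => [W oW <-] /oW.
  move=> [M [e [e0 MW]]].
  have M0 : 0 <= Num.max M 0 by rewrite le_max lexx orbT.
  have [e' e'0 tB] := stretched_ball x t0 M0 e0.
  exists (alpha_inv t (Num.max M 0)), e'; split=> //.
    by have /andP[_ /ltW] := alpha_inv_itv t0 M0.
  move=> y /tB tM; apply: MW; apply: sub_J1_ball tM => //.
  by rewrite le_max lexx.
- move=> u N e x u0 Nu e0.
  have N0 : 0 <= Num.max N 0 by rewrite le_max lexx orbT.
  have Nu' : Num.max N 0 < u by rewrite gt_max Nu.
  have [e' e'0 tB] := ball_stretched x N0 Nu' e0.
  have [U oU [Ux UB]] :=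
    @J1_ball_open (stretched u x) (alpha u (Num.max N 0)) _ e'0.
  exists ((stretched u : Om -> D) @^-1` U).
    by exists ((@stretch R d u) @^-1` U) => //; exists U.
  split=> // y /UB /tB; apply: sub_J1_ball => //.
  by rewrite le_max lexx.
(* Each radius is at most [e / 2], and the shift of the horizon caused by composing time changes
   stays within [N' - N]. *)
move=> x N N' e NN' e0; exists (Num.min (e / 2) (N' - N)).
  by rewrite lt_min; apply/andP; split; lra.
set e' := Num.min _ _.
have e'1 : e' <= e / 2 by rewrite ge_min lexx.
have e'2 : e' <= N' - N by rewrite ge_min lexx orbT.
move=> y xy z yz.
apply: (@sub_J1_ball _ _ _ N _ _ (e' + e')) => //; first lra.
apply: (@J1_ball_trans _ y).
  by apply: sub_J1_ball xy => //; exact: ltW.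
by apply: sub_J1_ball yz => //; lra.
Qed.

End cadlag_observation.

(** * Integration over a sub-sigma-algebra *)

Section sub_sigma_algebra.
Context d (T : measurableType d) {R : realType} (G : set (set T)).
Hypotheses (sG : sigma_algebra setT G) (Gm : G `<=` measurable).
Local Notation TG := (g_sigma_algebraType G).
Implicit Types (Q : probability T R) (f g h : T -> R) (A B : set T) (M : R).

Definition adapted f := forall B : set R, measurable B -> G (f @^-1` B).

Let measurableG : (measurable : set (set TG)) = G.
Proof. exact: measurable_g_measurableTypeE. Qed.

Lemma adaptedP f : adapted f <-> measurable_fun setT (f : TG -> R).
Proof.
split=> [af _ B mB|mf B mB]; first by rewrite setTI measurableG; exact: af.
by have := mf measurableT B mB; rewrite setTI measurableG.
Qed.

Lemma adapted_measurable f : adapted f -> measurable_fun setT f.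
Proof. by move=> af _ B mB; rewrite setTI; exact/Gm/af. Qed.

Lemma sub_setI A B : G A -> G B -> G (A `&` B).
Proof. by rewrite -measurableG; exact: measurableI. Qed.

Lemma sub_setU A B : G A -> G B -> G (A `|` B).
Proof. by rewrite -measurableG; exact: measurableU. Qed.

Lemma sub_setD A B : G A -> G B -> G (A `\` B).
Proof. by rewrite -measurableG; exact: measurableD. Qed.

Lemma sub_setT : G setT.
Proof. by rewrite -measurableG; exact: measurableT. Qed.

Lemma sub_set0 : G set0.
Proof. by rewrite -measurableG; exact: measurable0. Qed.

Lemma sub_setC A : G A -> G (~` A).
Proof. by rewrite -measurableG; exact: measurableC. Qed.

Lemma sub_ltr f g : adapted f -> adapted g -> G [set w | f w < g w].
Proof.
move=> /adaptedP mf /adaptedP mg.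
have mt : measurable [set true] by [].
have := measurable_fun_ltr mf mg measurableT mt.
by rewrite setTI measurableG.
Qed.

Lemma sub_ler f g : adapted f -> adapted g -> G [set w | f w <= g w].
Proof.
move=> /adaptedP mf /adaptedP mg.
have mt : measurable [set true] by [].
have := measurable_fun_ler mf mg measurableT mt.
by rewrite setTI measurableG.
Qed.

(** [Q] retyped on the coarser measurable space [TG]. Carrying [sG] and [Gm] in the term lets the
    measure structure, whose proof rests on them, be inferred. *)
Definition sub_probability (sG : sigma_algebra setT G) (Gm : G `<=` measurable)
  (Q : probability T R) : set TG -> \bar R := Q.

Section sub_probability.
Variable Q : probability T R.
Local Notation QG := (sub_probability sG Gm Q).

Let QG0 : QG set0 = 0%E. Proof. exact: measure0. Qed.
Let QG_ge0 A : (0 <= QG A)%E. Proof. exact: measure_ge0. Qed.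
Let QG_sigma_additive : semi_sigma_additive QG.
Proof.
move=> F; rewrite measurableG => GF tF GUF.
by apply: measure_semi_sigma_additive => // [i|]; exact: Gm.
Qed.
HB.instance Definition _ := isMeasure.Build _ _ _ QG QG0 QG_ge0 QG_sigma_additive.
Let QG_setT : QG setT = 1%E. Proof. exact: probability_setT. Qed.
HB.instance Definition _ := Measure_isProbability.Build _ _ _ QG QG_setT.

End sub_probability.

(** The coarser measure is the image of [Q] under the identity from [T] to [TG], so this is a change
    of variables. *)
Lemma integral_sub_probability Q A (f : T -> \bar R) :
  G A -> measurable_fun setT (f : TG -> \bar R) ->
  Q.-integrable setT f ->
  (\int[sub_probability sG Gm Q]_(w in A) f w = \int[Q]_(w in A) f w)%E.
Proof.
move=> GA mf fQ; have mid : measurable_fun setT (id : T -> TG).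
  by move=> _ B; rewrite measurableG setTI => /Gm.
have := @integral_pushforward _ _ T TG R id mid Q A f mf.
rewrite preimage_id measurableG => <- //.
by apply: (integrableS measurableT) => //; exact: Gm.
Qed.

Lemma eq_integral_adapted Q Q' A f : G A -> adapted f ->
  (forall B, G B -> Q B = Q' B) ->
  Q.-integrable setT (EFin \o f) -> Q'.-integrable setT (EFin \o f) ->
  \int[Q]_(w in A) f w = \int[Q']_(w in A) f w.
Proof.
move=> GA /adaptedP/measurable_EFinP mf QQ' fQ fQ'; rewrite /Rintegral.
rewrite -(integral_sub_probability GA mf fQ).
rewrite -(integral_sub_probability GA mf fQ').
by congr fine; apply: eq_measure_integral => B; rewrite measurableG => /QQ'.
Qed.

Section density.
Variables (Q : probability T R) (phi : set T -> R) (M : R).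
Hypothesis phi_additive : forall A B, G A -> G B -> A `&` B = set0 ->
  phi (A `|` B) = phi A + phi B.
Hypothesis phi_bounded : forall A, G A -> `|phi A| <= M * fine (Q A).

Let nu : set TG -> \bar R := EFin \o phi.

Let nu0 : nu set0 = 0%E.
Proof.
rewrite /nu/=; have := phi_bounded sub_set0.
by rewrite measure0 mulr0 normr_le0 => /eqP ->.
Qed.

Let nu_fin (A : set TG) : measurable A -> nu A \is a fin_num.
Proof. by []. Qed.

Let nu_sigma_additive : semi_sigma_additive nu.
Proof.
move=> F; rewrite measurableG => GF tF GUF.
have phi0 : phi set0 = 0 by case: nu0.
have GS n : G (\big[setU/set0]_(0 <= i < n) F i).
  by rewrite -measurableG; apply: bigsetU_measurable => i _; rewrite measurableG.
have phiS n : phi (\big[setU/set0]_(0 <= i < n) F i) =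
    \sum_(0 <= i < n) phi (F i).
  elim: n => [|n IHn]; first by rewrite !big_nil.
  rewrite !big_nat_recr//= phi_additive// ?IHn// big_mkord.
  by apply: (@trivIset_bigsetUI _ predT) => //; rewrite /predT /= trueE.
pose S n := \big[setU/set0]_(0 <= i < n) F i.
have SF n : S n `<=` \bigcup_i F i by rewrite /S big_mkord; exact: bigsetU_bigcup.
(* The tails decrease to the empty set, so their [Q]-mass tends to 0. Domination by [M * Q] then
   upgrades finite additivity to countable additivity. *)
pose D n := \bigcup_i F i `\` S n.
have GD n : G (D n) by exact: sub_setD GUF (GS n).
have phiD n : phi (\bigcup_i F i) - \sum_(0 <= i < n) phi (F i) = phi (D n).
  have SD : S n `&` D n = set0 by rewrite /D setDE setICA setICr setI0.
  have := phi_additive (GS n) (GD n) SD.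
  by rewrite (setDUK (SF n)) phiS => ->; rewrite addrAC subrr add0r.
have cQ : Q (D n) @[n --> \oo] --> 0%E.
  have D0 : \bigcap_n D n = set0.
    rewrite -subset0 => w Dw; have [[k _ Fkw] _] := Dw 0%N I.
    have [_] := Dw k.+1 I; apply; rewrite /S big_mkord -bigcup_mkord.
    by exists k => /=.
  rewrite -(measure0 Q) -D0; apply: nonincreasing_cvg_mu => //.
  - by rewrite ltey_eq fin_num_measure//; exact: Gm.
  - by move=> n; exact: Gm.
  - by rewrite D0.
  - move=> m n mn; apply/subsetPset; apply: setDS.
    by rewrite /S !big_mkord; exact: subset_bigsetU.
have cfQ : M * fine (Q (D n)) @[n --> \oo] --> (0 : R).
  by rewrite -(mulr0 M); apply: cvgMr; exact: fine_cvg cQ.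
have -> : (fun n => \sum_(0 <= i < n) nu (F i))%E =
    EFin \o (fun n => \sum_(0 <= i < n) phi (F i)).
  by apply/funext => n; rewrite /= sumEFin.
apply: cvg_EFin; first exact: nearW.
apply/subr_cvg0; apply/norm_cvg0P; rewrite -/(D _).
apply: (@squeeze_cvgr _ _ _ _ (cst 0) (fun n => M * fine (Q (D n)))) => //.
  apply: nearW => n; rewrite normr_ge0/= distrC phiD; exact: phi_bounded.
exact: cvg_cst.
Qed.

HB.instance Definition _ := isCharge.Build _ _ _ nu nu0 nu_fin nu_sigma_additive.

Let nu_dominated : nu `<< sub_probability sG Gm Q.
Proof.
apply/null_content_dominatesP => A; rewrite measurableG => GA QA0.
rewrite /nu/=; have := phi_bounded GA.
by rewrite [Q A]QA0 mulr0 normr_le0 => /eqP ->.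
Qed.

(** A Radon-Nikodym theorem on [G] for a merely additive [phi], domination making it a charge. It
    yields conditional expectations of bounded functions, and later the density of a supremum of
    integrals. *)
Lemma additive_bounded_density : exists y : T -> R,
  [/\ adapted y, Q.-integrable setT (EFin \o y) &
      forall A, G A -> \int[Q]_(w in A) y w = phi A].
Proof.
pose QG := sub_probability sG Gm Q.
pose f := Radon_Nikodym nu QG.
have ffin w : f w \is a fin_num by exact: Radon_Nikodym_fin_num.
have fint : QG.-integrable setT f by exact: Radon_Nikodym_integrable.
have fE A : G A -> (phi A)%:E = (\int[QG]_(w in A) f w)%E.
  by move=> GA; rewrite -Radon_Nikodym_integral// measurableG.
have mf : measurable_fun setT (fine \o f : TG -> R).
  by apply: measurableT_comp => //; exact: measurable_int fint.
have fineE : EFin \o (fine \o f) = f by apply/funext => w /=; rewrite fineK.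
have fQ : Q.-integrable setT f.
  have mid : measurable_fun setT (id : T -> TG).
    by move=> _ B; rewrite measurableG setTI => /Gm.
  have mfT : measurable_fun setT (f : T -> \bar R).
    rewrite -fineE; apply/measurable_EFinP.
    by apply: (@adapted_measurable (fine \o f)); exact/adaptedP.
  apply/integrableP; split=> //; case/integrableP : fint => mfG; apply: le_lt_trans.
  have := @ge0_integral_pushforward _ _ T TG R id mid Q setT (abse \o f).
  rewrite preimage_id /= => <- //; last exact: measurableT_comp.
exists (fine \o f); split; [exact/adaptedP|by rewrite fineE|move=> A GA].
have mfE : measurable_fun setT (f : TG -> \bar R) by exact: measurable_int fint.
rewrite /Rintegral (_ : (fun w => _) = f)//.
by rewrite -(integral_sub_probability GA mfE fQ) -fE.
Qed.

End density.

End sub_sigma_algebra.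

Section Rintegral_complements.
Context d (T : measurableType d) {R : realType}.
Implicit Types (mu : {measure set T -> \bar R}) (Q : probability T R)
  (f g h : T -> R) (A B : set T).

Lemma integrable_sub mu A (f : T -> \bar R) : measurable A ->
  mu.-integrable setT f -> mu.-integrable A f.
Proof. by move=> mA; exact: (integrableS measurableT mA). Qed.

Lemma Rintegrable_mul mu f h (M : R) : measurable_fun setT f ->
  (forall w, `|f w| <= M) -> mu.-integrable setT (EFin \o h) ->
  mu.-integrable setT (EFin \o (fun w => f w * h w)).
Proof.
move=> mf fM hi; apply: (@integrableMr _ _ _ mu _ measurableT f (EFin \o h)) => //.
by exists M; split; [exact: num_real|move=> x Mx w _; exact: le_trans (ltW Mx)].
Qed.

Lemma RintegrableB mu f g : mu.-integrable setT (EFin \o f) ->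
  mu.-integrable setT (EFin \o g) ->
  mu.-integrable setT (EFin \o (fun w => f w - g w)).
Proof. by move=> fi gi; exact: (integrableB measurableT fi gi). Qed.

Lemma RintegrableZ mu (a : R) f : mu.-integrable setT (EFin \o f) ->
  mu.-integrable setT (EFin \o (fun w => a * f w)).
Proof. by move=> fi; exact: (integrableZl measurableT a fi). Qed.

Lemma RintegrableN mu f : mu.-integrable setT (EFin \o f) ->
  mu.-integrable setT (EFin \o (fun w => - f w)).
Proof. by move=> fi; exact: (integrableN fi). Qed.

Lemma Rintegrable_normr mu f : mu.-integrable setT (EFin \o f) ->
  mu.-integrable setT (EFin \o (fun w => `|f w|)).
Proof. by move=> fi; exact: integrable_norm. Qed.

Lemma RintegralN mu A f : measurable A -> mu.-integrable setT (EFin \o f) ->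
  \int[mu]_(w in A) (- f w) = - \int[mu]_(w in A) f w.
Proof.
move=> mA fi; rewrite -mulN1r -RintegralZl//.
  by apply: eq_Rintegral => w _; rewrite mulN1r.
exact: integrable_sub.
Qed.

Lemma le_Rintegral_setT mu A f : measurable A ->
  mu.-integrable setT (EFin \o f) -> (forall w, 0 <= f w) ->
  \int[mu]_(w in A) f w <= \int[mu]_w f w.
Proof.
move=> mA fi f0; rewrite Rintegral_mkcond; apply: le_Rintegral => //.
  rewrite -restrict_EFin.
  exact: (iffLR (integrable_mkcond _ mA) (integrable_sub mA fi)).
by move=> w _; rewrite patchE; case: ifP.
Qed.

Lemma Rintegral_setC mu A f : measurable A -> mu.-integrable setT (EFin \o f) ->
  \int[mu]_w f w = \int[mu]_(w in A) f w + \int[mu]_(w in ~` A) f w.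
Proof.
move=> mA fi; rewrite -[in LHS](setUv A) Rintegral_setU ?setUv//.
  exact: measurableC.
by rewrite disj_set2E setICr.
Qed.

Lemma Rintegral_indic_mul mu A B f : measurable A -> measurable B ->
  \int[mu]_(w in A) (\1_B w * f w) = \int[mu]_(w in A `&` B) f w.
Proof.
move=> mA mB; rewrite Rintegral_mkcondr; apply: eq_Rintegral => w _.
by rewrite patchE indicE; case: (w \in B); rewrite ?mul1r ?mul0r.
Qed.

Lemma normr_Rintegral_le mu A f : measurable A ->
  mu.-integrable setT (EFin \o f) ->
  `|\int[mu]_(w in A) f w| <= \int[mu]_w `|f w|.
Proof.
move=> mA fi; apply: (@le_trans _ _ (\int[mu]_(w in A) `|f w|)).
  by apply: le_normr_Rintegral => //; exact: integrable_sub.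
apply: le_Rintegral_setT => //; exact: Rintegrable_normr.
Qed.

Lemma le_Rintegral_norm_sub mu A f g : measurable A ->
  mu.-integrable setT (EFin \o f) -> mu.-integrable setT (EFin \o g) ->
  `|\int[mu]_(w in A) f w - \int[mu]_(w in A) g w| <= \int[mu]_w `|f w - g w|.
Proof.
move=> mA fi gi; rewrite -RintegralB//.
- exact/normr_Rintegral_le/RintegrableB.
- exact: integrable_sub.
- exact: integrable_sub.
Qed.

Lemma Rintegral_null Q A f : measurable A -> Q A = 0%E ->
  Q.-integrable setT (EFin \o f) -> \int[Q]_(w in A) f w = 0.
Proof.
move=> mA QA0 fi; rewrite /Rintegral null_set_integral//.
by apply: measurable_funTS; case/integrableP: fi.
Qed.

Lemma bounded_integrable Q f (M : R) : measurable_fun setT f ->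
  (forall w, `|f w| <= M) -> Q.-integrable setT (EFin \o f).
Proof.
move=> mf fM; apply: measurable_bounded_integrable => //.
  by rewrite ltey_eq fin_num_measure.
by exists M; split; [exact: num_real|move=> x Mx w _; exact: le_trans (ltW Mx)].
Qed.

Lemma Rintegral_bound Q A f (M : R) : measurable A -> measurable_fun setT f ->
  (forall w, `|f w| <= M) -> `|\int[Q]_(w in A) f w| <= M * fine (Q A).
Proof.
move=> mA mf fM; have fi := bounded_integrable Q mf fM.
have fA : Q.-integrable A (EFin \o f) by exact: integrable_sub.
apply: (le_trans (le_normr_Rintegral mA fA)).
rewrite -Rintegral_cst//; apply: le_Rintegral => //.
  exact: integrable_norm.
apply: (integrableS measurableT) => //.
exact: (@bounded_integrable _ (cst M) `|M|).
Qed.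

End Rintegral_complements.

(** * Integrals against nonnegative adapted functions *)

Section layer_cake.
Context d (T : measurableType d) {R : realType} (G : set (set T)).
Hypotheses (sG : sigma_algebra setT G) (Gm : G `<=` measurable).
Variables (mu : {measure set T -> \bar R}) (h : T -> R) (e : R).
Hypothesis hi : mu.-integrable setT (EFin \o h).
Hypothesis he : forall B, G B -> - e <= \int[mu]_(w in B) h w.

(* Halving M: f = (M / 2) 1_{f >= M / 2} + f' with 0 <= f' <= M / 2. *)
Let layer_cake_approx (A : set T) n : G A -> forall M f, adapted G f ->
  (forall w, 0 <= f w <= M) ->
  - (M * e) - M / 2 ^+ n * \int[mu]_w `|h w| <= \int[mu]_(w in A) (f w * h w).
Proof.
move=> GA; have mA := Gm GA.
have e0 : 0 <= e.
  by have := he (sub_set0 sG); rewrite Rintegral_set0 oppr_le0.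
elim: n => [|n IHn] M f af fM.
  have M0 : 0 <= M by have /andP[/le_trans] := fM point; apply.
  have mf := adapted_measurable Gm af.
  have fN w : `|f w| <= M by have /andP[f0 ?] := fM w; rewrite ger0_norm.
  have fhi := Rintegrable_mul mf fN hi.
  (* Without any halving, the crude bound [M] times the integral of [|h|] is exactly the remainder
     allowed. *)
  rewrite expr0 divr1.
  have : `|\int[mu]_(w in A) (f w * h w)| <= M * \int[mu]_w `|h w|.
    apply: le_trans (normr_Rintegral_le mA fhi) _.
    rewrite -RintegralZl//; last exact: Rintegrable_normr.
    apply: le_Rintegral => //; first exact: Rintegrable_normr.
      exact/RintegrableZ/Rintegrable_normr.
    by move=> w _; rewrite normrM ler_wpM2r.
  have := mulr_ge0 M0 e0.
  by rewrite ler_norml => ? /andP[]; lra.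
pose B := [set w | M / 2 <= f w].
have GB : G B by apply: sub_ler => //; apply/adaptedP => //; exact: measurable_cst.
pose f' w := f w - M / 2 * \1_B w.
have af' : adapted G f'.
  apply/adaptedP => //; apply: measurable_funB; first exact/adaptedP.
  apply: measurable_funM => //; apply: measurable_indic.
  by rewrite measurable_g_measurableTypeE.
have f'M w : 0 <= f' w <= M / 2.
  have /andP[f0 f1] := fM w; rewrite /f' indicE.
  case: (boolP (w \in B)) => [/set_mem|/negP wB]; rewrite /B/=; first by lra.
  have : ~ M / 2 <= f w by move=> ?; apply: wB; exact: mem_set.
  by move/negP; rewrite -ltNge; lra.
have Bhi : mu.-integrable setT (EFin \o (fun w => \1_B w * h w)).
  apply: (@Rintegrable_mul _ _ _ _ _ _ 1) => //.
    by apply: measurable_indic; exact: Gm.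
  by move=> w; rewrite indicE; case: (w \in B); rewrite ?normr1 ?normr0.
have f'hi : mu.-integrable setT (EFin \o (fun w => f' w * h w)).
  apply: (@Rintegrable_mul _ _ _ _ _ _ (M / 2)) => //.
    exact: adapted_measurable af'.
  by move=> w; have /andP[? ?] := f'M w; rewrite ger0_norm.
have -> : \int[mu]_(w in A) (f w * h w) =
    M / 2 * \int[mu]_(w in A `&` B) h w + \int[mu]_(w in A) (f' w * h w).
  rewrite -Rintegral_indic_mul//; last exact: Gm.
  rewrite -RintegralZl//; last exact: integrable_sub.
  rewrite -RintegralD//; last 2 first.
    exact/integrable_sub/RintegrableZ.
    exact: integrable_sub.
  by apply: eq_Rintegral => w _; rewrite /f'; ring.
have := IHn _ _ af' f'M.
have := he (sub_setI sG GA GB).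
have M0 : 0 <= M by have /andP[/le_trans] := fM point; apply.
rewrite exprS invfM mulrA.
set a := \int[mu]_(w in A `&` B) h w => ha; have : M / 2 * - e <= M / 2 * a.
  by rewrite ler_wpM2l// divr_ge0.
by lra.
Qed.

(** The remainder of [layer_cake_approx] vanishes as n grows. The tolerance [e] is 0 when [h] has
    zero integral over all events of [G], and positive when [h] only approximates an element with
    nonnegative integrals. *)
Lemma layer_cake_ge (A : set T) M f : G A -> adapted G f ->
  (forall w, 0 <= f w <= M) ->
  - (M * e) <= \int[mu]_(w in A) (f w * h w).
Proof.
move=> GA af fM.
have cN : - (M * e) - M / 2 ^+ n * \int[mu]_w `|h w| @[n --> \oo] --> - (M * e).
  rewrite -[X in _ --> X]subr0; apply: cvgB; first exact: cvg_cst.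
  rewrite -[X in _ --> X](mul0r (\int[mu]_w `|h w|)); apply: cvgMl.
  rewrite -[X in _ --> X](mulr0 M); apply: cvgMr.
  under eq_fun do rewrite -exprVn.
  by apply: cvg_expr; rewrite ger0_norm; lra.
rewrite -(cvg_lim (@Rhausdorff R) cN); apply: limr_le.
  by apply/cvg_ex; exists (- (M * e)).
by apply: nearW => n; exact: layer_cake_approx.
Qed.

End layer_cake.

(** * Pasting of models *)

Section filtration_theory.
Context {R : realType} (Om : path_space R) (obs : observation Om).
Implicit Types (s t u : R) (A : set Om).
Local Notation Upto := (@Borel_upto R Om).

Let Upto_sigma t : sigma_algebra setT (Upto t).
Proof.
split.
- by exists set0; [exact: sigma_algebra0|rewrite preimage_set0].
- move=> _ [B mB <-]; exists (setT `\` B); first exact: sigma_algebraCD.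
  by rewrite !setTD preimage_setC.
- move=> F FU; have /choice[B BF] : forall n, exists B,
      <<s @open (path_upto Om t) >> B /\ restr Om t @^-1` B = F n.
    by move=> n; have [B] := FU n; exists B.
  exists (\bigcup_n B n); first by apply: sigma_algebra_bigcup => n; have [] := BF n.
  by rewrite preimage_bigcup; apply: eq_bigcupr => n _; have [] := BF n.
Qed.

Let sigma_algebra_comap (T T' : Type) (f : T -> T') (G : set (set T)) :
  sigma_algebra setT G -> sigma_algebra setT [set B | G (f @^-1` B)].
Proof.
move=> [G0 GC GU]; split=> /=.
- by rewrite preimage_set0.
- by move=> A GA; rewrite setTD preimage_setC -setTD; exact: GC.
- by move=> F GF; rewrite preimage_bigcup; exact: GU.
Qed.

Let observable_Upto t : @observable R Om t `<=` Upto t.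
Proof. by move=> _ [V oV <-]; exists V => //; exact: sub_sigma_algebra. Qed.

Let Upto_lt s t : 0 <= s -> s < t -> Upto s `<=` Upto t.
Proof.
move=> s0 st _ [B sB <-].
apply: (smallest_sub (sigma_algebra_comap (restr Om s) (Upto_sigma t)) _ sB).
move=> V oV /=; apply: observable_Upto; apply: (observable_lt obs s0 st).
by exists V.
Qed.

Let measurable_sigma : sigma_algebra setT (@measurable _ (Borel Om)).
Proof.
split; first exact: measurable0.
  by move=> A mA; rewrite setTD; exact: measurableC.
by move=> F mF; exact: bigcup_measurable.
Qed.

Let Upto_measurable t : 0 <= t -> Upto t `<=` @measurable _ (Borel Om).
Proof.
move=> t0 _ [B sB <-].
apply: (smallest_sub (sigma_algebra_comap (restr Om t) measurable_sigma) _ sB).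
move=> V oV /=; apply: sub_sigma_algebra; apply: (observable_open obs t0).
by exists V.
Qed.

Lemma filtration_sigma_algebra t : sigma_algebra setT (filtration Om t).
Proof.
split=> [u _|A fA u tu|F fF u tu]; have [U0 UC UU] := Upto_sigma u => //.
- exact/UC/fA.
- by apply: UU => n; exact: fF.
Qed.

Lemma filtration_measurable t : 0 <= t ->
  filtration Om t `<=` @measurable _ (Borel Om).
Proof.
move=> t0 A fA; apply: (@Upto_measurable (t + 1)); first by rewrite addr_ge0.
by apply: fA; rewrite ltrDl.
Qed.

Lemma filtration_le s t : s <= t -> filtration Om s `<=` filtration Om t.
Proof. by move=> st A fA u tu; apply: fA; exact: le_lt_trans tu. Qed.

Lemma Cb_upto_adapted s f : 0 <= s -> Cb_upto Om s f ->
  @adapted _ (Borel Om) R (filtration Om s) f.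
Proof.
move=> s0 [g [cg _] <-] B mB u su.
apply: (Upto_lt s0 su); have : (@RGenOpens.G R).-sigma.-measurable B.
  by rewrite -RGenOpens.measurableE.
apply: (smallest_sub (sigma_algebra_comap (g \o restr Om s) (Upto_sigma s))).
move=> _ [a [b ->]]; apply: observable_Upto; exists (g @^-1` `]a, b[) => //.
by move/continuousP : cg; apply; exact: interval_open.
Qed.

Lemma Cb_measurable f : Cb R Om f -> measurable_fun setT (f : Borel Om -> R).
Proof.
move=> [/continuousP cf _] _ B mB; rewrite setTI.
have : (@RGenOpens.G R).-sigma.-measurable B by rewrite -RGenOpens.measurableE.
apply: (smallest_sub (sigma_algebra_comap f measurable_sigma)).
by move=> _ [a [b ->]]; apply: sub_sigma_algebra; exact/cf/interval_open.
Qed.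

(** A pi-system argument: the events of the [filtration Om n%:R] with [s <= n] are stable under
    intersection and generate the Borel sets, by [observable_bigcup]. *)
Lemma eq_measure_filtration (m1 m2 : {measure set (Borel Om) -> \bar R}) s :
  (m1 setT < +oo)%E ->
  (forall t A, s <= t -> filtration Om t A -> m1 A = m2 A) ->
  forall A : set (Borel Om), measurable A -> m1 A = m2 A.
Proof.
move=> m1oo m12 A mA.
pose G : set (set (Borel Om)) :=
  [set A | exists2 n : nat, s <= n%:R & filtration Om n%:R A].
have [N sN] : exists N : nat, s <= N%:R.
  exists (Num.truncn `|s|).+1.
  by rewrite (le_trans (ler_norm _))// ltW// truncnS_gt.
have GT : G setT.
  by exists N => //; exact: (@sub_setT _ (Borel Om) _ (filtration_sigma_algebra N%:R)).
apply: (@measure_unique _ R (Borel Om) G (fun=> setT) _ _ _ _ m1 m2) => //.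
- apply/seteqP; split.
  + apply: (smallest_sub (smallest_sigma_algebra setT G)).
    move=> O oO; have [F -> FO] := observable_bigcup obs oO.
    apply: sigma_algebra_bigcup => n; apply: sub_sigma_algebra.
    exists (maxn n N); first by rewrite (le_trans sN)// ler_nat leq_maxr.
    move=> u nu; apply: observable_Upto; apply: FO.
    by apply: le_lt_trans nu; rewrite ler_nat leq_maxl.
  + apply: (smallest_sub measurable_sigma) => B [n _].
    exact: filtration_measurable.
- move=> B B' [n sn fB] [n' sn' fB']; exists (maxn n n').
    by rewrite (le_trans sn)// ler_nat leq_maxl.
  apply: (@sub_setI _ (Borel Om) (filtration Om (maxn n n')%:R)).
    exact: filtration_sigma_algebra.
    by apply: filtration_le fB; rewrite ler_nat leq_maxl.
  by apply: filtration_le fB'; rewrite ler_nat leq_maxr.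
- by rewrite bigcup_const//; exists 0%N.
- by move=> B [n sn fB]; exact: m12 sn fB.
Qed.

End filtration_theory.

(** * Null sets and densities *)

Section null_sets.
Context d (T : measurableType d) {R : realType}.
Implicit Types (Q : probability T R) (f g : T -> R).

Lemma ae_imply (mu : {measure set T -> \bar R}) (X Y : T -> Prop) :
  (forall w, X w -> Y w) -> {ae mu, forall w, X w} -> {ae mu, forall w, Y w}.
Proof. by move=> XY; apply: filterS. Qed.

Lemma null_dominates0 (Q Q' : probability T R) A : Q `<< Q' -> measurable A ->
  Q' A = 0%E -> Q A = 0%E.
Proof. by move=> /null_content_dominatesP QQ' mA; exact: QQ'. Qed.

Lemma null_setU_null (mu : {measure set T -> \bar R}) A B : measurable A ->
  measurable B -> mu A = 0%E -> mu B = 0%E -> mu (A `|` B) = 0%E.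
Proof. by move=> mA mB A0 B0; rewrite measureU0. Qed.

Lemma measurable_ltr_set f g : measurable_fun setT f -> measurable_fun setT g ->
  measurable [set w | f w < g w].
Proof.
move=> mf mg; have mt : measurable [set true] by [].
by have := measurable_fun_ltr mf mg measurableT mt; rewrite setTI.
Qed.

(** [f - g] is positive on [A] with nonpositive integral. Applied to an event where an inequality
    fails strictly, this turns a comparison of integrals into an almost sure one. *)
Lemma Rintegral_lt_null Q (A : set T) f g : measurable A ->
  Q.-integrable setT (EFin \o f) -> Q.-integrable setT (EFin \o g) ->
  (forall w, A w -> g w < f w) ->
  \int[Q]_(w in A) f w <= \int[Q]_(w in A) g w -> Q A = 0%E.
Proof.
move=> mA fi gi gf fg.
have mf : measurable_fun setT f by apply/measurable_EFinP; exact: measurable_int fi.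
have mg : measurable_fun setT g by apply/measurable_EFinP; exact: measurable_int gi.
have fgi := RintegrableB fi gi.
have : (\int[Q]_(w in A) `|(f w - g w)%:E| = 0)%E.
  have -> : (\int[Q]_(w in A) `|(f w - g w)%:E| =
      \int[Q]_(w in A) (f w - g w)%:E)%E.
    apply: eq_integral => w /[!inE] wA.
    by rewrite gee0_abs// lee_fin subr_ge0 ltW// gf.
  apply/eqP; rewrite eq_le integral_ge0 ?andbT; last first.
    by move=> w wA; rewrite lee_fin subr_ge0 ltW// gf.
  rewrite -[leLHS]fineK; last exact/integrable_fin_num/integrable_sub.
  by rewrite lee_fin -/(Rintegral _ _ _) RintegralB ?subr_le0//; exact: integrable_sub.
move/ae_eq_integral_abs => -/(_ mA) [].
  by apply: measurable_funTS; apply/measurable_EFinP; exact: measurable_funB.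
move=> N [mN N0 AN]; apply: (subset_measure0 mA mN) => // w wA.
apply: AN => /= /(_ wA) []; apply/eqP; rewrite subr_eq0 gt_eqF//; exact: gf.
Qed.

End null_sets.

Section density_measure.
Context d (T : measurableType d) {R : realType} (mu : {measure set T -> \bar R})
  (Z : T -> R) (mZ : measurable_fun setT Z) (Z0 : forall w, 0 <= Z w).

Definition density_measure (mZ : measurable_fun setT Z)
  (Z0 : forall w, 0 <= Z w) : set T -> \bar R :=
  fun A => (\int[mu]_(w in A) (Z w)%:E)%E.

Local Notation nu := (density_measure mZ Z0).

Let nu0 : nu set0 = 0%E. Proof. exact: integral_set0. Qed.
Let nu_ge0 A : (0 <= nu A)%E.
Proof. by apply: integral_ge0 => w _; rewrite lee_fin. Qed.
Let nu_sigma_additive : semi_sigma_additive nu.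
Proof.
apply: semi_sigma_additive_nng_induced; first exact/measurable_EFinP.
by move=> w; rewrite lee_fin.
Qed.

HB.instance Definition _ := isMeasure.Build _ _ _ nu nu0 nu_ge0 nu_sigma_additive.

End density_measure.

Section pasting.
Context {R : realType} (Om : path_space R) (obs : observation Om).
Local Notation prob := (probability (Borel Om) R).
Context (C : set prob) (P : prob) (C_stable : stable C).
Implicit Types (Q : prob) (s t : R) (A B : set (Borel Om)).

Definition equivalent_models : set prob :=
  [set Q | [/\ C Q, Q `<< P & P `<< Q]].

Definition eq_until s Q Q' := forall B, filtration Om s B -> Q B = Q' B.

Let density_integral Q Q' t (Y : Om -> R) : 0 <= t -> Q' `<< Q ->
  density_cond_exp Q Q' t Y -> [/\ @adapted _ (Borel Om) R (filtration Om t) Y,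
    Q.-integrable setT (EFin \o Y : Borel Om -> \bar R) &
    forall B, filtration Om t B -> (\int[Q]_(w in B) (Y w)%:E = Q' B)%E].
Proof.
move=> t0 QQ' [aY Yi YE]; split=> // B fB; rewrite YE// -Radon_Nikodym_integral//.
exact: filtration_measurable fB.
Qed.

(** Stability is applied with [Q1] as reference measure. The density process of R' with respect to
    [Q1] is that of [Q2], frozen from time s on over [A]; so [Z], a version of (dQ2/dQ1)_s, is the
    density of R' on [A]. *)
Lemma pasting s A Q1 Q2 : 0 <= s -> filtration Om s A ->
  equivalent_models Q1 -> equivalent_models Q2 ->
  exists R' Z, [/\ equivalent_models R', eq_until s Q2 R',
    [/\ @adapted _ (Borel Om) R (filtration Om s) Z, forall w, 0 <= Z w,
        Q1.-integrable setT (EFin \o Z : Borel Om -> \bar R) &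
        forall B, filtration Om s B -> (\int[Q1]_(w in B) (Z w)%:E = Q2 B)%E],
    forall B, measurable B -> (R' (B `&` A) = \int[Q1]_(w in B `&` A) (Z w)%:E)%E &
    forall B, measurable B -> R' (B `\` A) = Q2 (B `\` A)].
Proof.
move=> s0 fA [CQ1 Q1P PQ1] [CQ2 Q2P PQ2].
have sF t := @filtration_sigma_algebra _ Om t.
have mF t (t0 : 0 <= t) := filtration_measurable obs t0.
have mA : measurable A by exact: mF fA.
have Q21 : Q2 `<< Q1 by exact: null_dominates_trans PQ1.
pose tau (w : Om) : \bar R := if w \in A then s%:E else +oo%E.
have tau_stop : stopping_time Om tau.
  split=> [w|t t0]; first by rewrite /tau; case: ifP => _; rewrite ?lee_fin ?leey.
  have [st|ts] := leP s t.
    rewrite (_ : [set w | _] = A); first exact: filtration_le fA.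
    apply/seteqP; split=> w /=; rewrite /tau; last first.
      by move=> wA; rewrite mem_set// lee_fin.
    by case: ifP => [/set_mem//|]; rewrite leye_eq.
  rewrite (_ : [set w | _] = set0); first exact: (@sub_set0 _ (Borel Om)).
  apply/seteqP; split=> w //=; rewrite /tau.
  by case: ifP; rewrite ?leye_eq// lee_fin leNgt ts.
have [_ _ /(_ Q1 Q2 CQ1 CQ2 Q21 tau tau_stop)] := C_stable.
move=> [R' [CR' R'1] [ZQ [ZR [[ZQd _] [ZRd _] ZQR]]]].
have {}ZQd t (t0 : 0 <= t) := density_integral t0 Q21 (ZQd t t0).
have {}ZRd t (t0 : 0 <= t) := density_integral t0 R'1 (ZRd t t0).
have [aZs iZs IZs] := ZQd s s0.
have mint (f : Om -> R) : Q1.-integrable setT (EFin \o f : Borel Om -> \bar R) ->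
    forall B, measurable_fun B (EFin \o f : Borel Om -> \bar R).
  by move=> /measurable_int mf B; exact: measurable_funTS.
(* The version [ZQ s] is nonnegative only almost surely; truncation makes it so everywhere, as
   [density_measure] demands. *)
pose Z : Om -> R := fun w => Num.max (ZQ s w) 0.
have a0 : @adapted _ (Borel Om) R (filtration Om s) (cst 0).
  by apply/adaptedP => //; exact: measurable_cst.
have aZ : @adapted _ (Borel Om) R (filtration Om s) Z.
  apply/adaptedP => //; apply: measurable_maxr; exact/adaptedP.
have Z0 w : 0 <= Z w by rewrite le_max lexx orbT.
have mZ : measurable_fun setT (Z : Borel Om -> R).
  by apply: adapted_measurable aZ; exact: mF.
have c0i : Q1.-integrable setT (EFin \o cst 0 : Borel Om -> \bar R).
  exact: integrable0.
pose Bneg : set (Borel Om) := [set w | ZQ s w < 0].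
have fBneg : filtration Om s Bneg.
  exact: (@sub_ltr _ (Borel Om) _ _ (sF s) _ (cst 0)).
have mBneg : measurable Bneg by exact: mF fBneg.
have Bneg0 : Q1 Bneg = 0%E.
  apply: (@Rintegral_lt_null _ (Borel Om) R Q1 _ (cst 0) (ZQ s) mBneg) => //.
  by rewrite Rintegral_cst// mul0r /Rintegral IZs// fine_ge0.
have ZE : {ae Q1, forall w, ZQ s w = Z w}.
  exists Bneg; split=> // w /= nZ; rewrite /Bneg/= ltNge; apply/negP => Z0w.
  by apply: nZ; rewrite /Z max_l.
have IZ B : measurable B ->
    (\int[Q1]_(w in B) (Z w)%:E = \int[Q1]_(w in B) (ZQ s w)%:E)%E.
  move=> mB; apply: ae_eq_integral => //; [|exact: mint|].
    by apply: measurable_funTS; exact/measurable_EFinP.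
  by apply: (@ae_imply _ (Borel Om) R Q1 _ _ _ ZE) => w -> _.
have iZ : Q1.-integrable setT (EFin \o Z : Borel Om -> \bar R).
  apply/integrableP; split; first exact/measurable_EFinP.
  rewrite (eq_integral (fun w : Borel Om => (Z w)%:E)); last first.
    by move=> w _ /=; rewrite ger0_norm.
  rewrite IZ// IZs ?ltey_eq ?fin_num_measure//.
  exact: (@sub_setT _ (Borel Om) _ (sF s)).
(* Since [tau >= s] everywhere, the two density processes agree at time s, on [A] as well. *)
have R'2 : eq_until s Q2 R'.
  move=> B fB; have [_ iR IR] := ZRd s s0.
  rewrite -IZs// -IR//; have mB : measurable B by exact: mF fB.
  apply: ae_eq_integral => //; [exact: mint|exact: mint|].
  apply: (@ae_imply _ (Borel Om) R Q1 _ _ _ ZQR) => w.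
  move=> /(_ s s0) [h1 h2] _; congr EFin; apply/esym.
  by apply: h1; rewrite /tau; case: ifP; rewrite ?leey.
have R'A B : measurable B -> (R' (B `&` A) = \int[Q1]_(w in B `&` A) (Z w)%:E)%E.
  move=> mB.
  (* Both sides are measures in [B], so it is enough to compare them on the events of the filtration
     after s, where the density processes are available. *)
  apply: (@eq_measure_filtration _ _ obs (mrestr R' mA)
    (mrestr (density_measure Q1 mZ Z0) mA) s) => //.
    by rewrite /= /mrestr ltey_eq fin_num_measure//; exact: measurableI.
  move=> t B' st fB'; have t0 := le_trans s0 st; have [_ iR IR] := ZRd t t0.
  have fBA : filtration Om t (B' `&` A).
    by apply: (@sub_setI _ (Borel Om) _ (sF t)) => //; exact: filtration_le fA.
  have mBA : measurable (B' `&` A : set (Borel Om)) by exact: mF fBA.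
  transitivity (R' (B' `&` A)) => //.
  transitivity (\int[Q1]_(w in B' `&` A) (Z w)%:E)%E => //.
  rewrite -IR// IZ//.
  apply: ae_eq_integral => //; [exact: mint|exact: mint|].
  apply: (@ae_imply _ (Borel Om) R Q1 _ _ _ ZQR) => w.
  move=> /(_ t t0) [h1 h2] [_ wA]; congr EFin.
  by rewrite h2 /tau mem_set.
have R'C B : measurable B -> R' (B `\` A) = Q2 (B `\` A).
  have mC : measurable (~` A) by exact: measurableC.
  move=> mB; rewrite setDE.
  apply: (@eq_measure_filtration _ _ obs (mrestr R' mC) (mrestr Q2 mC) s) => //.
    by rewrite /= /mrestr ltey_eq fin_num_measure//; exact: measurableI.
  move=> t B' st fB'; have t0 := le_trans s0 st.
  have [_ iR IR] := ZRd t t0; have [_ iQ IQ] := ZQd t t0.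
  have fBA : filtration Om t (B' `&` ~` A).
    apply: (@sub_setI _ (Borel Om) _ (sF t)) => //.
    apply: (@sub_setC _ (Borel Om) _ (sF t)).
    exact: filtration_le fA.
  have mBA : measurable (B' `&` ~` A : set (Borel Om)) by exact: mF fBA.
  transitivity (R' (B' `&` ~` A)) => //.
  transitivity (Q2 (B' `&` ~` A)) => //.
  rewrite -IR// -IQ//; apply: ae_eq_integral => //; [exact: mint|exact: mint|].
  apply: (@ae_imply _ (Borel Om) R Q1 _ _ _ ZQR) => w.
  move=> /(_ t t0) [h1 h2] [_ wA]; congr EFin.
  by apply: h1; rewrite /tau memNset// leey.
exists R', Z; split=> //.
  split=> //; first exact: null_dominates_trans Q1P.
  (* An R'-null set splits in three: off [A], where R' is [Q2]; on [A] with [Z > 0], where it is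
     [Q1]-null; and inside the event where [Z = 0], which [Q2] does not charge. *)
  apply/null_content_dominatesP => N mN N0.
  have mNA := measurableD mN mA.
  have NA0 : P (N `\` A) = 0%E.
    apply: (null_dominates0 PQ2) => //; rewrite -R'C//.
    by apply: (subset_measure0 _ mN _ N0) => //; exact: subDsetl.
  pose Bp : set (Borel Om) := [set w | 0 < Z w].
  have fBp : filtration Om s Bp.
    exact: (@sub_ltr _ (Borel Om) _ _ (sF s) (cst 0)).
  have mBp : measurable Bp by exact: mF fBp.
  have mBpC : measurable (~` Bp) by exact: measurableC.
  have Bp0 : P (~` Bp) = 0%E.
    have fCp : filtration Om s (~` Bp) by exact: (@sub_setC _ (Borel Om) _ (sF s)).
    apply: (null_dominates0 PQ2) => //; rewrite -IZs// -IZ//.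
    apply: integral0_eq => w; rewrite /Bp/= => /negP; rewrite -leNgt => Zw.
    by congr EFin; apply/eqP; rewrite eq_le Zw Z0.
  have mNIA : measurable (N `&` A) by exact: measurableI.
  have mNAp : measurable (N `&` A `&` Bp) by exact: measurableI.
  have NAp : Q1 (N `&` A `&` Bp) = 0%E.
    apply: (@Rintegral_lt_null _ (Borel Om) R Q1 _ Z (cst 0)) => //.
      by move=> w [].
    rewrite Rintegral_cst// mul0r.
    have mI : measurable (N `&` Bp) by exact: measurableI.
    rewrite setIAC /Rintegral -R'A// (subset_measure0 _ mN _ N0)//.
      exact: measurableI.
    by move=> w [[]].
  have {}NAp : P (N `&` A `&` Bp) = 0%E by exact: null_dominates0 PQ1 _ NAp.
  have mU : measurable (N `\` A `|` N `&` A `&` Bp) by exact: measurableU.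
  have U0 := null_setU_null mNA mNAp NA0 NAp.
  have UB0 := null_setU_null mU mBpC U0 Bp0.
  apply: (@subset_measure0 _ _ _ P _ (N `\` A `|` N `&` A `&` Bp `|` ~` Bp)) => //.
  - exact: measurableU.
  - move=> w Nw; have [pw|] := pselect (Bp w); last by right.
    by left; have [Aw|] := pselect (A w); [right|left].
split=> //= B fB; rewrite IZ ?IZs//; exact: mF fB.
Qed.

End pasting.

Section change_of_density.
Context d (T : measurableType d) {R : realType}.

(** Any integrable [Z] representing [Q'] agrees almost surely with the Radon-Nikodym derivative, for
    which the change of variables is known. *)
Lemma Rintegral_density (Q Q' : probability T R) (Z h : T -> R) B :
  Q' `<< Q -> Q.-integrable setT (EFin \o Z) ->
  (forall B, measurable B -> Q' B = \int[Q]_(w in B) (Z w)%:E)%E ->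
  Q'.-integrable setT (EFin \o h) -> measurable B ->
  \int[Q']_(w in B) h w = \int[Q]_(w in B) (h w * Z w).
Proof.
move=> Q'Q iZ ZE ih mB.
have ihB := integrable_sub mB ih.
have DZ : ae_eq Q setT (Radon_Nikodym (charge_of_finite_measure Q') Q) (EFin \o Z).
  apply: integral_ae_eq => //.
  - exact: Radon_Nikodym_integrable.
  - exact: measurable_int iZ.
  - by move=> A _ mA; rewrite -Radon_Nikodym_integral// -ZE.
rewrite /Rintegral -(Radon_Nikodym_change_of_variables Q'Q mB ihB).
congr fine; apply: ae_eq_integral => //.
- apply: emeasurable_funM; first exact: measurable_int ihB.
  exact: measurable_funTS.
- apply/measurable_EFinP; apply: measurable_funM.
    by apply/measurable_EFinP; exact: measurable_int ihB.
  by apply: measurable_funTS; apply/measurable_EFinP; exact: measurable_int iZ.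
- by apply: ae_imply DZ => w /(_ I) -> _; rewrite EFinM.
Qed.

End change_of_density.

Section pasting_consequences.
Context {R : realType} (Om : path_space R) (obs : observation Om).
Local Notation prob := (probability (Borel Om) R).
Context (C : set prob) (P : prob) (C_stable : stable C).
Local Notation Se := (equivalent_models C P).
Implicit Types (Q : prob) (s t : R) (A B : set (Borel Om)).

Let sF t : @sigma_algebra (Borel Om) setT (filtration Om t) :=
  @filtration_sigma_algebra _ Om t.
Let adP s (f : Borel Om -> R) := @adaptedP _ (Borel Om) R _ (sF s) f.
Let mF t (t0 : 0 <= t) := filtration_measurable obs t0.

Lemma cond_exp_exists s Q (x : Borel Om -> R) (M : R) : 0 <= s ->
  measurable_fun setT x -> (forall w, `|x w| <= M) ->
  exists z, is_cond_exp Q (filtration Om s) (EFin \o x) z.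
Proof.
move=> s0 mx xM.
have ix := bounded_integrable Q mx xM.
have [|A fA|z [az iz Iz]] := @additive_bounded_density _ (Borel Om) R _
    (sF s) (mF s0) Q (fun A => \int[Q]_(w in A) x w) M.
- move=> A B fA fB AB0; apply: Rintegral_setU.
  + exact: mF fA.
  + exact: mF fB.
  + by apply: integrable_sub => //; apply: measurableU; [exact: mF fA|exact: mF fB].
  + by rewrite disj_set2E; apply/eqP.
- by apply: Rintegral_bound => //; exact: mF fA.
exists z; split=> // A fA; have mA : measurable A by exact: mF fA.
have ixA := integrable_fin_num mA (integrable_sub mA ix).
have izA := integrable_fin_num mA (integrable_sub mA iz).
have zx : fine (\int[Q]_(w in A) (z w)%:E)%E =
  fine (\int[Q]_(w in A) (x w)%:E)%E by exact: Iz.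
by rewrite -[LHS]fineK// -[RHS]fineK// zx.
Qed.

(** If the models agree on B_s, the pasting density [Z] integrates to [Q1 B] over each event [B] of
    B_s, hence equals 1 almost surely. The pasted model is then exactly [Q1] inside [A]. *)
Lemma pasting_eq_until s A Q1 Q2 : 0 <= s -> filtration Om s A ->
  Se Q1 -> Se Q2 -> eq_until s Q1 Q2 ->
  exists Q, [/\ Se Q, eq_until s Q2 Q,
    forall B, measurable B -> B `<=` A -> Q B = Q1 B &
    forall B, measurable B -> B `<=` ~` A -> Q B = Q2 B].
Proof.
move=> s0 fA S1 S2 Q12.
have [Q [Z [SQ Q2Q [aZ Z0 iZ IZ] QA QC]]] := pasting obs C_stable s0 fA S1 S2.
have ione : Q1.-integrable setT (EFin \o cst 1 : Borel Om -> \bar R).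
  by apply: (@bounded_integrable _ (Borel Om) R Q1 (cst 1) 1) => // w; rewrite normr1.
have aone : @adapted _ (Borel Om) R (filtration Om s) (cst 1).
  by apply/adP; exact: measurable_cst.
have Z_lt : Q1 [set w | Z w < 1] = 0%E.
  have fB : filtration Om s [set w | Z w < 1] :=
    @sub_ltr _ (Borel Om) _ _ (sF s) _ (cst 1) aZ aone.
  apply: (@Rintegral_lt_null _ (Borel Om) R Q1 _ (cst 1) Z (mF s0 fB)) => //.
  rewrite Rintegral_cst ?mul1r; last exact: mF fB.
  by rewrite /Rintegral IZ// -(Q12 _ fB).
have Z_gt : Q1 [set w | 1 < Z w] = 0%E.
  have fB : filtration Om s [set w | 1 < Z w] :=
    @sub_ltr _ (Borel Om) _ _ (sF s) (cst 1) _ aone aZ.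
  apply: (@Rintegral_lt_null _ (Borel Om) R Q1 _ Z (cst 1) (mF s0 fB)) => //.
  rewrite Rintegral_cst ?mul1r; last exact: mF fB.
  by rewrite /Rintegral IZ// -(Q12 _ fB).
have mZ : measurable_fun setT (Z : Borel Om -> R).
  by apply: adapted_measurable aZ; exact: mF.
exists Q; split=> // B mB BA.
  rewrite -(setIidl BA) QA// setIidl// -[RHS]mul1e -(integral_cst Q1 mB).
  apply: ae_eq_integral => //.
    by apply: measurable_funTS; exact/measurable_EFinP.
  exists ([set w | Z w < 1] `|` [set w | 1 < Z w]); split.
  - by apply: measurableU; exact: measurable_ltr_set.
  - by apply: null_setU_null => //; exact: measurable_ltr_set.
  - move=> w /= nZ; have [Z1|Z1|Z1] := ltgtP (Z w) 1; [by left|by right|].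
    by exfalso; apply: nZ => _; rewrite Z1.
by rewrite -(setIidl BA) -setDE QC.
Qed.

(* Pasting Q1 after s onto Q2 gives a model with the same conditional
   expectation z as Q1, whose integrals are computed under Q2. *)
Lemma cond_exp_pasted_le s Q1 Q2 (x z y : Borel Om -> R) (M : R) : 0 <= s ->
  Se Q1 -> Se Q2 -> measurable_fun setT x -> (forall w, `|x w| <= M) ->
  is_cond_exp Q1 (filtration Om s) (EFin \o x) z ->
  @adapted _ (Borel Om) R (filtration Om s) y -> Q2.-integrable setT (EFin \o y) ->
  (forall Q B, Se Q -> eq_until s Q2 Q -> filtration Om s B ->
     \int[Q]_(w in B) x w <= \int[Q2]_(w in B) y w) ->
  Q2 [set w | y w < z w] = 0%E.
Proof.
move=> s0 S1 S2 mx xM [az iz Iz] ay iy xy.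
have fT : filtration Om s setT by exact: (@sub_setT _ (Borel Om) _ (sF s)).
(* Pasting over the whole space, so that [Z] is the density of [Q] with respect to [Q1] on all Borel
   sets. *)
have [Q [Z [SQ Q2Q [aZ Z0 iZ IZ] QT _]]] := pasting obs C_stable s0 fT S1 S2.
have {}QT B : measurable B -> (Q B = \int[Q1]_(w in B) (Z w)%:E)%E.
  by move=> mB; rewrite -[in LHS](setIT B) QT// setIT.
have acst (c : R) : @adapted _ (Borel Om) R (filtration Om s) (cst c).
  by apply/adP; exact: measurable_cst.
have aN : @adapted _ (Borel Om) R (filtration Om s) (fun w => `|z w|).
  by apply/adP; apply: measurableT_comp => //; exact/adP.
pose B : set (Borel Om) := [set w | y w < z w].
have fB : filtration Om s B by exact: (@sub_ltr _ (Borel Om) _ _ (sF s)).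
(* Localization: on [F n] both [Z] and [z] are bounded by n, so their products with integrable
   functions are integrable. *)
pose F (n : nat) : set (Borel Om) :=
  B `&` ([set w | Z w <= n%:R] `&` [set w | `|z w| <= n%:R]).
have fF n : filtration Om s (F n).
  apply: (@sub_setI _ (Borel Om) _ (sF s)) => //.
  apply: (@sub_setI _ (Borel Om) _ (sF s)).
    exact: (@sub_ler _ (Borel Om) _ _ (sF s) _ (cst n%:R)).
  exact: (@sub_ler _ (Borel Om) _ _ (sF s) _ (cst n%:R)).
have FB : \bigcup_n F n = B.
  apply/seteqP; split=> [w [n _ []]//|w Bw].
  exists (Num.truncn (Num.max (Z w) `|z w|)).+1 => //; split=> //.
  have := ltW (truncnS_gt (Num.max (Z w) `|z w|)).
  by rewrite ge_max => /andP[].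
have mFn n : measurable (F n) by exact: mF (fF n).
have FZ n w : F n w -> Z w <= n%:R by case=> _ [].
have Fz n w : F n w -> `|z w| <= n%:R by case=> _ [].
have ix1 := bounded_integrable Q1 mx xM.
have zxE B' : filtration Om s B' -> \int[Q1]_(w in B') z w = \int[Q1]_(w in B') x w.
  by move=> fB'; congr fine; exact: Iz.
have mz : measurable_fun setT (z : Borel Om -> R).
  by apply: adapted_measurable az; exact: mF.
suff F0 n : Q2 (F n) = 0%E.
  rewrite -/B -FB; apply: measure_negligible; first exact: bigcup_measurable.
  apply: negligible_bigcup => n; exists (F n); split; [exact: mFn|exact: F0|by []].
have mFn' : measurable (F n) := mFn n.
have aF : @adapted _ (Borel Om) R (filtration Om s) (\1_(F n)).
  apply/adP; apply: measurable_indic.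
  by rewrite measurable_g_measurableTypeE.
have mI : measurable_fun setT (\1_(F n) : Borel Om -> R) by exact: measurable_indic.
pose f w := \1_(F n) w * z w.
have af : @adapted _ (Borel Om) R (filtration Om s) f.
  by apply/adP; apply: measurable_funM; exact/adP.
have fn w : `|f w| <= n%:R.
  rewrite /f indicE; case: (boolP (w \in F n)) => [/set_mem wF|_].
    by rewrite mul1r Fz.
  by rewrite mul0r normr0.
have mf : measurable_fun setT (f : Borel Om -> R).
  by apply: adapted_measurable af; exact: mF.
have if_ Q' := bounded_integrable Q' mf fn.
apply: (@Rintegral_lt_null _ (Borel Om) R Q2 _ f y (mFn n)) => //.
  by move=> w wF; rewrite /f indicE mem_set// mul1r; case: wF.
rewrite (eq_integral_adapted (sF s) (mF s0) (fF n) af Q2Q)//.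
apply: le_trans (xy Q (F n) SQ Q2Q (fF n)).
have ixQ := bounded_integrable Q mx xM.
rewrite -subr_le0 -RintegralB//;
  [|exact: (integrable_sub mFn' (if_ Q))|exact: integrable_sub].
pose h w := f w - x w.
have ihQ : Q.-integrable setT (EFin \o h) by exact: (RintegrableB (if_ Q) ixQ).
have QQ1 : Q `<< Q1.
  case: SQ => _ QP _; apply: null_dominates_trans QP _.
  by case: S1.
rewrite (Rintegral_density QQ1 iZ QT ihQ (mFn n)).
(* Under [Q1] the difference [x - z] has zero integral over every event of B_s, so [layer_cake_ge]
   with tolerance 0 applies to the adapted factor in front of it. *)
have -> : \int[Q1]_(w in F n) (h w * Z w) =
    - \int[Q1]_(w in F n) (\1_(F n) w * Z w * (x w - z w)).
  rewrite -mulN1r -RintegralZl//.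
    apply: eq_Rintegral => w wF.
    by rewrite /h /f indicE wF !mul1r; ring.
  apply: integrable_sub => //.
  apply: (@Rintegrable_mul _ (Borel Om) R Q1 _ _ n%:R); last exact: RintegrableB.
    apply: measurable_funM => //.
    by apply: adapted_measurable aZ; exact: mF.
  move=> w; rewrite indicE; case: (boolP (w \in F n)) => [/set_mem wF|_].
    by rewrite mul1r ger0_norm// FZ.
  by rewrite mul0r normr0.
rewrite oppr_le0 -(mulr0 n%:R) -oppr0 mulrN.
apply: (layer_cake_ge (sF s) (mF s0)) => //.
- exact: RintegrableB.
- move=> B' fB'; have mB' := mF s0 fB'.
  rewrite RintegralB//; [|exact: integrable_sub|exact: integrable_sub].
  by rewrite zxE// subrr oppr0.
- by apply/adP; apply: measurable_funM; exact/adP.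
- move=> w; rewrite indicE; case: (boolP (w \in F n)) => [/set_mem wF|_].
    by rewrite mul1r Z0 FZ.
  by rewrite mul0r lexx ler0n.
Qed.

End pasting_consequences.

(** * Integrals on the completion *)

Section mixture.
Context d (T : measurableType d) {R : realType}.
Variables (a : R) (Q Q' : probability T R).

Definition mixture (a0 : 0 <= a) (a1 : 0 <= 1 - a) : set T -> \bar R :=
  measure_add (mscale (NngNum a0) Q) (mscale (NngNum a1) Q').

Variables (a0 : 0 <= a) (a1 : 0 <= 1 - a).
Local Notation mix := (mixture a0 a1).

HB.instance Definition _ := Measure.on mix.

Lemma mixtureE A : mix A = (a%:E * Q A + (1 - a)%:E * Q' A)%E.
Proof. by rewrite /mixture measure_addE. Qed.

Let mixture_setT : mix setT = 1%E.
Proof. by rewrite mixtureE !probability_setT !mule1 -EFinD subrKC. Qed.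

HB.instance Definition _ := Measure_isProbability.Build _ _ _ mix mixture_setT.

Lemma Rintegral_mixture (h : T -> R) (M : R) : measurable_fun setT h ->
  (forall w, `|h w| <= M) ->
  \int[mix]_w h w = a * \int[Q]_w h w + (1 - a) * \int[Q']_w h w.
Proof.
move=> mh hM; pose k w := h w + M.
have k0 w : 0 <= k w by have := hM w; rewrite ler_norml /k => /andP[]; lra.
have mk : measurable_fun setT k by exact: measurable_funD.
have kM w : `|k w| <= M + `|M|.
  by rewrite (le_trans (ler_normD _ _))// lerD2r.
have kE (Q1 : probability T R) : \int[Q1]_w k w = \int[Q1]_w h w + M.
  rewrite RintegralD//; [|exact: bounded_integrable hM|].
    by rewrite Rintegral_cst// [X in fine X](@probability_setT _ _ _ Q1) mulr1.
  by apply: (@bounded_integrable _ _ _ _ (cst M) `|M|).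
suff : \int[mix]_w k w = a * \int[Q]_w k w + (1 - a) * \int[Q']_w k w.
  by rewrite !kE; lra.
have kfin (Q1 : probability T R) : (\int[Q1]_w (k w)%:E)%E \is a fin_num.
  by apply: integrable_fin_num => //; exact: bounded_integrable kM.
rewrite /Rintegral; have -> : (\int[mix]_w (k w)%:E =
    a%:E * \int[Q]_w (k w)%:E + (1 - a)%:E * \int[Q']_w (k w)%:E)%E.
  have mkE : measurable_fun setT (EFin \o k) by exact/measurable_EFinP.
  rewrite /mixture ge0_integral_measure_add//; last by move=> w _; rewrite lee_fin.
  by rewrite !ge0_integral_mscale//; move=> w _; rewrite lee_fin.
by rewrite fineD ?fineM ?fin_numM.
Qed.

End mixture.

(** * Bounded continuous functions and approximation in norm *)

Section bounded_continuous.
Context {R : realType} (T : topologicalType).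
Implicit Types (f g : T -> R) (a : R).

Lemma CbP f : Cb R T f <-> continuous f /\ exists M, forall w, `|f w| <= M.
Proof.
split=> -[cf bf]; split=> //.
  have [M [_ fM]] := bf; exists (M + 1) => w.
  by apply: fM => //; rewrite ltrDl.
have [M fM] := bf; exists M; split; first exact: num_real.
by move=> N MN w _; exact: le_trans (ltW MN).
Qed.

Lemma Cb_cst a : Cb R T (fun=> a).
Proof. by apply/CbP; split; [move=> w; exact: cvg_cst|exists `|a|]. Qed.

Lemma CbD f g : Cb R T f -> Cb R T g -> Cb R T (fun w => f w + g w).
Proof.
move=> /CbP[cf [M fM]] /CbP[cg [N gN]]; apply/CbP; split.
  by move=> w; apply: cvgD; [exact: cf|exact: cg].
by exists (M + N) => w; rewrite (le_trans (ler_normD _ _))// lerD.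
Qed.

Lemma CbM f g : Cb R T f -> Cb R T g -> Cb R T (fun w => f w * g w).
Proof.
move=> /CbP[cf [M fM]] /CbP[cg [N gN]]; apply/CbP; split.
  by move=> w; apply: cvgM; [exact: cf|exact: cg].
by exists (M * N) => w; rewrite normrM ler_pM.
Qed.

Lemma CbZ a f : Cb R T f -> Cb R T (fun w => a * f w).
Proof. by move=> fC; apply: CbM => //; exact: Cb_cst. Qed.

Lemma CbN f : Cb R T f -> Cb R T (fun w => - f w).
Proof.
move=> fC; rewrite (_ : (fun w => - f w) = fun w => -1 * f w); first exact: CbZ.
by apply/funext => w; rewrite mulN1r.
Qed.

Lemma CbB f g : Cb R T f -> Cb R T g -> Cb R T (fun w => f w - g w).
Proof. by move=> fC gC; apply: CbD => //; exact: CbN. Qed.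

Lemma Cb_norm f : Cb R T f -> Cb R T (fun w => `|f w|).
Proof.
move=> /CbP[cf [M fM]]; apply/CbP; split.
  by move=> w; apply: cvg_norm; exact: cf.
by exists M => w; rewrite normr_id.
Qed.

Lemma Cb_positive f : Cb R T f -> Cb R T (fun w => Num.max (f w) 0).
Proof.
move=> /CbP[cf [M fM]]; apply/CbP; split.
  by move=> w; apply: continuous_max; [exact: cf|exact: cvg_cst].
by exists M => w; case: (leP (f w) 0); rewrite ?normr0// (le_trans _ (fM w)).
Qed.

End bounded_continuous.

Lemma closure_normP {R : realType} (L : normedModType R) (A : set L) (x : L) :
  closure A x <-> forall e, 0 < e -> exists2 y, A y & `|y - x| < e.
Proof.
split=> [Ax e e0|Ax B /nbhs_ballP[e /= e0 xB]].
  have [y [Ay xy]] := Ax _ (nbhsx_ballx x e e0).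
  by exists y => //; rewrite distrC; move: xy; rewrite -ball_normE.
have [y Ay yx] := Ax e e0; exists y; split=> //; apply: xB.
by rewrite -ball_normE /= distrC.
Qed.

Lemma eq_of_normr_le {R : realType} (a b : R) :
  (forall e, 0 < e -> `|a - b| <= e) -> a = b.
Proof.
move=> ab; apply/eqP; rewrite -subr_eq0 -normr_le0; apply/ler_addgt0Pr => e e0.
by rewrite add0r; exact: ab.
Qed.

Section evaluation.
Context {R : realType} (Om : path_space R) (obs : observation Om).
Local Notation prob := (probability (Borel Om) R).
Context (C : set prob) (P : prob) (C_convex : convex_probs C).
Context (L : completeNormedModType R) (i : (Om -> R) -> L).
Hypothesis L1_C : is_completion (capacity (risk C)) i.
Hypothesis P_risk : forall X, Cb R Om X -> risk C X = risk (dominated C P) X.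
Local Notation Se := (equivalent_models C P).
Hypothesis Se0 : Se !=set0.
Implicit Types (Q : prob) (s t : R) (A B : set (Borel Om)) (f g : Om -> R)
  (X Y : L).

Lemma Cb_integrable Q f : Cb R Om f ->
  Q.-integrable setT (EFin \o f : Borel Om -> \bar R).
Proof.
move=> fC; have [_ [M fM]] := (CbP f).1 fC.
exact: (@bounded_integrable _ (Borel Om) R Q f M (Cb_measurable fC) fM).
Qed.

Let risk_set_bounded (D : set prob) f : Cb R Om f ->
  has_ubound [set \int[Q]_w (- f w) | Q in D].
Proof.
move=> fC; have [_ [M fM]] := (CbP _).1 (CbN fC).
exists (M * 1) => _ [Q _ <-].
rewrite -[1]/(fine 1%E) -(@probability_setT _ _ _ Q).
apply: le_trans (ler_norm _) _.
by apply: Rintegral_bound => //; apply: Cb_measurable => //; exact: CbN.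
Qed.

Lemma risk_ge Q f : C Q -> Cb R Om f -> \int[Q]_w (- f w) <= risk C f.
Proof. by move=> CQ fC; apply: ub_le_sup; [exact: risk_set_bounded|exists Q]. Qed.

(* A dominated model is the limit of its mixtures with an equivalent one. *)
Lemma risk_lt f e : Cb R Om f -> 0 < e ->
  exists2 Q, Se Q & risk C f - e < \int[Q]_w (- f w).
Proof.
move=> fC e0; have [Q0 [CQ0 Q0P PQ0]] := Se0.
have [_ [M fM]] := (CbP _).1 (CbN fC).
have mf : measurable_fun setT ((fun w => - f w) : Borel Om -> R).
  by apply: Cb_measurable => //; exact: CbN.
have M0 : 0 <= M by exact: le_trans (fM point).
have Df : has_sup [set \int[Q]_w (- f w) | Q in dominated C P].
  by split; [exists (\int[Q0]_w (- f w)), Q0|exact: risk_set_bounded].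
have e2 : 0 < e / 2 by lra.
have [_ [Q [CQ QP] <-]] := sup_adherent e2 Df.
rewrite -/(risk (dominated C P) f) -P_risk// => fQ.
(* The weight is at most 1, and moving it from [Q] to [Q0] lowers the integral by at most
   [2 * M * a < e / 2]. *)
pose a := e / (4 * M + 4 + e).
have den : 0 < 4 * M + 4 + e by lra.
have a0 : 0 <= a by rewrite divr_ge0// ltW.
have a1 : 0 <= 1 - a by rewrite subr_ge0 ler_pdivrMr//; lra.
have aE : a * (4 * M + 4 + e) = e by rewrite divfK// gt_eqF.
have an0 : 0 < a by rewrite divr_gt0.
exists (mixture Q0 Q a0 a1).
  have a01 : 0 <= a <= 1 by rewrite a0; lra.
  split.
  - by apply: (C_convex CQ0 CQ a01) => A _; exact: mixtureE.
  - apply/null_content_dominatesP => A mA PA0.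
    suff : mixture Q0 Q a0 a1 A = 0%E by [].
    by rewrite mixtureE (null_dominates0 Q0P)// (null_dominates0 QP)// !mule0 adde0.
  - apply/null_content_dominatesP => A mA mA0.
    have : mixture Q0 Q a0 a1 A = 0%E by [].
    rewrite mixtureE => /eqP; rewrite padde_eq0 ?mule_ge0// => /andP[/eqP + _].
    move/eqP; rewrite mule_eq0 eqe gt_eqF//= => /eqP.
    exact: null_dominates0 PQ0 mA.
rewrite (Rintegral_mixture Q0 Q a0 a1 mf fM).
have bound Q1 : `|\int[Q1]_w (- f w)| <= M.
  rewrite -[leRHS]mulr1 -[1]/(fine 1%E) -(@probability_setT _ _ _ Q1).
  exact: Rintegral_bound.
move: (bound Q0) (bound Q) fQ; rewrite !ler_norml => /andP[+ _] /andP[_ +].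
set u := \int[Q0]_w (- f w); set v := \int[Q]_w (- f w) => Mu vM fv.
have : a * (u - v) >= a * (- (2 * M)) by rewrite ler_pM2l//; lra.
have : 0 <= a * M by rewrite mulr_ge0.
have : 0 < a * e by rewrite mulr_gt0.
lra.
Qed.

Lemma i_lin a f g : Cb R Om f -> Cb R Om g ->
  i (fun w => a * f w + g w) = a *: i f + i g.
Proof. by case: L1_C => + _ _; exact. Qed.

Lemma i_sub f g : Cb R Om f -> Cb R Om g -> i (fun w => f w - g w) = i f - i g.
Proof.
move=> fC gC; rewrite addrC -scaleN1r -i_lin//; congr i.
by apply/funext => w; rewrite mulN1r addrC.
Qed.

Lemma i_dense X e : 0 < e -> exists2 f, Cb R Om f & `|i f - X| < e.
Proof.
move=> e0; have : closure (i @` Cb R Om) X by case: L1_C => _ _ ->.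
by move=> /closure_normP /(_ e e0)[_ [f fC <-] fX]; exists f.
Qed.

Lemma norm_ge Q f : C Q -> Cb R Om f -> \int[Q]_w `|f w| <= `|i f|.
Proof.
move=> CQ fC; case: (L1_C) => _ -> // _.
have := risk_ge CQ (CbN (Cb_norm fC)); apply: le_trans.
by under [in leRHS]eq_Rintegral do rewrite opprK.
Qed.

(** With [norm_ge], this makes the norm a supremum over equivalent models only. *)
Lemma norm_lt f e : Cb R Om f -> 0 < e ->
  exists2 Q, Se Q & `|i f| - e < \int[Q]_w `|f w|.
Proof.
move=> fC e0; have [Q SQ] := risk_lt (CbN (Cb_norm fC)) e0.
case: (L1_C) => _ -> // _; rewrite /capacity => fQ; exists Q => //.
by apply: lt_le_trans fQ _; under eq_Rintegral do rewrite opprK.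
Qed.

(* The continuous extension to L of f |-> E_Q(f 1_A). *)
Definition evaluation Q A X : R :=
  sup [set \int[Q]_(w in A) f w - `|i f - X| | f in Cb R Om].

Let Rintegral_sub_le Q A f g : C Q -> measurable A -> Cb R Om f -> Cb R Om g ->
  `|\int[Q]_(w in A) f w - \int[Q]_(w in A) g w| <= `|i f - i g|.
Proof.
move=> CQ mA fC gC; rewrite -i_sub//.
apply: le_trans (norm_ge CQ (CbB fC gC)).
by apply: le_Rintegral_norm_sub => //; exact: Cb_integrable.
Qed.

(** For [Q] in [C] the integral over [A] is 1-Lipschitz for the norm of L, and [evaluation] is its
    McShane extension: the largest of the lower bounds that the values on [Cb] impose at [X]. *)
Lemma evaluation_approx Q A X f : C Q -> measurable A -> Cb R Om f ->
  `|\int[Q]_(w in A) f w - evaluation Q A X| <= `|i f - X|.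
Proof.
move=> CQ mA fC.
have ub g : Cb R Om g ->
    ubound [set \int[Q]_(w in A) f w - `|i f - X| | f in Cb R Om]
      (\int[Q]_(w in A) g w + `|i g - X|).
  move=> gC _ [h hC <-]; rewrite lerBlDr -addrA -lerBlDl.
  apply: le_trans (ler_norm _) _; apply: le_trans (Rintegral_sub_le CQ mA hC gC) _.
  rewrite -(subrKA X) (le_trans (ler_normD _ _))//.
  by rewrite (distrC X) addrC.
have h1 : evaluation Q A X <= \int[Q]_(w in A) f w + `|i f - X|.
  apply: ge_sup; last exact: ub.
  by exists (\int[Q]_(w in A) f w - `|i f - X|), f.
have h2 : \int[Q]_(w in A) f w - `|i f - X| <= evaluation Q A X.
  apply: ub_le_sup; last by exists f.
  by exists (\int[Q]_(w in A) f w + `|i f - X|); exact: ub.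
by rewrite ler_norml; apply/andP; split; lra.
Qed.

(** By density, a Lipschitz estimate with any constant determines the value at [X]. *)
Lemma evaluation_unique Q A X (K e : R) : C Q -> measurable A -> 0 <= K ->
  (forall f, Cb R Om f -> `|\int[Q]_(w in A) f w - e| <= K * `|i f - X|) ->
  evaluation Q A X = e.
Proof.
move=> CQ mA K0 he; apply: eq_of_normr_le => c c0.
have K1 : 0 < K + 1 by lra.
have [f fC fX] := i_dense X (divr_gt0 c0 K1).
have h1 := evaluation_approx X CQ mA fC; have h2 := he f fC.
rewrite -(subrKA (\int[Q]_(w in A) f w)) (le_trans (ler_normD _ _))//.
rewrite (distrC (evaluation Q A X)).
have : (K + 1) * `|i f - X| <= c by rewrite -ler_pdivlMl// mulrC ltW.
lra.
Qed.

Lemma evaluation_i Q A f : C Q -> measurable A -> Cb R Om f ->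
  evaluation Q A (i f) = \int[Q]_(w in A) f w.
Proof.
move=> CQ mA fC; apply: (@evaluation_unique _ _ _ 1) => // g gC.
by rewrite mul1r; exact: Rintegral_sub_le.
Qed.

Lemma evaluation_lin Q A a X Y : C Q -> measurable A ->
  evaluation Q A (a *: X + Y) = a * evaluation Q A X + evaluation Q A Y.
Proof.
move=> CQ mA; apply: eq_of_normr_le => c c0.
pose K := `|a| + 1; have K0 : 0 < K by rewrite /K ltr_pwDr.
have cK : 0 < c / (2 * K) by rewrite divr_gt0// mulr_gt0.
have [f fC fX] := i_dense X cK; have [g gC gY] := i_dense Y cK.
have fgC : Cb R Om (fun w => a * f w + g w) by apply: CbD => //; exact: CbZ.
have h := evaluation_approx (a *: X + Y) CQ mA fgC.
have hf := evaluation_approx X CQ mA fC; have hg := evaluation_approx Y CQ mA gC.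
have If : \int[Q]_(w in A) (a * f w + g w) =
    a * \int[Q]_(w in A) f w + \int[Q]_(w in A) g w.
  have fi := Cb_integrable Q fC; have gi := Cb_integrable Q gC.
  rewrite RintegralD ?RintegralZl//; try exact: integrable_sub.
  by apply: integrable_sub => //; exact: RintegrableZ.
move: h; rewrite If i_lin// opprD addrACA -scalerBr => h.
have {}h := le_trans h (ler_normD _ _); rewrite normrZ in h.
set I := \int[Q]_(w in A) f w in hf h; set J := \int[Q]_(w in A) g w in hg h.
have -> : evaluation Q A (a *: X + Y) - (a * evaluation Q A X + evaluation Q A Y) =
  - (a * I + J - evaluation Q A (a *: X + Y)) + (a * (I - evaluation Q A X) +
    (J - evaluation Q A Y)) by ring.
apply: le_trans (ler_normD _ _) _; rewrite normrN.
apply: le_trans (lerD h (ler_normD _ _)) _; rewrite normrM.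
have haf : `|a| * `|I - evaluation Q A X| <= `|a| * `|i f - X| by rewrite ler_wpM2l.
have ha : `|a| * `|i f - X| <= `|a| * (c / (2 * K)) by rewrite ler_wpM2l// ltW.
have : c = `|a| * (c / (2 * K)) + c / (2 * K) + (`|a| * (c / (2 * K)) + c / (2 * K)).
  by rewrite /K; field; rewrite gt_eqF.
lra.
Qed.

Lemma evaluationD Q A X Y : C Q -> measurable A ->
  evaluation Q A (X + Y) = evaluation Q A X + evaluation Q A Y.
Proof. by move=> CQ mA; rewrite -[X in X + _]scale1r evaluation_lin// mul1r. Qed.

Lemma evaluation0 Q A : C Q -> measurable A -> evaluation Q A 0 = 0.
Proof.
move=> CQ mA; have := evaluationD 0 0 CQ mA; rewrite addr0 => h.
by apply: (@addrI _ (evaluation Q A 0)); rewrite -h addr0.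
Qed.

Lemma evaluationZ Q A a X : C Q -> measurable A ->
  evaluation Q A (a *: X) = a * evaluation Q A X.
Proof.
by move=> CQ mA; rewrite -[a *: X]addr0 evaluation_lin// evaluation0// addr0.
Qed.

Lemma evaluationN Q A X : C Q -> measurable A ->
  evaluation Q A (- X) = - evaluation Q A X.
Proof. by move=> CQ mA; rewrite -scaleN1r evaluationZ// mulN1r. Qed.

Lemma evaluationB Q A X Y : C Q -> measurable A ->
  evaluation Q A (X - Y) = evaluation Q A X - evaluation Q A Y.
Proof. by move=> CQ mA; rewrite evaluationD// evaluationN. Qed.

Lemma evaluation_norm Q A X : C Q -> measurable A ->
  `|evaluation Q A X| <= `|X|.
Proof.
move=> CQ mA; apply/ler_addgt0Pr => e e0.
have e2 : 0 < e / 2 by lra.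
have [f fC fX] := i_dense X e2.
have h := evaluation_approx X CQ mA fC.
have hf : `|\int[Q]_(w in A) f w| <= `|i f|.
  apply: le_trans (norm_ge CQ fC).
  by apply: normr_Rintegral_le => //; exact: Cb_integrable.
rewrite -(subrK (\int[Q]_(w in A) f w) (evaluation Q A X)).
apply: le_trans (ler_normD _ _) _; rewrite distrC.
have : `|i f| <= `|i f - X| + `|X| by rewrite -{1}(subrK X (i f)) ler_normD.
lra.
Qed.

Lemma evaluation_ge0 Q A X : C Q -> measurable A -> L1_le i 0 X ->
  0 <= evaluation Q A X.
Proof.
move=> CQ mA; rewrite /L1_le subr0 => /closure_normP X0.
apply/ler_addgt0Pr => e e0; have [_ [f [fC f0] <-] fX] := X0 e e0.
have := evaluation_approx X CQ mA fC; rewrite ler_norml => /andP[_].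
have : 0 <= \int[Q]_(w in A) f w by apply: Rintegral_ge0.
lra.
Qed.

Lemma eq_evaluation Q Q' A X :
  (forall B, measurable B -> B `<=` A -> Q B = Q' B) ->
  evaluation Q A X = evaluation Q' A X.
Proof.
move=> QQ'; congr sup; apply: eq_imagel => f _; congr (_ - _).
by congr fine; exact: eq_measure_integral.
Qed.

Lemma evaluation_null Q A X : C Q -> measurable A -> Q A = 0%E ->
  evaluation Q A X = 0.
Proof.
move=> CQ mA QA0; apply: (@evaluation_unique _ _ _ 1) => // f fC.
by rewrite Rintegral_null// ?subrr ?normr0 ?mulr_ge0//; exact: Cb_integrable.
Qed.

End evaluation.

Section class_representatives.
Context {R : realType} (Om : path_space R).
Local Notation prob := (probability (Borel Om) R).
Context (C : set prob) (P : prob).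
Context (L : completeNormedModType R) (i : (Om -> R) -> L).
Hypothesis L1_C : is_completion (capacity (risk C)) i.
Local Notation Se := (equivalent_models C P).

Lemma Rintegral_ge0_ae (Q : prob) A (h : Borel Om -> R) : measurable A ->
  measurable_fun setT h -> {ae Q, forall w, 0 <= h w} ->
  0 <= \int[Q]_(w in A) h w.
Proof.
move=> mA mh h0; rewrite /Rintegral.
have -> : (\int[Q]_(w in A) (h w)%:E = \int[Q]_(w in A) (Num.max (h w) 0)%:E)%E.
  apply: ae_eq_integral => //.
  - by apply: measurable_funTS; exact/measurable_EFinP.
  - apply: measurable_funTS; apply/measurable_EFinP.
    by apply: measurable_maxr.
  - by apply: ae_imply h0 => w h0 _; rewrite max_l.
by rewrite fine_ge0// integral_ge0// => w _; rewrite lee_fin le_max lexx orbT.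
Qed.

(* Where dQ/dP <= k, L^1(P)-convergence of g_n to y implies L^1(Q)-convergence. *)
Lemma class_dist (Q : prob) X y f : Se Q -> L1_class i P X y -> Cb R Om f ->
  (\int[Q]_w `|f w - y w|%:E <= `|i f - X|%:E)%E.
Proof.
move=> [CQ QP PQ] [iy [g gC [gX gy]]] fC.
pose D := Radon_Nikodym_SigmaFinite.f Q P.
have D0 w : (0 <= D w)%E by exact: Radon_Nikodym_SigmaFinite.f_ge0.
have Dfin w : D w \is a fin_num by exact: Radon_Nikodym_SigmaFinite.f_fin_num.
have mD : measurable_fun setT D.
  by apply: measurable_int; exact: Radon_Nikodym_SigmaFinite.f_integrable QP.
have my : measurable_fun setT (y : Borel Om -> R).
  by apply/measurable_EFinP; exact: measurable_int iy.
have mf := Cb_measurable fC.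
pose E (k : nat) : set (Borel Om) := [set w | (D w <= k%:R%:E)%E].
have mE k : measurable (E k).
  rewrite (_ : E k = setT `&` D @^-1` `]-oo, k%:R%:E]%classic).
    by apply: mD => //; exact: emeasurable_itv.
  by rewrite setTI; apply/seteqP; split=> w; rewrite /E/= in_itv.
have mfy (h : Borel Om -> R) : measurable_fun setT h ->
    measurable_fun setT ((fun w => `|h w - y w|%:E) : Borel Om -> \bar R).
  move=> mh; apply/measurable_EFinP; apply: measurableT_comp => //.
  exact: measurable_funB.
(* Triangle inequality through [g n]: the first distance is bounded by the norm, while the second
   passes from [Q] to [P] at the price of the factor k. *)
have bound k n : (\int[Q]_(w in E k) `|f w - y w|%:E <=
    `|i f - i (g n)|%:E + k%:R%:E * \int[P]_w `|g n w - y w|%:E)%E.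
  have mg := Cb_measurable (gC n).
  have fgC := CbB fC (gC n).
  have mfg := Cb_measurable (Cb_norm fgC).
  apply: (@le_trans _ _
    (\int[Q]_(w in E k) (`|f w - g n w|%:E + `|g n w - y w|%:E))%E).
    apply: ge0_le_integral => //.
    - by apply: measurable_funTS; exact: mfy.
    - apply: emeasurable_funD; apply: measurable_funTS; last exact: mfy.
      exact/measurable_EFinP.
    - by move=> w _; rewrite -EFinD lee_fin -(subrKA (g n w)) ler_normD.
  rewrite ge0_integralD//; last 2 first.
    by apply: measurable_funTS; exact/measurable_EFinP.
    by apply: measurable_funTS; exact: mfy.
  apply: leeD.
    rewrite -(i_sub L1_C)//.
    apply: le_trans (_ : (\int[Q]_w `|f w - g n w|%:E <= _)%E).
      apply: ge0_subset_integral => //; exact/measurable_EFinP.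
    rewrite -[leLHS]fineK; first by rewrite lee_fin; exact: (norm_ge L1_C CQ fgC).
    by apply: integrable_fin_num => //; exact: Cb_integrable (Cb_norm fgC).
  rewrite -(Radon_Nikodym_SigmaFinite.change_of_variables QP)//; last first.
    by apply: measurable_funTS; exact: mfy.
  apply: (@le_trans _ _ (\int[P]_(w in E k) (k%:R%:E * `|g n w - y w|%:E))%E).
    apply: ge0_le_integral => //.
    - by move=> w _; apply: mule_ge0 => //; exact: D0.
    - by apply: emeasurable_funM; apply: measurable_funTS => //; exact: mfy.
    - by apply: measurable_funTS; apply: measurable_funeM; exact: mfy.
    - by move=> w wE; rewrite muleC lee_wpmul2r.
  rewrite ge0_integralZl//; last by apply: measurable_funTS; exact: mfy.
  by rewrite lee_wpmul2l// ge0_subset_integral//; exact: mfy.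
(* The limit in n comes first, with k fixed, so the [P]-term vanishes; the sets [E k] then exhaust
   the space and monotone convergence concludes. *)
have {}bound k : (\int[Q]_(w in E k) `|f w - y w|%:E <= `|i f - X|%:E)%E.
  have cv : (`|i f - i (g n)|%:E + k%:R%:E * \int[P]_w `|g n w - y w|%:E)%E
      @[n --> \oo] --> (`|i f - X|%:E + k%:R%:E * 0)%E.
    apply: cvgeD => //; last exact: cvgeZl.
    apply: cvg_EFin; first exact: nearW.
    by apply: cvg_norm; apply: cvgB => //; exact: cvg_cst.
  by move: cv; rewrite mule0 adde0; apply: cvge_ge; exact: nearW.
have ET : \bigcup_k E k = setT.
  apply/seteqP; split=> // w _; exists (Num.truncn (fine (D w))).+1 => //.
  by rewrite /E/= -[leLHS]fineK// lee_fin ltW// truncnS_gt.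
rewrite -ET; have : (\int[Q]_(w in E k) `|f w - y w|%:E)%E @[k --> \oo] -->
    (\int[Q]_(w in \bigcup_k E k) `|f w - y w|%:E)%E.
  apply: ge0_nondecreasing_set_cvg_integral => //.
  - move=> m n mn; apply/subsetPset => w; rewrite /E/= => /le_trans; apply.
    by rewrite lee_fin ler_nat.
  - by move=> k; apply: measurable_funTS; exact: mfy.
by apply: cvge_le; exact: nearW.
Qed.

(** The bridge from L to almost sure statements: one representative under [P] computes the
    evaluations under every equivalent model. *)
Lemma class_evaluation (Q : prob) X y : Se Q -> L1_class i P X y ->
  Q.-integrable setT (EFin \o y : Borel Om -> \bar R) /\
  forall A, measurable A -> evaluation i Q A X = \int[Q]_(w in A) y w.
Proof.
move=> SQ Xy; have CQ : C Q by case: SQ.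
have dist f := @class_dist Q X y f SQ Xy.
have my : measurable_fun setT (y : Borel Om -> R).
  by apply/measurable_EFinP; case: Xy => iy _; exact: measurable_int iy.
have fyi f : Cb R Om f ->
    Q.-integrable setT (EFin \o (fun w => f w - y w) : Borel Om -> \bar R).
  move=> fC; apply/integrableP; split.
    by apply/measurable_EFinP; apply: measurable_funB => //; exact: Cb_measurable.
  by apply: le_lt_trans (dist f fC) _; rewrite ltry.
have yi : Q.-integrable setT (EFin \o y : Borel Om -> \bar R).
  have C0 : Cb R Om (fun=> 0) by exact: Cb_cst.
  have := RintegrableN (fyi _ C0).
  rewrite (_ : EFin \o (fun w => - _) = EFin \o y)//.
  by apply/funext => w /=; rewrite sub0r opprK.
split=> // A mA; apply: (evaluation_unique L1_C (K := 1)) => // f fC.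
rewrite mul1r; have fi := Cb_integrable Q fC.
apply: le_trans (le_Rintegral_norm_sub mA fi yi) _.
rewrite -lee_fin fineK; first exact: dist.
exact: integrable_fin_num (Rintegrable_normr (fyi f fC)).
Qed.

End class_representatives.

(** * Conditional risk *)

Lemma cvg_of_dist {R : realType} (L : completeNormedModType R) (u : nat -> L)
  (K : R) : 0 <= K ->
  (forall n m, `|u n - u m| <= K * (n.+1%:R^-1 + m.+1%:R^-1)) ->
  exists l : L, u n @[n --> \oo] --> l.
Proof.
move=> K0 uK; apply/cvg_ex/cauchy_cvgP/cauchy_exP => e e0.
have [N NK] : exists N : nat, 2 * K / e < N.+1%:R.
  exists (Num.truncn (2 * K / e)); exact: truncnS_gt.
exists (u N); suff : \forall n \near \oo, ball (u N) e (u n) by [].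
near=> n; rewrite -ball_normE /=.
apply: le_lt_trans (uK _ _) _.
have nN : n.+1%:R^-1 <= N.+1%:R^-1 :> R.
  rewrite lef_pV2 ?posrE ?ltr0n// ler_nat ltnS.
  by near: n; exact: nbhs_infty_ge.
apply: (@le_lt_trans _ _ (K * (N.+1%:R^-1 + N.+1%:R^-1))).
  by rewrite ler_wpM2l// lerD2l.
move: NK; rewrite ltr_pdivrMr// => NK.
have -> : K * (N.+1%:R^-1 + N.+1%:R^-1) = 2 * K / N.+1%:R by ring.
by rewrite ltr_pdivrMr ?ltr0n//; lra.
Unshelve. all: by end_near. Qed.


(** * Values at a fixed time: norm, order, uniqueness and closedness *)

Section time_values.
Context {R : realType} (Om : path_space R) (obs : observation Om).
Local Notation prob := (probability (Borel Om) R).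
Context (C : set prob) (P : prob) (C_convex : convex_probs C).
Hypothesis C_stable : stable C.
Context (L : completeNormedModType R) (i : (Om -> R) -> L).
Hypothesis L1_C : is_completion (capacity (risk C)) i.
Hypothesis P_risk : forall X, Cb R Om X -> risk C X = risk (dominated C P) X.
Local Notation Se := (equivalent_models C P).
Hypothesis Se0 : Se !=set0.
Local Notation E := (evaluation i).
Implicit Types (Q : prob) (s t : R) (A B : set (Borel Om)) (f g : Om -> R)
  (X Y W : L).

Let SeC Q : Se Q -> C Q. Proof. by case. Qed.
Let sF t : @sigma_algebra (Borel Om) setT (filtration Om t) :=
  @filtration_sigma_algebra _ Om t.
Let mF t (t0 : 0 <= t) := filtration_measurable obs t0.

Let a0 t (c : R) : @adapted _ (Borel Om) R (filtration Om t) (cst c).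
Proof. by apply/(adaptedP (sF t)); exact: measurable_cst. Qed.

Lemma Cb_upto_Cb s f : 0 <= s -> Cb_upto Om s f -> Cb R Om f.
Proof.
move=> s0 [g /CbP[cg [M gM]] <-]; apply/CbP; split; last by exists M => w; exact: gM.
apply/continuousP => V oV; apply: (observable_open obs s0).
by exists (g @^-1` V) => //; move/continuousP : cg; exact.
Qed.

Lemma Cb_upto_lin s a f g : Cb_upto Om s f -> Cb_upto Om s g ->
  Cb_upto Om s (fun w => a * f w + g w).
Proof.
move=> [f' fC <-] [g' gC <-]; exists (fun w => a * f' w + g' w) => //.
by apply: CbD => //; exact: CbZ.
Qed.

Lemma Cb_upto_mul s f g : Cb_upto Om s f -> Cb_upto Om s g ->
  Cb_upto Om s (fun w => f w * g w).
Proof.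
by move=> [f' fC <-] [g' gC <-]; exists (fun w => f' w * g' w) => //; exact: CbM.
Qed.

Lemma L1_upto_approx s X e : L1_upto i s X -> 0 < e ->
  exists2 f, Cb_upto Om s f & `|i f - X| < e.
Proof.
by move=> /closure_normP sX e0; have [_ [f fC <-] fX] := sX e e0; exists f.
Qed.

Lemma L1_upto_closed s X :
  (forall e, 0 < e -> exists2 Y, L1_upto i s Y & `|Y - X| < e) -> L1_upto i s X.
Proof.
move=> YX; apply/closure_normP => e e0; have e2 : 0 < e / 2 by lra.
have [Y sY hY] := YX _ e2; have [f fC fY] := L1_upto_approx sY e2.
exists (i f); first by exists f.
by rewrite -(subrKA Y) (le_lt_trans (ler_normD _ _))// [e]splitr ltrD.
Qed.

Lemma L1_upto_lin s a X Y : 0 <= s -> L1_upto i s X -> L1_upto i s Y ->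
  L1_upto i s (a *: X + Y).
Proof.
move=> s0 sX sY; apply/closure_normP => e e0.
pose K := `|a| + 1; have K0 : 0 < K by rewrite /K ltr_pwDr.
have eK : 0 < e / (2 * K) by rewrite divr_gt0// mulr_gt0.
have e2 : 0 < e / 2 by lra.
have [f fC fX] := L1_upto_approx sX eK; have [g gC gY] := L1_upto_approx sY e2.
exists (i (fun w => a * f w + g w)).
  by exists (fun w => a * f w + g w) => //; exact: Cb_upto_lin.
have /= fCb := Cb_upto_Cb s0 fC; have gCb := Cb_upto_Cb s0 gC.
rewrite (i_lin L1_C)// opprD addrACA -scalerBr (le_lt_trans (ler_normD _ _))//.
rewrite [e]splitr ler_ltD// normrZ.
apply: (@le_trans _ _ (K * (e / (2 * K)))).
  by apply: ler_pM => //; [rewrite /K lerDl|exact: ltW].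
by rewrite le_eqVlt; apply/orP; left; apply/eqP; field; rewrite gt_eqF.
Qed.

Lemma L1_upto_i s f : Cb_upto Om s f -> L1_upto i s (i f).
Proof. by move=> fC; apply: subset_closure; exists f. Qed.

Lemma L1_uptoB s X Y : 0 <= s -> L1_upto i s X -> L1_upto i s Y ->
  L1_upto i s (X - Y).
Proof. by move=> s0 sX sY; rewrite addrC -scaleN1r; exact: L1_upto_lin. Qed.

Lemma L1_uptoZ s a X : 0 <= s -> L1_upto i s X -> L1_upto i s (a *: X).
Proof.
move=> s0 sX; rewrite -[a *: X]addr0 -(subrr X).
apply: L1_upto_lin => //; exact: L1_uptoB.
Qed.

Lemma L1_uptoD s X Y : 0 <= s -> L1_upto i s X -> L1_upto i s Y ->
  L1_upto i s (X + Y).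
Proof. by move=> s0 sX sY; rewrite -[X]scale1r; exact: L1_upto_lin. Qed.

Lemma evaluation_eq_until s Q Q' A Y : 0 <= s -> Se Q -> Se Q' ->
  eq_until s Q Q' -> filtration Om s A -> L1_upto i s Y -> E Q A Y = E Q' A Y.
Proof.
move=> s0 SQ SQ' QQ' fA sY; apply: eq_of_normr_le => e e0.
have e2 : 0 < e / 2 by lra.
have [f fC fY] := L1_upto_approx sY e2; have fCb := Cb_upto_Cb s0 fC.
have mA := mF s0 fA.
have h := evaluation_approx L1_C Y (SeC SQ) mA fCb.
have h' := evaluation_approx L1_C Y (SeC SQ') mA fCb.
have fE : \int[Q]_(w in A) f w = \int[Q']_(w in A) f w.
  apply: (eq_integral_adapted (sF s) (mF s0)) => //; [|exact: Cb_integrable..].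
  exact: Cb_upto_adapted.
rewrite -(subrKA (\int[Q]_(w in A) f w)) (le_trans (ler_normD _ _))//.
by rewrite distrC {2}fE; lra.
Qed.

(** [W] is approximated by [g] in [Cb_upto Om s]. With [A] the B_s-event where [g >= 0], the
    difference of the integrals over [A] and its complement is the integral of [|g|], nearly the
    norm for a suitable equivalent model. *)
Lemma norm_le_upto s W (K : R) : 0 <= s -> L1_upto i s W ->
  (forall Q A, Se Q -> filtration Om s A -> E Q A W - E Q (~` A) W <= K) ->
  `|W| <= K.
Proof.
move=> s0 sW WK; apply/ler_addgt0Pr => e e0.
have e4 : 0 < e / 4 by lra.
have [g gC gW] := L1_upto_approx sW e4; have gCb := Cb_upto_Cb s0 gC.
have [Q SQ gQ] := norm_lt C_convex L1_C P_risk Se0 gCb e4.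
pose A : set (Borel Om) := [set w | 0 <= g w].
have fA : filtration Om s A.
  have ag := Cb_upto_adapted obs s0 gC.
  exact: (@sub_ler _ (Borel Om) R _ (sF s) (cst 0) g (@a0 s 0) ag).
have mA := mF s0 fA; have mCA := measurableC mA.
have hA := evaluation_approx L1_C W (SeC SQ) mA gCb.
have hC := evaluation_approx L1_C W (SeC SQ) mCA gCb.
have gi := Cb_integrable Q gCb.
have gE : \int[Q]_w `|g w| = \int[Q]_(w in A) g w - \int[Q]_(w in ~` A) g w.
  rewrite (Rintegral_setC mA (Rintegrable_normr gi)) -RintegralN//; congr (_ + _).
    by apply: eq_Rintegral => w /[!inE] wA; rewrite ger0_norm.
  apply: eq_Rintegral => w /[!inE] wA; rewrite ltr0_norm// ltNge.
  by apply/negP.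
have := WK Q A SQ fA.
have : `|W| <= `|i g - W| + `|i g|.
  by rewrite distrC -{1}(subrK (i g) W) ler_normD.
move: hA hC; rewrite !ler_norml => /andP[_ hA] /andP[hC _].
lra.
Qed.

(** The positive part of an approximation [g] of [Y - X] is the required nonnegative function. Its
    distance to [g] is nearly an expectation of the negative part, which lives on the B_s-event
    [g < 0], where the hypothesis makes it small. *)
Lemma L1_le_upto s X Y : 0 <= s -> L1_upto i s (Y - X) ->
  (forall Q A, Se Q -> filtration Om s A -> E Q A X <= E Q A Y) ->
  L1_le i X Y.
Proof.
move=> s0 sXY EXY; apply/closure_normP => e e0.
have e4 : 0 < e / 4 by lra.
have [g gC gW] := L1_upto_approx sXY e4; have gCb := Cb_upto_Cb s0 gC.
have pCb := Cb_positive gCb; have nCb := CbB pCb gCb.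
have [Q SQ gQ] := norm_lt C_convex L1_C P_risk Se0 nCb e4.
exists (i (fun w => Num.max (g w) 0)).
  by exists (fun w => Num.max (g w) 0) => //; split=> // w; rewrite le_max lexx orbT.
pose A : set (Borel Om) := [set w | g w < 0].
have fA : filtration Om s A.
  have ag := Cb_upto_adapted obs s0 gC.
  exact: (@sub_ltr _ (Borel Om) R _ (sF s) g (cst 0) ag (@a0 s 0)).
have mA := mF s0 fA; have gi := Cb_integrable Q gCb.
have hA := evaluation_approx L1_C (Y - X) (SeC SQ) mA gCb.
have gE : \int[Q]_w `|Num.max (g w) 0 - g w| = - \int[Q]_(w in A) g w.
  rewrite (Rintegral_setC mA); last exact/Rintegrable_normr/(Cb_integrable Q nCb).
  rewrite -RintegralN// [X in _ + X](_ : _ = 0) ?addr0.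
    apply: eq_Rintegral => w /[!inE] wA; rewrite max_r; last exact: ltW.
    by rewrite sub0r normrN ltr0_norm.
  rewrite (@eq_Rintegral _ _ _ _ _ (cst 0)).
    by rewrite Rintegral_cst ?mul0r//; exact: measurableC.
  move=> w /[!inE] /negP; rewrite -leNgt => g0.
  by rewrite max_l// subrr normr0.
have CQ := SeC SQ.
have := EXY Q A SQ fA; rewrite -subr_ge0 -(evaluationB L1_C)// => EA.
have : `|i (fun w => Num.max (g w) 0) - (Y - X)| <=
    `|i (fun w => Num.max (g w) 0) - i g| + `|i g - (Y - X)|.
  by rewrite -(subrKA (i g)) ler_normD.
rewrite -(i_sub L1_C)//.
move: hA; rewrite ler_norml => /andP[hA _].
lra.
Qed.

(** Bounding the two terms separately would give twice the norm; taken together under one model they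
    amount to integrating [X] against a sign. *)
Lemma evaluation_setC_le Q A X : C Q -> measurable A ->
  E Q A X - E Q (~` A) X <= `|X|.
Proof.
move=> CQ mA; apply/ler_addgt0Pr => e e0; have e4 : 0 < e / 4 by lra.
have [f fC fX] := i_dense L1_C X e4; have fi := Cb_integrable Q fC.
have mCA := measurableC mA.
have hA := evaluation_approx L1_C X CQ mA fC.
have hC := evaluation_approx L1_C X CQ mCA fC.
have fE : \int[Q]_(w in A) f w - \int[Q]_(w in ~` A) f w <= `|i f|.
  apply: le_trans (norm_ge L1_C CQ fC).
  rewrite (Rintegral_setC mA (Rintegrable_normr fi)) -RintegralN//.
  apply: lerD; apply: le_Rintegral => //.
  - exact: integrable_sub.
  - exact/integrable_sub/Rintegrable_normr.
  - by move=> w _; exact: ler_norm.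
  - exact/integrable_sub/RintegrableN.
  - exact/integrable_sub/Rintegrable_normr.
  - by move=> w _; rewrite -normrN ler_norm.
have : `|i f| <= `|i f - X| + `|X| by rewrite -{1}(subrK X (i f)) ler_normD.
move: hA hC; rewrite !ler_norml => /andP[hA _] /andP[_ hC].
lra.
Qed.

(* Y = ess sup_Q E_Q(-X | B_s), expressed without conditional expectations:
   E_Q(Y 1_A) is the supremum of E_Q'(-X 1_A) over the models Q' that agree
   with Q up to time s. *)
Definition time_value s X Y := L1_upto i s Y /\
  forall Q A, Se Q -> filtration Om s A ->
    (forall Q', Se Q' -> eq_until s Q Q' -> E Q' A (- X) <= E Q A Y) /\
    (forall e, 0 < e -> exists2 Q', Se Q' /\ eq_until s Q Q' &
       E Q A Y <= E Q' A (- X) + e).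

Lemma time_value_contraction s X X' Y Y' : 0 <= s ->
  time_value s X Y -> time_value s X' Y' -> `|Y - Y'| <= `|X - X'|.
Proof.
move=> s0 [sY vY] [sY' vY']; apply: (norm_le_upto s0); first exact: L1_uptoB.
move=> Q A SQ fA; have fCA : filtration Om s (~` A) by exact: sub_setC (sF s) _ fA.
have mA := mF s0 fA; have mCA := measurableC mA.
apply/ler_addgt0Pr => e e0; have e2 : 0 < e / 2 by lra.
(* [Q1] is nearly optimal for [X] on [A], [Q2] for [X'] on the complement. Pasting them puts both
   differences under one model, where [evaluation_setC_le] gives the constant 1. *)
have [_ /(_ _ e2)[Q1 [S1 QQ1] Y1]] := vY Q A SQ fA.
have [/(_ _ S1 QQ1) Y1' _] := vY' Q A SQ fA.
have [_ /(_ _ e2)[Q2 [S2 QQ2] Y2]] := vY' Q (~` A) SQ fCA.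
have [/(_ _ S2 QQ2) Y2' _] := vY Q (~` A) SQ fCA.
have Q12 : eq_until s Q1 Q2 by move=> B fB; rewrite -QQ1// QQ2.
have [Q' [S' Q2' Q'A Q'C]] := pasting_eq_until obs C_stable s0 fA S1 S2 Q12.
have CQ := SeC SQ; have CQ1 := SeC S1; have CQ2 := SeC S2.
have := evaluation_setC_le (X' - X) (SeC S') mA.
rewrite (eq_evaluation i _ Q'A) (eq_evaluation i _ Q'C) distrC.
move: Y1 Y1' Y2 Y2'.
rewrite !(evaluationN L1_C) ?(evaluationB L1_C)//.
lra.
Qed.

Lemma time_value_unique s X Y Y' : 0 <= s ->
  time_value s X Y -> time_value s X Y' -> Y = Y'.
Proof.
move=> s0 vY vY'; apply/eqP; rewrite -subr_eq0 -normr_le0 -(normr0 L) -(subrr X).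
exact: time_value_contraction vY vY'.
Qed.

(** Evaluations are 1-Lipschitz uniformly in the model, so both halves of [time_value] pass to the
    limit. *)
Lemma time_value_limit s X Y (u v : nat -> L) : 0 <= s ->
  (forall n, time_value s (u n) (v n)) ->
  u n @[n --> \oo] --> X -> v n @[n --> \oo] --> Y -> time_value s X Y.
Proof.
move=> s0 uv uX vY.
have close e : 0 < e -> exists n, `|u n - X| < e /\ `|v n - Y| < e.
  move=> e0; have : \forall n \near \oo, `|X - u n| < e /\ `|Y - v n| < e.
    move/cvgrPdist_lt : uX => /(_ e e0); move/cvgrPdist_lt : vY => /(_ e e0).
    by apply: filterS2 => n.
  by move=> [n _ /(_ n (leqnn n))]; exists n; rewrite distrC (distrC (v n)).
split.
  apply: L1_upto_closed => e /close[n [_ vn]]; exists (v n) => //.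
  by have [] := uv n.
move=> Q A SQ fA; have mA := mF s0 fA.
have nX Q' Z Z' : C Q' -> `|E Q' A Z - E Q' A Z'| <= `|Z - Z'|.
  by move=> CQ'; rewrite -(evaluationB L1_C)//; exact: (evaluation_norm L1_C).
split=> [Q' SQ' QQ'|e e0].
  apply/ler_addgt0Pr => e e0; have [|n [un vn]] := close (e / 2); first by lra.
  have [_ /(_ Q A SQ fA)[/(_ Q' SQ' QQ') h _]] := uv n.
  have CQ := SeC SQ; have CQ' := SeC SQ'.
  have := nX Q' (u n) X (SeC SQ'); have := nX Q (v n) Y (SeC SQ).
  rewrite !ler_norml; move: h; rewrite !(evaluationN L1_C)//.
  by move=> h /andP[_ h1] /andP[h2 h3]; lra.
have [|n [un vn]] := close (e / 4); first by lra.
have e2 : 0 < e / 2 by lra.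
have [_ /(_ Q A SQ fA)[_ /(_ _ e2)[Q' [SQ' QQ'] h]]] := uv n.
exists Q' => //; have CQ := SeC SQ; have CQ' := SeC SQ'.
have := nX Q' (u n) X (SeC SQ'); have := nX Q (v n) Y (SeC SQ).
rewrite !ler_norml; move: h; rewrite !(evaluationN L1_C)//.
by move=> h /andP[h1 _] /andP[h2 h3]; lra.
Qed.

End time_values.

(** * Multiplication by bounded continuous functions *)

Section multiplication.
Context {R : realType} (Om : path_space R) (obs : observation Om).
Local Notation prob := (probability (Borel Om) R).
Context (C : set prob) (P : prob) (C_convex : convex_probs C).
Context (L : completeNormedModType R) (i : (Om -> R) -> L).
Hypothesis L1_C : is_completion (capacity (risk C)) i.
Hypothesis P_risk : forall X, Cb R Om X -> risk C X = risk (dominated C P) X.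
Local Notation Se := (equivalent_models C P).
Hypothesis Se0 : Se !=set0.
Implicit Types (f g : Om -> R) (X Y W : L) (M : R).

Let norm_mul f g M : Cb R Om f -> (forall w, `|f w| <= M) -> Cb R Om g ->
  `|i (fun w => f w * g w)| <= M * `|i g|.
Proof.
move=> fC fM gC; apply/ler_addgt0Pr => e e0.
have [Q [CQ _ _]] := norm_lt C_convex L1_C P_risk Se0 (CbM fC gC) e0.
have M0 : 0 <= M by exact: le_trans (fM point).
have : \int[Q]_w `|f w * g w| <= M * \int[Q]_w `|g w|.
  have gi := Rintegrable_normr (Cb_integrable Q gC).
  rewrite -RintegralZl//; apply: le_Rintegral => //.
  - exact: Rintegrable_normr (Cb_integrable Q (CbM fC gC)).
  - exact: RintegrableZ.
  - by move=> w _; rewrite normrM ler_wpM2r.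
have : M * \int[Q]_w `|g w| <= M * `|i g| by rewrite ler_wpM2l// (norm_ge L1_C).
lra.
Qed.

Let mul_sub f g h : Cb R Om f -> Cb R Om g -> Cb R Om h ->
  i (fun w => f w * g w) - i (fun w => f w * h w) =
  i (fun w => f w * (g w - h w)).
Proof.
move=> fC gC hC; rewrite -(i_sub L1_C); [|exact: CbM|exact: CbM].
by congr i; apply/funext => w; rewrite mulrBr.
Qed.

(** Multiplication by [f] is [M]-Lipschitz on [Cb], so a sequence as in the definition of [L1_mul]
    exists. The estimate pins down the chosen limit and is the only access to it afterwards. *)
Lemma L1_mul_approx f g M X : Cb R Om f -> (forall w, `|f w| <= M) ->
  Cb R Om g -> `|i (fun w => f w * g w) - L1_mul i f X| <= M * `|i g - X|.
Proof.
move=> fC fM gC; have M0 : 0 <= M by exact: le_trans (fM point).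
have [h [hC _ [hX hf]]] : exists h : nat -> Om -> R,
    [/\ forall n, Cb R Om (h n), True & i (h n) @[n --> \oo] --> X /\
      i (fun w => f w * h n w) @[n --> \oo] --> L1_mul i f X].
  suff : exists Y, exists2 h : nat -> Om -> R, (forall n, Cb R Om (h n)) &
      i (h n) @[n --> \oo] --> X /\ i (fun w => f w * h n w) @[n --> \oo] --> Y.
    by move=> /getPex[h hC hX]; exists h.
  have /choice[h hP] (n : nat) : exists h, Cb R Om h /\ `|i h - X| < n.+1%:R^-1.
    have n0 : 0 < n.+1%:R^-1 :> R by rewrite invr_gt0 ltr0n.
    by have [h hC hX] := i_dense L1_C X n0; exists h.
  have hC n : Cb R Om (h n) by have [] := hP n.
  have hhC n m : Cb R Om (fun w => h n w - h m w) by exact: CbB.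
  have [n m|Y hY] := @cvg_of_dist _ _ (fun n => i (fun w => f w * h n w)) M M0.
    rewrite mul_sub//; apply: le_trans (norm_mul fC fM (hhC n m)) _.
    rewrite ler_wpM2l// (i_sub L1_C)// -(subrKA X) (le_trans (ler_normD _ _))//.
    by rewrite lerD ?(distrC X)// ltW//; [have [] := hP n|have [] := hP m].
  exists Y, h => //; split=> //; apply/cvgrPdist_lt => e e0; near=> n.
  rewrite distrC; have [_ /lt_le_trans] := hP n; apply.
  by near: n; have /cvgrPdist_lt/(_ e e0) := @cvg_harmonic R;
    apply: filterS => n; rewrite sub0r normrN ger0_norm ?invr_ge0// => /ltW.
have c1 : `|i (fun w => f w * g w) - i (fun w => f w * h n w)| @[n --> \oo] -->
    `|i (fun w => f w * g w) - L1_mul i f X|.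
  by apply: cvg_norm; apply: cvgB => //; exact: cvg_cst.
have c2 : M * `|i g - i (h n)| @[n --> \oo] --> M * `|i g - X|.
  by apply: cvgMr; apply: cvg_norm; apply: cvgB => //; exact: cvg_cst.
apply: ler_cvg_to c1 c2 _; apply: nearW => n.
rewrite mul_sub//; apply: le_trans (norm_mul fC fM (CbB gC (hC n))) _.
by rewrite (i_sub L1_C).
Unshelve. all: by end_near. Qed.

Lemma L1_mulD f X Y : Cb R Om f ->
  L1_mul i f (X + Y) = L1_mul i f X + L1_mul i f Y.
Proof.
move=> fC; have [_ [M fM]] := (CbP f).1 fC.
have M0 : 0 <= M by exact: le_trans (fM point).
apply/eqP; rewrite -subr_eq0 -normr_le0; apply/ler_addgt0Pr => e e0.
have eM : 0 < e / (4 * (M + 1)) by rewrite divr_gt0//; lra.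
have [g gC gX] := i_dense L1_C X eM; have [h hC hY] := i_dense L1_C Y eM.
have ghC := CbD gC hC.
have igh : i (fun w => g w + h w) = i g + i h.
  rewrite -[i g]scale1r -(i_lin L1_C)//; congr i.
  by apply/funext => w; rewrite mul1r.
have ifgh : i (fun w => f w * (g w + h w)) =
    i (fun w => f w * g w) + i (fun w => f w * h w).
  rewrite -[i (fun w => f w * g w)]scale1r -(i_lin L1_C); [|exact: CbM|exact: CbM].
  by congr i; apply/funext => w; rewrite mul1r mulrDr.
have H := L1_mul_approx (X + Y) fC fM ghC.
have HX := L1_mul_approx X fC fM gC; have HY := L1_mul_approx Y fC fM hC.
rewrite ifgh igh opprD addrACA in H.
have {}H := le_trans H (ler_wpM2l M0 (ler_normD _ _)).
have -> : L1_mul i f (X + Y) - (L1_mul i f X + L1_mul i f Y) =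
    - (i (fun w => f w * g w) + i (fun w => f w * h w) - L1_mul i f (X + Y)) +
    ((i (fun w => f w * g w) - L1_mul i f X) +
     (i (fun w => f w * h w) - L1_mul i f Y)).
  by rewrite [in RHS](addrACA _ (- L1_mul i f X)) -opprD opprB subrKA.
rewrite add0r (le_trans (ler_normD _ _))// normrN.
have := ler_normD (i (fun w => f w * g w) - L1_mul i f X)
  (i (fun w => f w * h w) - L1_mul i f Y).
have MX : M * `|i g - X| <= M * (e / (4 * (M + 1))) by rewrite ler_wpM2l// ltW.
have MY : M * `|i h - Y| <= M * (e / (4 * (M + 1))) by rewrite ler_wpM2l// ltW.
have : M * (e / (4 * (M + 1))) <= e / 4.
  have -> : M * (e / (4 * (M + 1))) = M / (M + 1) * (e / 4).
    by field; rewrite gt_eqF//; lra.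
  rewrite ler_piMl ?ler_pdivrMr; lra.
lra.
Qed.

Lemma L1_mul_upto s f X : 0 <= s -> Cb_upto Om s f -> L1_upto i s X ->
  L1_upto i s (L1_mul i f X).
Proof.
move=> s0 fC sX; have fCb := Cb_upto_Cb obs s0 fC.
have [_ [M fM]] := (CbP f).1 fCb.
have M0 : 0 <= M by exact: le_trans (fM point).
apply/closure_normP => e e0.
have eM : 0 < e / (M + 1) by rewrite divr_gt0//; lra.
have [g gC gX] := L1_upto_approx sX eM.
exists (i (fun w => f w * g w)).
  by exists (fun w => f w * g w) => //; exact: Cb_upto_mul.
apply: le_lt_trans (L1_mul_approx X fCb fM (Cb_upto_Cb obs s0 gC)) _.
have M1 : 0 < M + 1 by lra.
move: gX; rewrite ltr_pdivlMr//.
by have := normr_ge0 (i g - X); lra.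
Qed.

Lemma L1_mul_evaluation_ge0 s Q f W : 0 <= s -> Se Q -> Cb_upto Om s f ->
  (forall w, 0 <= f w) ->
  (forall B, filtration Om s B -> 0 <= evaluation i Q B W) ->
  forall A, filtration Om s A -> 0 <= evaluation i Q A (L1_mul i f W).
Proof.
move=> s0 [CQ _ _] fC f0 W0 A fA; have fCb := Cb_upto_Cb obs s0 fC.
have [_ [M fM]] := (CbP f).1 fCb.
have M0 : 0 <= M by exact: le_trans (fM point).
apply/ler_addgt0Pr => e e0.
(* One error of [M] times the distance comes from replacing the product by [f * g], another from the
   tolerance in [layer_cake_ge]; the added 1 covers [M = 0]. *)
have eM : 0 < e / (2 * M + 1) by rewrite divr_gt0//; lra.
have [g gC gW] := i_dense L1_C W eM.
have mF := filtration_measurable obs s0.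
have sF : @sigma_algebra (Borel Om) setT (filtration Om s).
  exact: filtration_sigma_algebra.
have h := evaluation_approx L1_C (L1_mul i f W) CQ (mF A fA) (CbM fCb gC).
have hg B : filtration Om s B -> - `|i g - W| <= \int[Q]_(w in B) g w.
  move=> fB; have := evaluation_approx L1_C W CQ (mF B fB) gC.
  by rewrite ler_norml => /andP[+ _]; have := W0 B fB; lra.
have af := Cb_upto_adapted obs s0 fC.
have fM' w : 0 <= f w <= M by rewrite f0 -(ger0_norm (f0 w)) fM.
have := @layer_cake_ge _ (Borel Om) R _ sF mF Q g _
  (Cb_integrable Q gC) hg A M f fA af fM'.
have hm := L1_mul_approx W fCb fM gC.
move: h; rewrite ler_norml => /andP[_ h].
have M1 : 0 < 2 * M + 1 by lra.
move: gW; rewrite ltr_pdivlMr//.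
by have := normr_ge0 (i g - W); lra.
Qed.

End multiplication.

(** * The conditional risk measures and their properties *)

Section conditional_risk.
Context {R : realType} (Om : path_space R) (obs : observation Om).
Local Notation prob := (probability (Borel Om) R).
Context (C : set prob) (P : prob) (C_convex : convex_probs C).
Hypothesis C_stable : stable C.
Context (L : completeNormedModType R) (i : (Om -> R) -> L).
Hypothesis L1_C : is_completion (capacity (risk C)) i.
Hypothesis P_risk : forall X, Cb R Om X -> risk C X = risk (dominated C P) X.
Local Notation Se := (equivalent_models C P).
Hypothesis Se0 : Se !=set0.
Local Notation E := (evaluation i).
Implicit Types (Q : prob) (s t : R) (A B : set (Borel Om)) (f g : Om -> R)
  (X Y W : L).

Definition cond_exps s (f : Om -> R) : set (Borel Om -> R) :=
  [set z | exists2 Q : prob, [/\ dominated C P Q, Q `<< P & P `<< Q] &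
    is_cond_exp Q (filtration Om s) (fun w => (- f w)%:E) z].

Let SeC Q : Se Q -> C Q. Proof. by case. Qed.
Let sF t : @sigma_algebra (Borel Om) setT (filtration Om t) :=
  @filtration_sigma_algebra _ Om t.
Let mF t (t0 : 0 <= t) := filtration_measurable obs t0.

Let ae_null Q Q' (y z : Borel Om -> R) : Q `<< Q' ->
  {ae Q', forall w, z w <= y w} -> {ae Q, forall w, z w <= y w}.
Proof.
move=> QQ' [N [mN N0 zN]]; exists N; split=> //.
exact: null_dominates0 QQ' mN N0.
Qed.

Let le_Rintegral_ae Q A (y z : Borel Om -> R) : measurable A ->
  Q.-integrable setT (EFin \o y) -> Q.-integrable setT (EFin \o z) ->
  {ae Q, forall w, z w <= y w} ->
  \int[Q]_(w in A) z w <= \int[Q]_(w in A) y w.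
Proof.
move=> mA yi zi zy; rewrite -subr_ge0 -RintegralB//; [|exact: integrable_sub..].
apply: Rintegral_ge0_ae => //.
  by apply/measurable_EFinP; exact: measurable_int (RintegrableB yi zi).
by apply: ae_imply zy => w; rewrite subr_ge0.
Qed.

(** As a function of [A], the candidate for the integral over [A] of the essential supremum under
    [Q]. *)
Definition sup_until s Q (x : Om -> R) (A : set (Borel Om)) : R :=
  sup [set \int[Q']_(w in A) x w | Q' in [set Q' | Se Q' /\ eq_until s Q Q']].

Section sup_until.
Context (s : R) (Q : prob) (x : Om -> R) (s0 : 0 <= s) (SQ : Se Q)
  (xC : Cb R Om x).
Local Notation phi := (sup_until s Q x).
Local Notation S := (fun A : set (Borel Om) =>
  [set \int[Q']_(w in A) x w | Q' in [set Q' | Se Q' /\ eq_until s Q Q']]).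

Let S_bound A (M : R) : (forall w, `|x w| <= M) -> filtration Om s A ->
  forall r, S A r -> `|r| <= M * fine (Q A).
Proof.
move=> xM fA _ [Q' [SQ' QQ'] <-]; rewrite (QQ' _ fA).
apply: (@Rintegral_bound _ (Borel Om) R) => //; first exact: mF fA.
exact: Cb_measurable.
Qed.

Let S_sup A : filtration Om s A -> has_sup (S A).
Proof.
move=> fA; have [_ [M xM]] := (CbP x).1 xC; split.
  by exists (\int[Q]_(w in A) x w), Q.
exists (M * fine (Q A)) => r Sr; exact: le_trans (ler_norm r) (S_bound xM fA Sr).
Qed.

Lemma sup_until_ge A Q' : filtration Om s A -> Se Q' -> eq_until s Q Q' ->
  \int[Q']_(w in A) x w <= phi A.
Proof.
by move=> fA SQ' QQ'; apply: ub_le_sup; [case: (S_sup fA)|exists Q'].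
Qed.

Lemma sup_until_adherent A e : filtration Om s A -> 0 < e ->
  exists2 Q', Se Q' /\ eq_until s Q Q' & phi A - e < \int[Q']_(w in A) x w.
Proof.
by move=> fA e0; have [_ [Q' Q'P <-] h] := sup_adherent e0 (S_sup fA); exists Q'.
Qed.

Lemma sup_until_bound A (M : R) : (forall w, `|x w| <= M) ->
  filtration Om s A -> `|phi A| <= M * fine (Q A).
Proof.
move=> xM fA; rewrite ler_norml; apply/andP; split.
  have := S_bound xM fA (ex_intro2 _ _ Q (conj SQ (fun _ _ => erefl)) erefl).
  rewrite ler_norml => /andP[/le_trans + _]; apply.
  exact: sup_until_ge.
apply: ge_sup; first by case: (S_sup fA).
by move=> r Sr; exact: le_trans (ler_norm r) (S_bound xM fA Sr).
Qed.

(* Near-optimal models for the disjoint events A and B are pasted along A. *)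
Lemma sup_until_additive A B : filtration Om s A -> filtration Om s B ->
  A `&` B = set0 -> phi (A `|` B) = phi A + phi B.
Proof.
move=> fA fB AB0; have fAB : filtration Om s (A `|` B) by exact: (sub_setU (sF s)).
have mA := mF s0 fA; have mB := mF s0 fB; have mAB := mF s0 fAB.
have intU Q' : \int[Q']_(w in A `|` B) x w =
    \int[Q']_(w in A) x w + \int[Q']_(w in B) x w.
  apply: Rintegral_setU => //; last by rewrite disj_set2E; apply/eqP.
  by apply: integrable_sub => //; exact: Cb_integrable.
apply/eqP; rewrite eq_le; apply/andP; split.
  apply: ge_sup; first by case: (S_sup fAB).
  by move=> _ [Q' [SQ' QQ'] <-]; rewrite intU lerD// sup_until_ge.
apply/ler_addgt0Pr => e e0; have e2 : 0 < e / 2 by lra.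
have [Q1 [S1 QQ1] h1] := sup_until_adherent fA e2.
have [Q2 [S2 QQ2] h2] := sup_until_adherent fB e2.
have Q12 : eq_until s Q1 Q2 by move=> D fD; rewrite -QQ1// QQ2.
have [Q' [S' Q2' Q'A Q'C]] := pasting_eq_until obs C_stable s0 fA S1 S2 Q12.
have QQ' : eq_until s Q Q' by move=> D fD; rewrite QQ2// Q2'.
have := sup_until_ge fAB S' QQ'; rewrite intU.
have -> : \int[Q']_(w in A) x w = \int[Q1]_(w in A) x w.
  by congr fine; exact: eq_measure_integral.
have -> : \int[Q']_(w in B) x w = \int[Q2]_(w in B) x w.
  congr fine; apply: eq_measure_integral => D mD DB; apply: Q'C => // w Dw Aw.
  have : (A `&` B) w by split => //; exact: DB.
  by rewrite AB0.
lra.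
Qed.

End sup_until.

(** Upper bounds: [Y] is evaluated equally under Q and Q', and under Q' the conditional expectation
    of -f lies below [y]. Near-optimality: the density [y'] of [sup_until] dominates the whole
    family by [cond_exp_pasted_le], so [y <= y'] by minimality, and the supremum is approached by
    definition. *)
Lemma time_value_i s f Y y : 0 <= s -> Cb R Om f -> L1_upto i s Y ->
  L1_class i P Y y -> is_ess_sup P (cond_exps s f) y -> time_value C P i s (i f) Y.
Proof.
move=> s0 fC sY Yy [my y_ub y_min]; split=> // Q A SQ fA; have mA := mF s0 fA.
have xC := CbN fC; have [_ [M xM]] := (CbP _).1 xC.
have mx := Cb_measurable xC.
have Eif Q' : Se Q' -> E Q' A (- i f) = \int[Q']_(w in A) (- f w).
  move=> SQ'; have CQ' := SeC SQ'.
  rewrite (evaluationN L1_C)// (evaluation_i L1_C)// RintegralN//.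
  exact: Cb_integrable.
split=> [Q' SQ' QQ'|e e0].
  rewrite (evaluation_eq_until obs L1_C s0 SQ SQ' QQ' fA sY) Eif//.
  have [yi ->//] := class_evaluation L1_C SQ' Yy.
  have [z zE] := @cond_exp_exists _ _ obs s Q' (fun w => - f w) M s0 mx xM.
  have [_ zi Iz] := zE.
  have -> : \int[Q']_(w in A) (- f w) = \int[Q']_(w in A) z w.
    by congr fine; rewrite Iz.
  apply: le_Rintegral_ae => //; have [CQ' Q'P PQ'] := SQ'.
  by apply: (ae_null Q'P); apply: y_ub; exists Q'.
have [y' [ay' yi' Iy']] := additive_bounded_density (sF s) (mF s0)
  (fun A B => @sup_until_additive s Q _ s0 SQ xC A B)
  (fun A => @sup_until_bound s Q _ s0 SQ xC A M xM).
have my' : measurable_fun setT (y' : Borel Om -> R).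
  by apply: adapted_measurable ay'; exact: mF.
have yy' : {ae P, forall w, y w <= y' w}.
  apply: y_min => // z [Q1 [[CQ1 _] Q1P PQ1] zE].
  have SQ1 : Se Q1 by split.
  have mz : measurable_fun setT (z : Borel Om -> R).
    by case: zE => az _ _; apply: (@adapted_measurable _ (Borel Om) R _ (mF s0)).
  exists [set w | y' w < z w]; split.
  - exact: measurable_ltr_set.
  - have [_ _ PQ] := SQ; apply: (null_dominates0 PQ).
      exact: measurable_ltr_set.
    apply: (cond_exp_pasted_le obs C_stable s0 SQ1 SQ mx xM zE ay' yi').
    move=> Q' B SQ' QQ' fB; rewrite Iy'//.
    exact: sup_until_ge.
  - by move=> w /= /negP; rewrite -ltNge.
have [Q' Q'P h] := sup_until_adherent s0 SQ xC fA e0; exists Q' => //.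
rewrite Eif; last by case: Q'P.
have [yi ->//] := class_evaluation L1_C SQ Yy.
apply: (@le_trans _ _ (\int[Q]_(w in A) y' w)).
  by apply: le_Rintegral_ae => //; case: SQ => _ QP _; exact: ae_null QP yy'.
by rewrite Iy'// -lerBlDr ltW.
Qed.

Section operators.
Variables (D : R -> set (Om -> R)) (rho_ : R -> (Om -> R) -> L).
Hypothesis D_Cb : forall s, 0 <= s -> D s `<=` Cb R Om.
Hypothesis D_dense : forall s, 0 <= s -> forall f, Cb R Om f ->
  forall e : R, 0 < e ->
  exists2 g, D s g & capacity (risk C) (fun w => f w - g w) < e.
Hypothesis rho_D : forall s, 0 <= s -> forall f, D s f ->
  time_value C P i s (i f) (rho_ s f).

Lemma time_value_exists s X : 0 <= s -> exists Y, time_value C P i s X Y.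
Proof.
move=> s0.
have /choice[g gP] (n : nat) : exists g, D s g /\ `|i g - X| < n.+1%:R^-1.
  (* Half of the error reaches a function of [Cb], the other half an element of [D s]. *)
  have n0 : 0 < n.+1%:R^-1 / 2 :> R by rewrite divr_gt0// invr_gt0 ltr0n.
  have [f fC fX] := i_dense L1_C X n0.
  have [g Dg fg] := D_dense s0 fC n0; exists g; split=> //.
  have gC := D_Cb s0 Dg; have [_ iC _] := L1_C.
  rewrite -iC in fg; last exact: CbB.
  rewrite (i_sub L1_C)// distrC in fg.
  by rewrite -(subrKA (i f)) (le_lt_trans (ler_normD _ _))// [ltRHS]splitr ltrD.
have gV n := rho_D s0 (gP n).1.
have [n m|Y hY] := @cvg_of_dist _ L (fun n => rho_ s (g n)) 1 ler01.
  rewrite mul1r.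
  apply: le_trans (time_value_contraction obs C_convex C_stable L1_C P_risk Se0
    s0 (gV n) (gV m)) _.
  rewrite -(subrKA X) (le_trans (ler_normD _ _))//.
  by rewrite lerD ?(distrC X)// ltW//; [have [] := gP n|have [] := gP m].
exists Y; apply: (time_value_limit obs L1_C s0 gV _ hY).
apply/cvgrPdist_lt => e e0; near=> n.
rewrite distrC; have [_ /lt_le_trans] := gP n; apply.
by near: n; have /cvgrPdist_lt/(_ e e0) := @cvg_harmonic R;
  apply: filterS => n; rewrite sub0r normrN ger0_norm ?invr_ge0// => /ltW.
Unshelve. all: by end_near. Qed.

(** By [time_value_unique] the choice is forced, so the value depends on no approximating sequence
    and an identity is proved by exhibiting a [time_value]. *)
Definition conditional_risk s X : L := get [set Y | time_value C P i s X Y].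
Local Notation rhos := conditional_risk.

Let rhosP s X : 0 <= s -> time_value C P i s X (rhos s X).
Proof. by move=> s0; have /getPex := time_value_exists X s0. Qed.

Let rhosE s X Y : 0 <= s -> time_value C P i s X Y -> rhos s X = Y.
Proof.
move=> s0 XY.
exact: (time_value_unique obs C_convex C_stable L1_C P_risk Se0 s0 (rhosP X s0) XY).
Qed.

Lemma conditional_risk_D s f : 0 <= s -> D s f -> rhos s (i f) = rho_ s f.
Proof. by move=> s0 Df; apply: rhosE => //; exact: rho_D. Qed.

Lemma conditional_risk_upto s X : 0 <= s -> L1_upto i s (rhos s X).
Proof. by move=> s0; have [] := rhosP X s0. Qed.

(** [rhos s X] is the least element of L^1_s whose evaluations dominate those of [- X] under all
    models equal up to s. *)
Let le_rhos s X Y : 0 <= s -> L1_upto i s Y ->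
  (forall Q Q' A, Se Q -> Se Q' -> eq_until s Q Q' -> filtration Om s A ->
     E Q' A (- X) <= E Q A Y) -> L1_le i (rhos s X) Y.
Proof.
move=> s0 sY XY; apply: (L1_le_upto obs C_convex L1_C P_risk Se0 s0).
  by apply: (L1_uptoB obs L1_C) => //; exact: conditional_risk_upto.
move=> Q A SQ fA; apply/ler_addgt0Pr => e e0.
have [_ /(_ Q A SQ fA)[_ /(_ e e0)[Q' [SQ' QQ'] h]]] := rhosP X s0.
by have := XY Q Q' A SQ SQ' QQ' fA; lra.
Qed.

Let rhos_ge s X Q Q' A : 0 <= s -> Se Q -> Se Q' -> eq_until s Q Q' ->
  filtration Om s A -> E Q' A (- X) <= E Q A (rhos s X).
Proof.
by move=> s0 SQ SQ' QQ' fA; have [_ /(_ Q A SQ fA)[+ _]] := rhosP X s0; exact.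
Qed.

Lemma conditional_risk_monotone s X Y : 0 <= s -> L1_le i X Y ->
  L1_le i (rhos s Y) (rhos s X).
Proof.
move=> s0 XY; apply: le_rhos => // [|Q Q' A SQ SQ' QQ' fA].
  exact: conditional_risk_upto.
apply: le_trans (rhos_ge X s0 SQ SQ' QQ' fA).
have CQ' := SeC SQ'; have mA := mF s0 fA.
rewrite !(evaluationN L1_C)// lerN2 -subr_ge0 -(evaluationB L1_C)//.
by apply: (evaluation_ge0 L1_C) => //; rewrite /L1_le subr0.
Qed.

(** [Y] has the same evaluations under models that agree up to s, so it comes out of the
    supremum. *)
Lemma conditional_risk_translation s X Y : 0 <= s -> L1_upto i s Y ->
  rhos s (X + Y) = rhos s X - Y.
Proof.
move=> s0 sY; apply: rhosE => //; split.
  by apply: (L1_uptoB obs L1_C) => //; exact: conditional_risk_upto.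
move=> Q A SQ fA; have CQ := SeC SQ; have mA := mF s0 fA.
have EY Q' (SQ' : Se Q') QQ' := evaluation_eq_until obs L1_C s0 SQ SQ' QQ' fA sY.
have [_ /(_ Q A SQ fA)[h1 h2]] := rhosP X s0.
rewrite (evaluationB L1_C)//; split=> [Q' SQ' QQ'|e /h2[Q' [SQ' QQ'] h]].
  have CQ' := SeC SQ'; have := h1 Q' SQ' QQ'.
  by rewrite opprD (evaluationB L1_C)// (EY Q' SQ' QQ') lerD2r.
exists Q' => //; have CQ' := SeC SQ'.
by rewrite opprD (evaluationB L1_C)// (EY Q' SQ' QQ'); lra.
Qed.

Lemma conditional_risk_subadditive s X Y : 0 <= s ->
  L1_le i (rhos s (X + Y)) (rhos s X + rhos s Y).
Proof.
move=> s0; apply: le_rhos => // [|Q Q' A SQ SQ' QQ' fA].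
  by apply: (L1_uptoD obs L1_C) => //; exact: conditional_risk_upto.
have CQ := SeC SQ; have CQ' := SeC SQ'; have mA := mF s0 fA.
by rewrite opprD !(evaluationD L1_C)// lerD// rhos_ge.
Qed.

Lemma conditional_risk_homogeneous s (a : R) X : 0 <= s -> 0 <= a ->
  rhos s (a *: X) = a *: rhos s X.
Proof.
move=> s0 a0; apply: rhosE => //; split.
  by apply: (L1_uptoZ obs L1_C) => //; exact: conditional_risk_upto.
move=> Q A SQ fA; have CQ := SeC SQ; have mA := mF s0 fA.
have [_ /(_ Q A SQ fA)[h1 h2]] := rhosP X s0.
rewrite (evaluationZ L1_C)//; split=> [Q' SQ' QQ'|e e0].
  by have CQ' := SeC SQ'; rewrite -scalerN (evaluationZ L1_C)// ler_wpM2l// h1.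
(* The added 1 allows [a = 0]. *)
have ea : 0 < e / (a + 1) by rewrite divr_gt0// ltr_wpDl.
have [Q' [SQ' QQ'] h] := h2 _ ea; exists Q' => //; have CQ' := SeC SQ'.
rewrite -scalerN (evaluationZ L1_C)//.
apply: le_trans (ler_wpM2l a0 h) _; rewrite mulrDr lerD2l mulrCA ger_pMr//.
by rewrite ler_pdivrMr ?mul1r ?lerDl// ltr_wpDl.
Qed.

(** Nested suprema collapse: continuing a model by a near-optimal one after s keeps agreement up to
    r, and conversely a model near-optimal at time r is itself admissible at time s. *)
Lemma conditional_risk_consistent r s X : 0 <= r <= s ->
  rhos r X = rhos r (- rhos s X).
Proof.
move=> /andP[r0 rs]; have s0 : 0 <= s by exact: le_trans rs.
apply/esym; apply: rhosE => //; split; first exact: conditional_risk_upto.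
have fle := @filtration_le _ Om _ _ rs.
have eqW Q Q' : eq_until s Q Q' -> eq_until r Q Q'.
  by move=> QQ' B /fle; exact: QQ'.
move=> Q A SQ fA; have fsA := fle A fA; rewrite opprK.
have [_ /(_ Q A SQ fA)[h1 h2]] := rhosP X r0.
split=> [Q' SQ' QQ'|e e0].
  apply/ler_addgt0Pr => e e0.
  have [_ /(_ Q' A SQ' fsA)[_ /(_ e e0)[Q2 [SQ2 Q2Q'] h]]] := rhosP X s0.
  have QQ2 : eq_until r Q Q2 by move=> B fB; rewrite QQ'// (eqW _ _ Q2Q').
  by have := h1 Q2 SQ2 QQ2; lra.
have [Q' [SQ' QQ'] h] := h2 e e0; exists Q' => //.
by apply: le_trans h _; rewrite lerD2r; apply: rhos_ge.
Qed.

(** The claim reduces to nonnegative evaluations of [f] times [X + rhos s X]. On B_s-events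
    [X + rhos s X] has them by [rhos_ge], and [L1_mul_evaluation_ge0] transfers them to the
    product. *)
Lemma conditional_risk_local s f X : 0 <= s -> Cb_upto Om s f ->
  (forall w, 0 <= f w) ->
  L1_le i (rhos s (L1_mul i f X)) (L1_mul i f (rhos s X)).
Proof.
move=> s0 fC f0; have fCb := Cb_upto_Cb obs s0 fC.
have sX := @conditional_risk_upto s X s0.
have sfX := L1_mul_upto obs C_convex L1_C P_risk Se0 s0 fC sX.
apply: le_rhos => // Q Q' A SQ SQ' QQ' fA.
have CQ' := SeC SQ'; have mA := mF s0 fA.
rewrite (evaluation_eq_until obs L1_C s0 SQ SQ' QQ' fA sfX).
rewrite (evaluationN L1_C)// -subr_ge0 opprK -(evaluationD L1_C)//.
rewrite -(L1_mulD C_convex L1_C P_risk Se0)//.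
apply: (L1_mul_evaluation_ge0 obs C_convex L1_C P_risk Se0 s0 SQ' fC f0) => // B fB.
have mB := mF s0 fB.
rewrite (evaluationD L1_C)// -(opprK (E Q' B X)) -(evaluationN L1_C)// subr_ge0.
exact: rhos_ge.
Qed.

(** Triviality of B_0 makes all equivalent models agree on it, so the supremum at time 0 runs over
    all of them and is the risk. An event [A] of B_0 is either null, with nothing to prove, or of
    full measure. *)
Lemma conditional_risk_initial f :
  (forall A, filtration Om 0 A -> P A = 0%E \/ P A = 1%E) ->
  Cb R Om f -> rhos 0 (i f) = i (fun=> risk C f).
Proof.
move=> P01 fC; apply: rhosE => //.
have cC : Cb_upto Om 0 (fun=> risk C f).
  by exists (fun=> risk C f) => //; exact: Cb_cst.
have cCb : Cb R Om (fun=> risk C f) by exact: Cb_cst.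
split; first exact: L1_upto_i.
move=> Q A SQ fA; have mA := mF (lexx 0) fA.
have null Q' B : Se Q' -> measurable B -> P B = 0%E -> Q' B = 0%E.
  by move=> [_ Q'P _]; exact: null_dominates0.
have full Q' B : Se Q' -> measurable B -> P B = 1%E -> Q' B = 1%E.
  move=> SQ' mB PB; have mCB := measurableC mB.
  have PC0 : P (~` B) = 0%E by rewrite (probability_setC P mB) PB subee.
  have := probability_setC Q' mCB.
  by rewrite setCK (null _ _ SQ' mCB PC0) sube0.
have eqQ Q' : Se Q' -> eq_until 0 Q Q'.
  move=> SQ' B fB; have mB := mF (lexx 0) fB.
  have [PB|PB] := P01 B fB.
    by rewrite (null _ _ SQ mB PB) (null _ _ SQ' mB PB).
  by rewrite (full _ _ SQ mB PB) (full _ _ SQ' mB PB).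
have Ec Q' : Se Q' -> E Q' A (i (fun=> risk C f)) = risk C f * fine (Q' A).
  move=> SQ'; have CQ' := SeC SQ'.
  by rewrite (evaluation_i L1_C)// Rintegral_cst.
have Ef Q' : Se Q' -> E Q' A (- i f) = \int[Q']_(w in A) (- f w).
  move=> SQ'; have CQ' := SeC SQ'.
  rewrite (evaluationN L1_C)// (evaluation_i L1_C)// RintegralN//.
  exact: Cb_integrable.
have [PA|PA] := P01 A fA.
  have E0 Q' W : Se Q' -> E Q' A W = 0.
    by move=> SQ'; apply: (evaluation_null L1_C) => //; [exact: SeC|exact: null].
  split=> [Q' SQ' _|e e0]; first by rewrite !E0.
  by exists Q => //; rewrite !E0// add0r ltW.
have EfT Q' : Se Q' -> E Q' A (- i f) = \int[Q']_w (- f w).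
  move=> SQ'; rewrite Ef// (Rintegral_setC mA); last exact/Cb_integrable/CbN.
  rewrite [X in _ + X]Rintegral_null ?addr0//; [exact: measurableC| |].
    by rewrite (probability_setC Q' mA) (full _ _ SQ' mA PA) subee.
  exact/Cb_integrable/CbN.
have QA : fine (Q A) = 1 by rewrite (full _ _ SQ mA PA).
rewrite Ec// QA mulr1; split=> [Q' SQ' _|e e0].
  by rewrite EfT//; apply: risk_ge => //; exact: SeC.
have [Q' SQ' h] := risk_lt C_convex P_risk Se0 fC e0.
by exists Q' => //; [split=> //; exact: eqQ|rewrite EfT//; lra].
Qed.

Lemma conditional_risk_factorizes :
  (forall A, filtration Om 0 A -> P A = 0%E \/ P A = 1%E) ->
  factorizes i (risk C) rhos.
Proof.
move=> P01; split.
- by move=> s X; exact: conditional_risk_upto.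
- by move=> s X Y; exact: conditional_risk_monotone.
- by move=> s X Y; exact: conditional_risk_translation.
- by move=> s X Y; exact: conditional_risk_subadditive.
- by move=> s a X; exact: conditional_risk_homogeneous.
- by move=> r s X; exact: conditional_risk_consistent.
- by move=> s f X; exact: conditional_risk_local.
- by move=> f; exact: conditional_risk_initial.
Qed.

End operators.

End conditional_risk.

Lemma path_space_observation (R : realType) (d : nat) (Om : path_space R) :
  Om = continuous_paths R d \/ Om = cadlag_paths R d -> observation Om.
Proof.
case=> ->; first exact: continuous_paths_observation.
exact: cadlag_paths_observation.
Qed.

Theorem theorem5 (R : realType) (d : nat) (Om : path_space R)
  (Om_paths : Om = continuous_paths R d \/ Om = cadlag_paths R d)
  (C : set (probability (Borel Om) R))
  (C_stable : stable C) (C_convex : convex_probs C)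
  (C_compact : compact (C : set (weak_prob Om)))
  (L : completeNormedModType R) (i : (Om -> R) -> L)
  (L1_C : is_completion (capacity (risk C)) i)
  (P : probability (Borel Om) R)
  (P_canonical : canonical_class i P)
  (P_trivial : forall A, filtration Om 0 A -> P A = 0%E \/ P A = 1%E)
  (P_risk : forall X, Cb R Om X -> risk C X = risk (dominated C P) X)
  (D : R -> set (Om -> R))
  (D_Cb : forall s, 0 <= s -> D s `<=` Cb R Om)
  (D_dense : forall s, 0 <= s -> forall f, Cb R Om f ->
     forall e : R, 0 < e ->
     exists2 g, D s g & capacity (risk C) (fun w => f w - g w) < e)
  (rho_ : R -> (Om -> R) -> L)
  (rho_D : forall s, 0 <= s -> forall X, D s X ->
     L1_upto i s (rho_ s X) /\
     exists2 y : Om -> R, L1_class i P (rho_ s X) y &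
       is_ess_sup P
         [set z | exists2 Q : probability (Borel Om) R,
            [/\ dominated C P Q, Q `<< P & P `<< Q] &
            is_cond_exp Q (filtration Om s) (fun w => (- X w)%:E) z] y) :
  exists rhos : R -> L -> L,
    [/\ forall s, 0 <= s -> forall X, D s X -> rhos s (i X) = rho_ s X,
        forall s, 0 <= s -> forall X, L1_upto i s (rhos s X),
        factorizes i (risk C) rhos &
        forall r s, 0 <= r -> r <= s ->
          forall X, rhos r X = rhos r (- rhos s X)].
Proof.
have obs := path_space_observation Om_paths.
have Se0 : equivalent_models C P !=set0.
  (* Without equivalent models the family at time 0 is empty, every measurable function bounds it,
     and minimality would give [y <= y - 1] almost surely. *)
  have [g Dg _] := D_dense _ (lexx 0) _ (Cb_cst Om 0) _ ltr01.
  have [_ [y _ [my _ ymin]]] := rho_D _ (lexx 0) _ Dg.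
  apply: contrapT => Sempty.
  have my1 : measurable_fun setT ((fun w => y w - 1) : Borel Om -> R).
    exact: measurable_funB.
  have [z [Q [[CQ _] QP PQ] _]|N [mN N0 yN]] := ymin _ my1.
    by exfalso; apply: Sempty; exists Q.
  suff : (P setT <= P N)%E by rewrite probability_setT N0 lee_fin ler10.
  by apply: le_measure; rewrite ?inE// => w _; apply: yN => /=; lra.
have vD s : 0 <= s -> forall f, D s f -> time_value C P i s (i f) (rho_ s f).
  move=> s0 f Df; have [sY [y Yy yE]] := rho_D s s0 f Df.
  exact: (time_value_i obs C_stable L1_C s0 (D_Cb s s0 f Df) sY Yy yE).
have rho_fact := conditional_risk_factorizes obs C_convex C_stable L1_C P_risk
  Se0 D_Cb D_dense vD P_trivial.
exists (conditional_risk C P i); split=> //.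
- move=> s s0 X DX; exact: (conditional_risk_D obs C_convex C_stable L1_C P_risk
    Se0 D_Cb D_dense vD).
- by move=> s s0 X; exact: (factor_range rho_fact).
- by move=> r s r0 rs X; apply: (factor_consistent rho_fact); rewrite r0.
Qed.
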